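(* Let $\mathscr N(\mathscr O,\mathscr E)$ be the set of real numbers that are normal in every odd integer base $b\ge 3$ and not normal in any even integer base $b\ge 2$. There exists a Borel probability measure $\mu$ on $[0,1)$ supported on $\mathscr N(\mathscr O,\mathscr E)$, i.e. $\mu\bigl(\mathscr N(\mathscr O,\mathscr E)\cap[0,1)\bigr)=1$, that is Rajchman ($\widehat\mu(n)\to 0$ as $|n|\to\infty$) and has the following property: for every $\kappa>0$ there exists $C_\kappa>0$ such that $$|\widehat{\mu}(n)|\le (\log\log|n|)^{-1+\kappa}\qquad\text{for all } n\in\mathbb Z \text{ with } |n|\ge C_\kappa .$$ Consequently, $\mathscr N(\mathscr O,\mathscr E)$ (that is, $\mathscr N(\mathscr O,\mathscr E)\cap[0,1)$) is a set of multiplicity.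
   Context: Write $e(y)=e^{2\pi i y}$. For an integer $b\ge2$, a real number $x$ is $b$-normal (normal in base $b$) if for every $k\ge1$ every block of $k$ digits from $\{0,\dots,b-1\}$ occurs in the base-$b$ digit expansion of the fractional part of $x$ with limiting frequency $b^{-k}$. $\widehat\mu(n)=\int e(xn)\,d\mu(x)$ for $n\in\mathbb Z$. A Borel measure on $[0,1)$ is Rajchman if its Fourier coefficients tend to $0$ as $|n|\to\infty$. A set $E\subseteq[0,1)$ is a set of uniqueness if every complex trigonometric series $\sum_{n\in\mathbb Z}a_n e(nx)$ that converges to $0$ (in the sense of symmetric partial sums $\sum_{|n|\le M}$, $M\to\infty$) at every point of $[0,1)\setminus E$ has $a_n=0$ for all $n\in\mathbb{Z}$; otherwise $E$ is a set of multiplicity. *)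

(* Defs.v *)
From HB Require Import structures.
From mathcomp Require Import all_boot all_order all_algebra.
From mathcomp Require Import all_classical all_reals all_analysis.
From mathcomp Require Import complex.

Set Implicit Arguments.
Unset Strict Implicit.
Unset Printing Implicit Defensive.

Import Order.TTheory GRing.Theory Num.Theory.
Import numFieldNormedType.Exports.

Local Open Scope classical_set_scope.
Local Open Scope ring_scope.
Local Open Scope complex_scope.

Definition frac_part {R : realType} (x : R) : R := x - (Num.floor x)%:~R.

(* The digits of [frac_part x] are numbered from 0: [digit b x j] is the
   coefficient of b^-(j+1), in the expansion that does not end in b-1 repeated.
   The floor is nonnegative, so the absolute value only casts it to nat. *)
Definition digit {R : realType} (b : nat) (x : R) (j : nat) : nat :=
  (`|Num.floor (b%:R ^+ j.+1 * frac_part x)| %% b)%N.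

(* Number of (possibly overlapping) occurrences of the block [w] that start
   among the first [N] digits. *)
Definition block_count {R : realType} (b : nat) (x : R) (k : nat)
    (w : k.-tuple 'I_b) (N : nat) : nat :=
  (\sum_(j < N) [forall i : 'I_k, digit b x (j + i) == tnth w i :> nat])%N.

Definition normal_in_base {R : realType} (b : nat) (x : R) : Prop :=
  forall (k : nat) (w : k.-tuple 'I_b), (1 <= k)%N ->
    ((block_count x w N)%:R / N%:R : R) @[N --> \oo] --> (b%:R ^- k : R).

Definition normal_odd_not_even (R : realType) : set R :=
  [set x | (forall b : nat, (3 <= b)%N -> odd b -> normal_in_base b x) /\
           (forall b : nat, (2 <= b)%N -> ~~ odd b -> ~ normal_in_base b x)].

Arguments normal_odd_not_even : clear implicits.

(* e2pi y = exp(2 pi i y) *)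
Definition e2pi {R : realType} (y : R) : R[i] :=
  cos (2 * pi * y) +i* sin (2 * pi * y).

(* The integral of the complex function x |-> e2pi (x n), taken on its real and
   imaginary parts. *)
Definition fourier_coef {R : realType} (mu : probability (measurableTypeR R) R)
    (n : int) : R[i] :=
  (\int[mu]_(x in `[0%R, 1%R[) complex.Re (e2pi (x * n%:~R)))%R +i*
  (\int[mu]_(x in `[0%R, 1%R[) complex.Im (e2pi (x * n%:~R)))%R.

Definition rajchman {R : realType} (mu : probability (measurableTypeR R) R) :
    Prop :=
  forall eps : R, 0 < eps ->
    exists M : nat, forall n : int, (M <= `|n|)%N ->
      `|fourier_coef mu n| < eps%:C.

(* Symmetric partial sum over |n| <= M, reindexed by n = k - M. *)
Definition trig_partial_sum {R : realType} (a : int -> R[i]) (x : R) (M : nat) :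
    R[i] :=
  \sum_(k < (2 * M).+1)
    a (k%:Z - M%:Z) * e2pi ((k%:Z - M%:Z)%:~R * x).

Definition set_of_uniqueness {R : realType} (E : set R) : Prop :=
  (E `<=` `[0, 1[) /\
  forall a : int -> R[i],
    (forall x : R, (`[0, 1[ `\` E) x ->
       trig_partial_sum a x M @[M --> \oo] --> (0 : R[i]^o)) ->
    forall n : int, a n = 0.

Definition set_of_multiplicity {R : realType} (E : set R) : Prop :=
  (E `<=` `[0, 1[) /\ ~ set_of_uniqueness E.

(* Main.v *)
Require Import Defs.
From HB Require Import structures.
From mathcomp Require Import all_boot all_order all_algebra.
From mathcomp Require Import all_classical all_reals all_analysis.
From mathcomp Require Import measurable_realfun.
From mathcomp Require Import complex.
From mathcomp Require Import ring lra zify.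

(** The measure is an infinite Riesz product of factors
    [1 - p_i + p_i F_(K_i) (A_i x)], where [F_K] is the Fejer kernel, the [A_i]
    are rapidly growing powers of 2, and [p_i = 2 / (i + 2)].  The gaps between
    the scales make the factors behave like independent ones, and a Fourier
    coefficient at a frequency of the i-th range is at most [p_i], which is
    about [(log log n)^-1] up to a factor [log log log n].

    As the [p_i] have a divergent sum, almost every [x] is infinitely often at a
    peak of a factor; then [A_i x] is so close to an integer that a long run of
    binary digits of [x] is constant, and so is a positive proportion of the
    first digits of [x] in every even base.

    For odd [b], [h (b^j - b^l)] is divisible by a high power of 2 for few pairs
    [(j, l)] only, whereas the frequencies of the measure are close to multiples
    of every [A_i].  This makes the second moments of the Weyl sums of [h b^j x]
    summable along the lengths [2^p m], and normality follows by Borel-Cantelli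
    and Weyl's criterion.

    For multiplicity, restrict the measure to a closed subset [K] of the set, of
    positive mass.  By a Riemann-Lebesgue argument, which only uses that the
    Fourier coefficients of the measure tend to 0, the Fourier series of the
    restriction converges to 0 at every point outside [K], though its constant
    term is the mass of [K]. *)

Import Order.TTheory GRing.Theory Num.Theory.
Import numFieldNormedType.Exports.

Set Implicit Arguments.
Unset Strict Implicit.
Unset Printing Implicit Defensive.

Local Open Scope classical_set_scope.
Local Open Scope ring_scope.

(** * Cosine polynomials *)

(** The two goals pull against each other: the factor at [scaleA i] puts Fourier mass of size
    [weight i] near that frequency, so the weights must tend to 0, but spikes recur almost surely
    only if their sum diverges. The rate moreover needs log log n to be of order i log i in the i-th
    range, which the factorial growth of [scale_exp] provides, while the run of constant digits at a
    spike has to outlast all earlier digits. Powers of 2 serve both kinds of base: [b ^ N] is a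
    multiple of [2 ^ N] for even [b], whereas the powers of an odd [b] meet each residue modulo
    [2 ^ n] only rarely. Integration of polynomials is replaced by algebra on finite lists: the
    constant coefficient [mean] stands for the integral, and inequalities between means come from
    the mean value theorem applied to antiderivatives. Nor is the measure a weak limit: the
    antiderivatives of the partial products converge uniformly, at a geometric rate, to a continuous
    distribution function, and cosine integrals are recovered from it by Riemann-Stieltjes sums. *)

Section trig.
Context {R : realType}.
Implicit Types (s u : seq (int * R)) (x y th : R).

Lemma cos_intD (n : int) x : cos (x + 2 * pi * n%:~R) = cos x.
Proof.
have H (m : nat) (z : R) : cos (z + 2 * pi * m%:R) = cos z.
  rewrite -[RHS](periodicn (@cosD2pi R) m); congr (cos (_ + _)).
  by rewrite -[RHS]mulr_natr -[pi *+ 2]mulr_natl.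
case: n => n; first exact: H.
by rewrite NegzE mulrNz -[LHS](H n.+1) mulrN -pmulrn subrK.
Qed.

Lemma sin_intD (n : int) x : sin (x + 2 * pi * n%:~R) = sin x.
Proof. by rewrite -!cosBpihalf addrAC cos_intD. Qed.

(* A list of pairs [(n, c)] stands for the sum of the [c * cos (2 pi n x)];
   [th] is a phase added to every term, [cmul] is the product-to-sum formula,
   and [mean] is the integral over a period. *)
Definition ev th s x : R := \sum_(t <- s) t.2 * cos (2 * pi * (t.1%:~R * x) + th).

Definition mean s : R := \sum_(t <- s | t.1 == 0) t.2.

Definition cmul s u : seq (int * R) :=
  [seq (a.1 + b.1, a.2 * b.2 / 2) | a <- s, b <- u] ++
  [seq (a.1 - b.1, a.2 * b.2 / 2) | a <- s, b <- u].

Definition cscl (c : R) s : seq (int * R) := [seq (t.1, c * t.2) | t <- s].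

Definition prim th s x : R := \sum_(t <- s) t.2 *
  (if t.1 == 0 then cos th * x
   else sin (2 * pi * (t.1%:~R * x) + th) / (2 * pi * t.1%:~R)).

Lemma sum_cmul (h : int * R -> R) s u :
  \sum_(t <- cmul s u) h t = \sum_(a <- s) \sum_(b <- u)
     (h (a.1 + b.1, a.2 * b.2 / 2) + h (a.1 - b.1, a.2 * b.2 / 2)).
Proof.
rewrite /cmul big_cat /= !big_allpairs_dep -big_split /=.
by apply: eq_bigr => a _; rewrite -big_split.
Qed.

Lemma ev_cmul th s u x : ev th (cmul s u) x = ev th s x * ev 0 u x.
Proof.
rewrite /ev sum_cmul mulr_suml; apply: eq_bigr => a _.
rewrite mulr_sumr; apply: eq_bigr => b _ /=.
rewrite intrD intrB addr0.
set p := 2 * pi * (a.1%:~R * x) + th; set q := 2 * pi * (b.1%:~R * x).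
have -> : 2 * pi * ((a.1%:~R + b.1%:~R) * x) + th = p + q by rewrite /p /q; ring.
have -> : 2 * pi * ((a.1%:~R - b.1%:~R) * x) + th = p - q by rewrite /p /q; ring.
rewrite cosD cosB; lra.
Qed.

Lemma ev_cat th s u x : ev th (s ++ u) x = ev th s x + ev th u x.
Proof. by rewrite /ev big_cat. Qed.

Lemma ev_cscl th c s x : ev th (cscl c s) x = c * ev th s x.
Proof.
by rewrite /ev big_map mulr_sumr; apply: eq_bigr => t _ /=; rewrite mulrA.
Qed.

Lemma ev_seq1 th n c x : ev th [:: (n, c)] x = c * cos (2 * pi * (n%:~R * x) + th).
Proof. by rewrite /ev big_seq1. Qed.

Lemma mean_cat s u : mean (s ++ u) = mean s + mean u.
Proof. by rewrite /mean big_cat. Qed.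

Lemma mean_cscl c s : mean (cscl c s) = c * mean s.
Proof. by rewrite /mean big_map mulr_sumr. Qed.

Lemma pi_neq0 : (pi : R) != 0. Proof. by rewrite gt_eqF // pi_gt0. Qed.

Lemma is_derive_prim th s x : is_derive x 1 (prim th s) (ev th s x).
Proof.
have -> : prim th s = \sum_(t <- s) (fun x => t.2 *
  (if t.1 == 0 then cos th * x
   else sin (2 * pi * (t.1%:~R * x) + th) / (2 * pi * t.1%:~R))).
  by apply/funext => y; rewrite fct_sumE.
rewrite /ev; elim: s => [|t s IH].
  by rewrite !big_nil; exact: is_derive_cst.
rewrite !big_cons; apply: is_deriveD.
have [t0|t0] := eqVneq t.1 0.
  rewrite t0 mul0r mulr0 add0r.
  have -> : (fun x => t.2 * (cos th * x)) = (t.2 * cos th) \*: (@id R).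
    by apply/funext => y /=; rewrite /GRing.scale /= mulrA.
  by apply: is_derive_eq; rewrite /GRing.scale /= mulr1.
have t0' : t.1%:~R != 0 :> R by rewrite intr_eq0.
have := pi_neq0 => p0.
set k : R := t.1%:~R.
have -> : (fun x => t.2 * (sin (2 * pi * (k * x) + th) / (2 * pi * k))) =
  (t.2 / (2 * pi * k)) \*: (sin \o (fun x => 2 * pi * k * x + th)).
  apply/funext => y /=; rewrite /GRing.scale /= mulrA.
  by rewrite mulrAC; congr (_ * sin (_ + _)); ring.
have d1 : is_derive x 1 (fun x => 2 * pi * k * x + th) (2 * pi * k).
  have -> : (fun x => 2 * pi * k * x + th) = (2 * pi * k) \*: (@id R) + cst th.
    by apply/funext => y /=.
  by apply: is_derive_eq; rewrite addr0 /GRing.scale /= mulr1.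
have d2 := @is_derive1_comp R sin (fun x => 2 * pi * k * x + th) x _ _ (is_derive_sin _) d1.
apply: (@is_derive_eq _ _ _ _ _ _ _ _ (is_deriveZ (t.2 / (2 * pi * k)) d2)).
rewrite /GRing.scale /=.
rewrite -[X in cos (X + th)]mulrA.
move: (cos _) => C; move: (t.2) t0' => c; rewrite -/k.
by move: (k) (pi) p0 => K P p0 t0'; field; rewrite t0' p0.
Qed.

Lemma prim00 s : prim 0 s 0 = 0.
Proof.
rewrite /prim big1 // => t _; rewrite !mulr0 add0r sin0 mul0r.
by case: ifP; rewrite mulr0.
Qed.

(** Terms of nonzero frequency have antiderivatives of period 1, so only the constant term
    survives. *)
Lemma prim1B0 th s : prim th s 1 - prim th s 0 = cos th * mean s.
Proof.
rewrite /prim /mean -sumrB mulr_sumr [RHS]big_mkcond; apply: eq_bigr => t _ /=.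
case: ifP => t0; first by rewrite mulr1 mulr0 mulr0 subr0 mulrC.
by rewrite mulr1 !mulr0 add0r [_ + th]addrC sin_intD subrr.
Qed.

Lemma is_derive_continuous (f : R -> R) (x d : R) :
  is_derive x 1 f d -> {for x, continuous f}.
Proof. by move=> h; apply/differentiable_continuous/derivable1_diffP/ex_derive. Qed.

Lemma is_derive_nondecr (f f' : R -> R) (a b : R) : a <= b ->
  (forall x, is_derive x 1 f (f' x)) ->
  (forall x, a <= x <= b -> 0 <= f' x) -> f a <= f b.
Proof.
rewrite le_eqVlt => /orP[/eqP -> //|ab] df f'0.
have [c cab ] := @MVT R f f' a b ab (fun x _ => df x)
  (continuous_subspaceT (fun x => is_derive_continuous (df x))).
move=> e; rewrite -subr_ge0 e mulr_ge0 ?subr_ge0 ?(ltW ab) // f'0 //.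
by move: cab; rewrite in_itv /= => /andP[/ltW -> /ltW ->].
Qed.

Lemma mean_ge0 s : (forall x, 0 <= ev 0 s x) -> 0 <= mean s.
Proof.
move=> h; have := prim1B0 0 s; rewrite cos0 mul1r => <-.
rewrite subr_ge0; apply: (@is_derive_nondecr _ (ev 0 s)) => // x.
exact: is_derive_prim.
Qed.

Lemma mean_le s u : (forall x, ev 0 s x <= ev 0 u x) -> mean s <= mean u.
Proof.
move=> h; rewrite -subr_ge0 -[X in _ - X]mul1r -mulNr -mean_cscl -mean_cat.
by apply: mean_ge0 => x; rewrite ev_cat ev_cscl mulN1r subr_ge0.
Qed.

(** Lists have no normal form; products are regrouped by comparing values pointwise and passing to
    means. *)
Lemma mean_eq s u : (forall x, ev 0 s x = ev 0 u x) -> mean s = mean u.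
Proof. by move=> h; apply/eqP; rewrite eq_le !mean_le // => x; rewrite h. Qed.

Definition deg_le (r : nat) s := all (fun t => (`|t.1| <= r)%N) s.
Definition mult_of (A : nat) s := all (fun t => (A %| `|t.1|)%N) s.

(** A frequency of [u] is 0 or at least [A] in modulus, so it can cancel a frequency of [s] only if
    both are 0. This is the independence of factors at separated scales. *)
Lemma mean_cmul r A s u : deg_le r s -> mult_of A u -> (r < A)%N ->
  mean (cmul s u) = mean s * mean u.
Proof.
move=> /allP ds /allP mu rA; rewrite /mean big_mkcond sum_cmul.
rewrite [in RHS]big_mkcond mulr_suml; apply: eq_big_seq => a /ds /= da.
rewrite [in RHS]big_mkcond mulr_sumr; apply: eq_big_seq => b /mu /= mb.
have [a0|a0] := eqVneq a.1 0; have [b0|b0] := eqVneq b.1 0.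
- by rewrite a0 b0 /=; lra.
- by rewrite a0 add0r sub0r oppr_eq0 (negbTE b0) mulr0 addr0.
- by rewrite b0 oppr0 addr0 (negbTE a0) mul0r addr0.
have lb : (A <= `|b.1|)%N by apply: dvdn_leq; rewrite ?absz_gt0.
have -> : (a.1 + b.1 == 0) = false.
  by apply/eqP => e; move: (a.1) (b.1) e da lb {mb b0 a0} => k l; lia.
have -> : (a.1 - b.1 == 0) = false.
  by apply/eqP => e; move: (a.1) (b.1) e da lb {mb b0 a0} => k l; lia.
by rewrite mul0r addr0.
Qed.

Lemma deg_le_cmul r r' s u : deg_le r s -> deg_le r' u -> deg_le (r + r') (cmul s u).
Proof.
move=> /allP ds /allP du; rewrite /deg_le all_cat; apply/andP; split;
  apply/allP => _ /allpairsP[[a b] [/= /ds da /du db ->]] /=; lia.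
Qed.

Lemma mult_of_cmul A s u : mult_of A s -> mult_of A u -> mult_of A (cmul s u).
Proof.
move=> /allP ds /allP du; rewrite /mult_of all_cat; apply/andP; split;
  apply/allP => _ /allpairsP[[a b] [/= /ds da /du db ->]] /=.
  by suff: (A%:Z %| (a.1 + b.1)%R)%Z by []; exact: rpredD.
by suff: (A%:Z %| (a.1 - b.1)%R)%Z by []; exact: rpredB.
Qed.

End trig.

(** * Fejer kernels, the factors of the product, spikes *)

Section fejer.
Context {R : realType}.
Implicit Types (x t : R) (A K : nat).

Definition csum K t : R := \sum_(j < K) cos (j%:R * t).
Definition ssum K t : R := \sum_(j < K) sin (j%:R * t).

(** The right side is the squared modulus of the sum of the e^(ijt), j < K, and the left side groups
    its K^2 products by difference. Passing to K + 1 adds 1 and the products with the new term. *)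
Lemma fejer_sum K t :
  K%:R + \sum_(d < K) 2 * (K%:R - d.+1%:R) * cos (d.+1%:R * t) =
  csum K t ^+ 2 + ssum K t ^+ 2.
Proof.
elim: K => [|K IH]; first by rewrite /csum /ssum !big_ord0 expr0n !addr0.
have -> : csum K.+1 t ^+ 2 + ssum K.+1 t ^+ 2 =
    csum K t ^+ 2 + ssum K t ^+ 2 + 1 + 2 * \sum_(d < K) cos (d.+1%:R * t).
  rewrite /csum /ssum !big_ord_recr /=.
  have -> : \sum_(d < K) cos (d.+1%:R * t) =
      csum K t * cos (K%:R * t) + ssum K t * sin (K%:R * t).
    rewrite /csum /ssum !mulr_suml -big_split /=.
    rewrite (reindex_inj rev_ord_inj) /=; apply: eq_bigr => j _.
    rewrite -cosB -mulrBl -[RHS]cosN -mulNr opprB; congr (cos (_ * _)).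
    by rewrite -natrB ?(ltnW (ltn_ord j)) // subnSK.
  have := cos2Dsin2 (K%:R * t); rewrite -/(csum K t) -/(ssum K t).
  move: (cos _) (sin _) (csum _ _) (ssum _ _) => a b c d.
  nra.
rewrite -IH big_ord_recr /= subrr mulr0 mul0r addr0.
have -> : \sum_(i < K) 2 * (K.+1%:R - i.+1%:R) * cos (i.+1%:R * t) =
    \sum_(i < K) 2 * (K%:R - i.+1%:R) * cos (i.+1%:R * t) +
    2 * \sum_(i < K) cos (i.+1%:R * t).
  rewrite mulr_sumr -big_split; apply: eq_bigr => i _ /=.
  rewrite -[K.+1%:R]natr1; move: (cos _) => c; ring.
rewrite -[K.+1%:R]natr1; ring.
Qed.

(** With z = e^(it), this is the squared modulus of (z - 1)(1 + ... + z^(K-1)) = z^K - 1, whose real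
    and imaginary parts are [e1] and [e2]; a common factor 2 is dropped. *)
Lemma csum_ssum_eq K t :
  (csum K t ^+ 2 + ssum K t ^+ 2) * (1 - cos t) = 1 - cos (K%:R * t).
Proof.
have e1 : csum K t * (cos t - 1) - ssum K t * sin t = cos (K%:R * t) - 1.
  elim: K => [|K IH]; first by rewrite /csum /ssum !big_ord0 !mul0r cos0 !subrr.
  rewrite /csum /ssum !big_ord_recr /= -/(csum K t) -/(ssum K t).
  rewrite -[K.+1%:R]natr1 [(K%:R + 1) * t]mulrDl mul1r cosD.
  by move: IH; move: (cos _) (cos _) (sin _) (sin _) (csum _ _) (ssum _ _) => a b c d e f; lra.
have e2 : csum K t * sin t + ssum K t * (cos t - 1) = sin (K%:R * t).
  elim: K {e1} => [|K IH]; first by rewrite /csum /ssum !big_ord0 !mul0r sin0 addr0.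
  rewrite /csum /ssum !big_ord_recr /= -/(csum K t) -/(ssum K t).
  rewrite -[K.+1%:R]natr1 [(K%:R + 1) * t]mulrDl mul1r sinD.
  by move: IH; move: (cos _) (cos _) (sin _) (sin _) (csum _ _) (ssum _ _) => a b c d e f; lra.
have h1 := cos2Dsin2 t; have h2 := cos2Dsin2 (K%:R * t).
have : (csum K t * (cos t - 1) - ssum K t * sin t) ^+ 2 +
  (csum K t * sin t + ssum K t * (cos t - 1)) ^+ 2 =
  (csum K t ^+ 2 + ssum K t ^+ 2) * ((cos t ^+ 2 + sin t ^+ 2) + 1 - 2 * cos t).
  by move: (csum K t) (ssum K t) (cos t) (sin t) => a b c d; ring.
rewrite e1 e2 h1 => e.
have : (cos (K%:R * t) - 1) ^+ 2 + sin (K%:R * t) ^+ 2 =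
  (cos (K%:R * t) ^+ 2 + sin (K%:R * t) ^+ 2) + 1 - 2 * cos (K%:R * t).
  by move: (cos _) (sin _) => a b; ring.
rewrite h2 e; move: (cos _) (cos _) (_ + _) => a b c h.
lra.
Qed.

(* [1 + ev 0 (fejer A K)] is the Fejer kernel of order [K], dilated by [A]. *)
Definition fejer A K : seq (int * R) :=
  [seq (A%:Z * d.+1%:Z, 2 * (1 - d.+1%:R / K%:R)) | d <- iota 0 K].

Lemma ev_fejer A K x : (0 < K)%N -> 1 + ev 0 (fejer A K) x =
  (csum K (2 * pi * (A%:R * x)) ^+ 2 + ssum K (2 * pi * (A%:R * x)) ^+ 2) / K%:R.
Proof.
move=> K0; have K0' : K%:R != 0 :> R by rewrite pnatr_eq0 -lt0n.
rewrite -fejer_sum mulrDl divff // mulr_suml; congr (_ + _).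
rewrite /ev big_map -[K in iota 0 K]subn0 -/(index_iota 0 K) big_mkord.
apply: eq_bigr => d _ /=; rewrite addr0 intrM.
set c1 := cos _; set c2 := cos _.
have -> : c1 = c2.
  rewrite /c1 /c2 -!pmulrn; congr cos.
  by move: (A%:R) (d.+1%:R) => a b; ring.
move: c2 (d.+1%:R : R) (K%:R : R) K0' => c e k k0; by field.
Qed.

Lemma fejer_ge0 A K x : (0 < K)%N -> 0 <= 1 + ev 0 (fejer A K) x.
Proof. by move=> K0; rewrite ev_fejer // divr_ge0 ?addr_ge0 ?sqr_ge0. Qed.

(** The closed form of the kernel, kept free of division since 1 - cos may vanish. *)
Lemma fejer_cos A K x : (0 < K)%N ->
  (1 + ev 0 (fejer A K) x) * (1 - cos (2 * pi * (A%:R * x))) =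
  (1 - cos (2 * pi * ((A * K)%:R * x))) / K%:R.
Proof.
move=> K0; rewrite ev_fejer // mulrAC csum_ssum_eq natrM.
congr ((1 - cos _) / _); move: (A%:R) (K%:R) => a k; ring.
Qed.

Lemma mult_of_fejer A K : mult_of A (fejer A K).
Proof. by apply/allP => _ /mapP[d _ ->] /=; rewrite ?abszM dvdn_mulr. Qed.

Lemma deg_le_fejer A K : deg_le (A * K) (fejer A K).
Proof.
apply/allP => _ /mapP[d + ->] /=; rewrite mem_iota add0n => /andP[_ dK].
by rewrite ?abszM leq_mul2l; apply/orP; right.
Qed.

Lemma mean_eq0 (s : seq (int * R)) : all (fun t : int * R => t.1 != 0) s -> mean s = 0.
Proof.
move=> /allP s0; rewrite /mean big_seq_cond big1 // => a /andP[/s0 /negbTE -> //].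
Qed.

Lemma mean_fejer A K : (0 < A)%N -> mean (fejer A K) = 0.
Proof.
move=> A0; apply/mean_eq0/allP => _ /mapP[d _ ->] /=.
by rewrite mulf_neq0 // eqz_nat -lt0n.
Qed.

Definition cone : seq (int * R) := [:: (0, 1)].

Lemma ev_cone th x : ev th cone x = cos th.
Proof. by rewrite ev_seq1 mul0r mulr0 add0r mul1r. Qed.

Lemma mean_cone : mean cone = 1.
Proof. by rewrite /mean big_cons big_nil eqxx addr0. Qed.

Fixpoint cpow (s : seq (int * R)) n := if n is m.+1 then cmul (cpow s m) s else cone.

Lemma ev_cpow s n x : ev 0 (cpow s n) x = ev 0 s x ^+ n.
Proof. by elim: n => [|n IH]; rewrite ?ev_cone ?cos0 //= ev_cmul IH exprSr. Qed.

Lemma mult_of_cone A : mult_of A cone. Proof. by rewrite /mult_of /= dvdn0. Qed.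

Lemma mult_of_cat A (s u : seq (int * R)) : mult_of A (s ++ u) = mult_of A s && mult_of A u.
Proof. exact: all_cat. Qed.

Lemma deg_le_cat r (s u : seq (int * R)) : deg_le r (s ++ u) = deg_le r s && deg_le r u.
Proof. exact: all_cat. Qed.

Lemma mult_of_cscl A c (s : seq (int * R)) : mult_of A (cscl c s) = mult_of A s.
Proof. exact: all_map. Qed.

Lemma deg_le_cscl r c (s : seq (int * R)) : deg_le r (cscl c s) = deg_le r s.
Proof. exact: all_map. Qed.

Lemma deg_leW r r' (s : seq (int * R)) : (r <= r')%N -> deg_le r s -> deg_le r' s.
Proof. by move=> rr /allP h; apply/allP => a /h /leq_trans; apply. Qed.

Lemma mult_of_cpow A s n : mult_of A s -> mult_of A (cpow s n).
Proof. by move=> h; elim: n => [|n IH] /=; [exact: mult_of_cone|exact: mult_of_cmul]. Qed.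

Lemma deg_le_cpow r s n : deg_le r s -> deg_le (r * n) (cpow s n).
Proof.
by move=> h; elim: n => [|n IH] //=; rewrite mulnSr; exact: deg_le_cmul.
Qed.

(* [((1 + cos (2 pi A x)) / 2) ^ K], which is tiny unless [A x] is almost an
   integer; Bernoulli's inequality shows that it detects the Fejer kernel. *)
Definition spike A K := cpow [:: (0, 1 / 2); (A%:Z, 1 / 2)] K.

Lemma ev_spike A K x : ev 0 (spike A K) x = ((1 + cos (2 * pi * (A%:R * x))) / 2) ^+ K.
Proof.
rewrite ev_cpow; congr (_ ^+ _); rewrite /ev 2!big_cons big_nil /= -pmulrn.
rewrite mul0r mulr0 !addr0 cos0; move: (cos _) => c; lra.
Qed.

Lemma bernoulli (u : R) n : 0 <= u <= 1 -> 1 - n%:R * u <= (1 - u) ^+ n.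
Proof.
move=> /andP[u0 u1]; elim: n => [|n IH]; first by rewrite mul0r subr0 expr0.
rewrite exprS; apply: (@le_trans _ _ ((1 - u) * (1 - n%:R * u))).
  rewrite -[n.+1%:R]natr1; have : 0 <= n%:R * u ^+ 2 by rewrite mulr_ge0 // sqr_ge0.
  move: (n%:R) => m; nra.
by rewrite ler_wpM2l // subr_ge0.
Qed.

Definition rfactor (p : R) A K := cone ++ cscl p (fejer A K).

Lemma ev_rfactor p A K x :
  ev 0 (rfactor p A K) x = (1 - p) + p * (1 + ev 0 (fejer A K) x).
Proof. by rewrite ev_cat ev_cone cos0 ev_cscl; lra. Qed.

Lemma rfactor_ge0 p A K x : (0 < K)%N -> 0 <= p <= 1 -> 0 <= ev 0 (rfactor p A K) x.
Proof.
move=> K0 /andP[p0 p1]; rewrite ev_rfactor addr_ge0 ?subr_ge0 //.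
by rewrite mulr_ge0 // fejer_ge0.
Qed.

Lemma mean_rfactor p A K : (0 < A)%N -> mean (rfactor p A K) = 1.
Proof. by move=> A0; rewrite mean_cat mean_cscl mean_fejer // mean_cone mulr0 addr0. Qed.

Lemma mult_of_rfactor p A K : mult_of A (rfactor p A K).
Proof. by rewrite mult_of_cat mult_of_cone mult_of_cscl mult_of_fejer. Qed.

Lemma deg_le_rfactor p A K : deg_le (A * K) (rfactor p A K).
Proof. by rewrite deg_le_cat deg_le_cscl deg_le_fejer. Qed.

Definition cospike A K := cone ++ cscl (-1) (spike A K).

Lemma ev_cospike A K x : ev 0 (cospike A K) x = 1 - ev 0 (spike A K) x.
Proof. by rewrite ev_cat ev_cone cos0 ev_cscl mulN1r. Qed.

Lemma spike_ge0 A K x : 0 <= ev 0 (spike A K) x.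
Proof.
by rewrite ev_spike exprn_ge0 // divr_ge0.
Qed.

Lemma spike_le1 A K x : ev 0 (spike A K) x <= 1.
Proof.
rewrite ev_spike; apply: exprn_ile1.
  by rewrite divr_ge0.
by rewrite ler_pdivrMr //; have := cos_le1 (2 * pi * (A%:R * x)); lra.
Qed.

Lemma mult_of_spike A K : mult_of A (spike A K).
Proof. by apply: mult_of_cpow; rewrite /mult_of /= dvdn0 dvdnn. Qed.

Lemma deg_le_spike A K : deg_le (A * K) (spike A K).
Proof. by apply: deg_le_cpow; rewrite /deg_le /= leqnn. Qed.

Lemma mult_of_cospike A K : mult_of A (cospike A K).
Proof. by rewrite mult_of_cat mult_of_cone mult_of_cscl mult_of_spike. Qed.

Lemma deg_le_cospike A K : deg_le (A * K) (cospike A K).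
Proof. by rewrite deg_le_cat deg_le_cscl deg_le_spike. Qed.

(** Bernoulli's inequality bounds the cospike by K (1 - cos(2 pi A x)) / 2, and the Fejer kernel
    turns this into (1 - cos(2 pi A K x)) / 2, of mean 1/2. The rest of the factor contributes at
    most 1 - p. The list [s] is this majorant of the product. *)
Lemma mean_rfactor_cospike p A K : (0 < A)%N -> (0 < K)%N -> 0 <= p <= 1 ->
  mean (cmul (rfactor p A K) (cospike A K)) <= 1 - p / 2.
Proof.
move=> A0 K0 /andP[p0 p1].
have K0' : 0 < K%:R :> R by rewrite ltr0n.
pose s : seq (int * R) := cscl (1 - p) cone ++
  cscl (p / 2) (cone ++ cscl (-1) [:: ((A * K)%:Z, 1)]).
have -> : 1 - p / 2 = mean s.
  rewrite !(mean_cat, mean_cscl) mean_cone (mean_eq0 (s := [:: _])) ?mulr0; first lra.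
  by rewrite /= andbT eqz_nat -lt0n muln_gt0 A0 K0.
apply: mean_le => x.
rewrite ev_cmul ev_rfactor ev_cospike.
rewrite !(ev_cat, ev_cscl, ev_cone, ev_seq1) addr0 cos0 mul1r -pmulrn.
have F0 := fejer_ge0 A x K0.
have := fejer_cos A x K0.
set F := 1 + _; set c := cos (2 * pi * (A%:R * x)); set c' := cos _ => e.
have c1 : -1 <= c <= 1 by rewrite /c cos_geN1 cos_le1.
have b1 : 1 - K%:R * ((1 - c) / 2) <= ev 0 (spike A K) x.
  rewrite ev_spike -/c; have -> : (1 + c) / 2 = 1 - (1 - c) / 2 by lra.
  by apply: bernoulli; apply/andP; split; move/andP: c1 => [? ?]; lra.
have b0 := spike_ge0 A K x.
have b2 := spike_le1 A K x.
move: (ev _ _ _) b0 b1 b2 => b b0 b1 b2.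
have h : F * (1 - b) <= (1 - c') / 2.
  apply: (@le_trans _ _ (F * (K%:R * ((1 - c) / 2)))).
    by rewrite ler_wpM2l //; lra.
  have -> : F * (K%:R * ((1 - c) / 2)) = K%:R * (F * (1 - c)) / 2 by ring.
  by rewrite e mulrCA divff ?gt_eqF // mulr1.
have : (1 - p) * (1 - b) <= 1 - p.
  by rewrite ler_piMr ?subr_ge0 //; lra.
have : p * (F * (1 - b)) <= p * ((1 - c') / 2) by rewrite ler_wpM2l.
move=> h1 h2; rewrite mulrDl -[p * F * _]mulrA; move: h1 h2; move: (p * (F * _)) => w; lra.
Qed.

End fejer.

(** * The Riesz product and its measure *)

(* [scaleR i] bounds the frequencies of the first [i] factors.  As
   [2 * scaleR i < scaleA i], the spectra of successive factors do not interfere,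
   and [scaleK i] is so large that [scaleA i * x] being within [scaleK i]^(-1/2)
   of an integer determines, for large [i], the binary digits of [x] from
   [scale_exp i] to [4 * scale_exp i]. *)
Fixpoint scale_exp (i : nat) : nat := if i is j.+1 then (3 * j.+2 * scale_exp j)%N else 12.
Definition scaleA i := (2 ^ scale_exp i)%N.
Definition scaleK i := (2 ^ (i.+1 * scale_exp i))%N.
Fixpoint scaleR (i : nat) : nat :=
  if i is j.+1 then (scaleR j + 2 * (scaleA j * scaleK j))%N else 0%N.

Lemma scale_exp_ge i : (12 * i.+1 <= scale_exp i)%N.
Proof. elim: i => // i IH /=; nia. Qed.

Lemma leq_scale_exp i j : (i <= j)%N -> (scale_exp i <= scale_exp j)%N.
Proof.
move=> /subnK <-; elim: (j - i)%N => // k IH; apply: (leq_trans IH) => /=; nia.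
Qed.

Lemma scaleA_gt0 i : (0 < scaleA i)%N. Proof. by rewrite expn_gt0. Qed.
Lemma scaleK_gt0 i : (0 < scaleK i)%N. Proof. by rewrite expn_gt0. Qed.

Lemma leq_scaleR i j : (i <= j)%N -> (scaleR i <= scaleR j)%N.
Proof.
by move=> /subnK <-; elim: (j - i)%N => // k IH; apply: (leq_trans IH); exact: leq_addr.
Qed.

Lemma dvdn_scaleA i j : (i <= j)%N -> (scaleA i %| scaleA j)%N.
Proof. by move=> ij; rewrite dvdn_exp2l // leq_scale_exp. Qed.

(** [scaleR i.+1] is of the order of [scaleA i * scaleK i], a power of 2 with exponent
    [i.+2 * scale_exp i]. The factor [3 * i.+2] in the recursion of [scale_exp] pays for twice this
    exponent and the constants; the square-root gap is what later absorbs polynomial losses. *)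
Lemma scaleR_sqr i : (scaleR i ^ 2 <= scaleA i)%N.
Proof.
case: i => [|i]; first by rewrite [scaleR 0]/= exp0n.
have AK j : (scaleA j * scaleK j = 2 ^ (j.+2 * scale_exp j))%N.
  by rewrite -expnD -mulSn.
have h j : (scaleR j.+1 <= 2 ^ (2 + j.+2 * scale_exp j))%N.
  elim: j => [|j IH].
    have -> : scaleR 1 = (2 * (scaleA 0 * scaleK 0))%N by rewrite /scaleR add0n.
    by rewrite AK -expnS leq_exp2l //; lia.
  have -> : scaleR j.+2 = (scaleR j.+1 + 2 * (scaleA j.+1 * scaleK j.+1))%N by [].
  rewrite AK; apply: (@leq_trans (2 ^ (1 + j.+3 * scale_exp j.+1) + 2 ^ (1 + j.+3 * scale_exp j.+1)))%N.
    apply: leq_add; last by rewrite [in leqRHS]expnD.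
    by apply: (leq_trans IH); rewrite leq_exp2l //=; have := scale_exp_ge j; nia.
  by rewrite addnn -mul2n -expnS.
apply: (@leq_trans ((2 ^ (2 + i.+2 * scale_exp i)) ^ 2)%N); first by rewrite leq_sqr.
rewrite -expnM leq_exp2l //=; have := scale_exp_ge i; nia.
Qed.

Lemma scaleA_ge i : (4096 <= scaleA i)%N.
Proof. by rewrite (@leq_exp2l 2 12) //; have := scale_exp_ge i; lia. Qed.

Lemma scaleR_lt i : (2 * scaleR i < scaleA i)%N.
Proof. have := scaleR_sqr i; have := scaleA_ge i; nia. Qed.

Lemma scale_exp_even i : ~~ odd (scale_exp i).
Proof. by elim: i => // i IH /=; rewrite !oddM (negbTE IH) andbF. Qed.

Lemma scaleR_expn2 i : (scaleR i <= 2 ^ (scale_exp i)./2)%N.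
Proof.
rewrite -leq_sqr; apply: (leq_trans (scaleR_sqr i)).
rewrite -expnM leq_exp2l //.
by have := scale_exp_even i; lia.
Qed.

Section riesz.
Context {R : realType}.
Implicit Types (s u : seq (int * R)).

Fixpoint iprod (h : nat -> seq (int * R)) m :=
  if m is j.+1 then cmul (iprod h j) (h j) else cone.

Lemma ev_iprod h m x : ev 0 (iprod h m) x = \prod_(i < m) ev 0 (h i) x.
Proof.
by elim: m => [|m IH]; rewrite ?big_ord0 ?ev_cone ?cos0 // big_ord_recr /= ev_cmul IH.
Qed.

Lemma deg_le_iprod h m : (forall i, deg_le (2 * (scaleA i * scaleK i)) (h i)) ->
  deg_le (scaleR m) (iprod h m).
Proof. by move=> dh; elim: m => // m IH; exact: deg_le_cmul. Qed.

Lemma mean_iprod h m : (forall i, deg_le (2 * (scaleA i * scaleK i)) (h i)) ->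
  (forall i, mult_of (scaleA i) (h i)) -> mean (iprod h m) = \prod_(i < m) mean (h i).
Proof.
move=> dh mh; elim: m => [|m IH]; first by rewrite big_ord0 mean_cone.
rewrite big_ord_recr -IH /=; apply: mean_cmul (deg_le_iprod m dh) (mh m) _.
have := scaleR_lt m; lia.
Qed.

(* The sum of the weights diverges, so a.e. point is infinitely often at a spike
   of a Fejer factor; the decay of the weights is that of the Fourier
   coefficients. *)
Definition weight i : R := 2 / i.+2%:R.

Lemma weight_itv i : 0 <= weight i <= 1.
Proof.
rewrite /weight divr_ge0 //= ler_pdivrMr ?ltr0n // mul1r.
by rewrite ler_nat.
Qed.

Definition rfac i := rfactor (weight i) (scaleA i) (scaleK i).
Definition rprod := iprod rfac.

Lemma rfac_ge0 i x : 0 <= ev 0 (rfac i) x.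
Proof. exact: rfactor_ge0 (scaleK_gt0 _) (weight_itv _). Qed.

Lemma rprod_ge0 m x : 0 <= ev 0 (rprod m) x.
Proof. by rewrite ev_iprod prodr_ge0 // => i _; exact: rfac_ge0. Qed.

Lemma deg_le_rfac i : deg_le (2 * (scaleA i * scaleK i)) (rfac i).
Proof. by apply: deg_leW (deg_le_rfactor _ _ _); lia. Qed.

Lemma mult_of_rfac i : mult_of (scaleA i) (rfac i).
Proof. exact: mult_of_rfactor. Qed.

Lemma deg_le_rprod m : deg_le (scaleR m) (rprod m).
Proof. exact: deg_le_iprod deg_le_rfac. Qed.

Lemma mean_rprod m : mean (rprod m) = 1.
Proof.
rewrite mean_iprod; [|exact: deg_le_rfac|exact: mult_of_rfac].
by rewrite big1 // => i _; rewrite mean_rfactor // scaleA_gt0.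
Qed.

Definition mode (n : int) : seq (int * R) := [:: (n, 1)].

Definition rcoef m n := mean (cmul (rprod m) (mode n)).

Lemma ev_mode n x : ev 0 (mode n) x = cos (2 * pi * (n%:~R * x)).
Proof. by rewrite ev_seq1 addr0 mul1r. Qed.

Lemma mean_deg r s n : deg_le r s -> (r < `|n|)%N -> mean (cmul s (mode n)) = 0.
Proof.
move=> /allP ds rn; apply/mean_eq0; rewrite all_cat; apply/andP; split;
  apply/allP => z /allpairsP[[a b] [/= /ds /= da]];
  rewrite mem_seq1 => /eqP -> -> /=; apply/eqP; move: (a.1) da => k; lia.
Qed.

Lemma mean_cmulCA s u v : mean (cmul (cmul s u) v) = mean (cmul (cmul s v) u).
Proof. by apply: mean_eq => x; rewrite !ev_cmul mulrAC. Qed.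

Lemma deg_le_mode n : deg_le `|n| (mode n).
Proof. by rewrite /deg_le /= leqnn. Qed.

(** The new factor has mean 1, and its other frequencies are too large to meet those of [rprod m]
    shifted by [n]. Hence [rcoef m n] is already the coefficient of the limit once [scaleR m]
    reaches [n]. *)
Lemma rcoefS m n : (`|n| <= scaleR m)%N -> rcoef m.+1 n = rcoef m n.
Proof.
move=> nR; rewrite /rcoef /= mean_cmulCA.
rewrite (mean_cmul (deg_le_cmul (deg_le_rprod m) (deg_le_mode n)) (mult_of_rfac m)).
  by rewrite mean_rfactor ?mulr1 // scaleA_gt0.
have := scaleR_lt m; lia.
Qed.

Lemma rcoef_stable m k n : (`|n| <= scaleR m)%N -> rcoef (m + k) n = rcoef m n.
Proof.
move=> nR; elim: k => [|k IH]; first by rewrite addn0.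
by rewrite addnS rcoefS // (leq_trans nR) // leq_scaleR // leq_addr.
Qed.

Lemma mean_mode_le s n : (forall x, 0 <= ev 0 s x) -> `|mean (cmul s (mode n))| <= mean s.
Proof.
move=> s0; rewrite ler_norml; apply/andP; split; last first.
  apply: mean_le => x; rewrite ev_cmul ev_mode ler_piMr //; exact: cos_le1.
rewrite -[- mean s]mulN1r -mean_cscl; apply: mean_le => x.
rewrite ev_cscl ev_cmul ev_mode mulrC ler_wpM2l //; exact: cos_geN1.
Qed.

Lemma rcoef_le1 m n : `|rcoef m n| <= 1.
Proof. by rewrite -(mean_rprod m); exact/mean_mode_le/rprod_ge0. Qed.

(** The last factor is 1 - p plus p times a Fejer kernel. The part with 1 - p has no frequency [n],
    which exceeds the degree of [rprod m]; the other part is p times a coefficient of a nonnegative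
    function of mean 1. *)
Lemma rcoef_le_weight m n : (scaleR m < `|n|)%N -> `|rcoef m.+1 n| <= weight m.
Proof.
move=> nR; rewrite /rcoef /= mean_cmulCA.
set p := weight m; pose F := cone ++ fejer (R := R) (scaleA m) (scaleK m).
have -> : mean (cmul (cmul (rprod m) (mode n)) (rfac m)) =
  mean (cscl (1 - p) (cmul (rprod m) (mode n)) ++ cscl p (cmul (cmul (rprod m) F) (mode n))).
  apply: mean_eq => x; rewrite ev_cat !ev_cscl !ev_cmul ev_rfactor -/p ev_cat ev_cone cos0.
  move: (ev _ _ _) (ev _ _ _) (ev _ _ _) => a b c; ring.
have /andP[p0 p1] := weight_itv m.
rewrite mean_cat !mean_cscl (mean_deg (deg_le_rprod m) nR) mulr0 add0r normrM.
rewrite ger0_norm // ler_piMr //.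
have F0 x : 0 <= ev 0 F x by rewrite ev_cat ev_cone cos0 fejer_ge0 // scaleK_gt0.
apply: (le_trans (mean_mode_le _ _)).
  by move=> x; rewrite ev_cmul mulr_ge0 // rprod_ge0.
rewrite (mean_cmul (deg_le_rprod m) (A := scaleA m)); last 2 first.
- by rewrite mult_of_cat mult_of_cone mult_of_fejer.
- by have := scaleR_lt m; lia.
by rewrite mean_rprod mean_cat mean_cone mean_fejer ?scaleA_gt0 // addr0 mulr1.
Qed.

(* A superset of the frequencies of all the partial products. *)
Definition in_spec (n : int) := forall i,
  exists2 r : int, (`|r| <= scaleR i)%N & ((scaleA i)%:Z %| n - r)%Z.

(** The first [i] factors contribute a frequency of modulus at most [scaleR i]; each later one
    contributes a multiple of its own scale, hence of [scaleA i]. *)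
Lemma in_spec_rprod m t : t \in rprod m -> in_spec t.1.
Proof.
move=> tm i; have dm := allP (deg_le_rprod m) t tm.
have [mi|im] := leqP m i.
  by exists t.1; rewrite ?subrr ?dvdz0 // (leq_trans dm) // leq_scaleR.
move: (ltnW im) t tm dm => {}im t tm _; elim: m im t tm => [|m IH] im t tm.
  exists 0; first by [].
  by move: tm; rewrite mem_seq1 => /eqP -> /=; rewrite subrr dvdz0.
have [mi|{}im] := leqP m.+1 i.
  have := allP (deg_le_rprod m.+1) t tm => /= dm.
  by exists t.1; rewrite ?subrr ?dvdz0 // (leq_trans dm) // (leq_scaleR mi).
move: tm; rewrite /= mem_cat => /orP[|] /allpairsP[[a b] [/= am bm ->]] /=;
  have [r rR ra] := IH im a am; exists r => //;
  have bA : ((scaleA i)%:Z %| b.1)%Z by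
    exact: dvdn_trans (dvdn_scaleA (im : (i <= m)%N)) (allP (mult_of_rfac m) b bm).
- by rewrite addrAC rpredD.
- by rewrite addrAC rpredB.
Qed.

Lemma in_specN n : in_spec n -> in_spec (- n).
Proof.
move=> h i; have [r rR ra] := h i; exists (- r); first by rewrite abszN.
by rewrite opprK addrC -opprB rpredN.
Qed.

Lemma rcoef_spec m n : rcoef m n != 0 -> in_spec n.
Proof.
move=> c0; have [t tm] : exists2 t, t \in rprod m & (t.1 == n) || (t.1 == - n).
  apply/hasP; apply: contraNT c0 => /hasPn h; apply/eqP/mean_eq0.
  rewrite all_cat; apply/andP; split;
  apply/allP => z /allpairsP[[a b] [/= /h /norP[an aNn]]];
  rewrite mem_seq1 => /eqP -> -> /=; move: (a.1) an aNn => k; lia.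
by move=> /orP[/eqP <-|/eqP e]; [|rewrite -[n]opprK -e; apply: in_specN];
  exact: (in_spec_rprod tm).
Qed.

End riesz.

(** Serves to absorb powers of [scale_exp i] into a small power of [scaleA i]. *)
Lemma leq_expn_div c n : (0 < c)%N -> (n <= c * 2 ^ (n %/ c))%N.
Proof.
move=> c0; have := ltn_expl (n %/ c) (isT : (1 < 2)%N) => h.
by apply: (@leq_trans (c * (n %/ c).+1)); [rewrite mulnC ltnW // ltn_ceil|rewrite leq_mul2l h orbT].
Qed.

(** With N = [scale_exp m]: [scaleR m] costs 2^(N/2), the logarithmic factor, at most N^2, costs
    2^(N/4), and m <= N/12. These exponents add up to less than N. *)
Lemma scale_cauchy m :
  ((scaleR m).+1 * (m.+1 * scale_exp m).+1 * 2 ^ m <= 128 * scaleA m)%N.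
Proof.
have N0 := scale_exp_ge m; have hR := scaleR_expn2 m; have hd := leq_expn_div (scale_exp m) (isT : (0 < 8)%N).
rewrite /scaleA; have := scale_exp_even m; move: (scale_exp m) (scaleR m) N0 hR hd => N r N0 hR hd ev.
apply: (@leq_trans ((2 * 2 ^ N./2) * (8 * 2 ^ (N %/ 8)) ^ 2 * 2 ^ m)).
  rewrite leq_mul2r; apply/orP; right; apply: leq_mul.
    by have : (0 < 2 ^ N./2)%N; [rewrite expn_gt0|lia].
  by apply: (@leq_trans (N ^ 2)); [nia|rewrite leq_sqr].
rewrite expnMn -expnM.
have -> : (2 * 2 ^ N./2 * (8 ^ 2 * 2 ^ (N %/ 8 * 2)) * 2 ^ m =
   128 * (2 ^ N./2 * 2 ^ (N %/ 8 * 2) * 2 ^ m))%N by lia.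
rewrite -!expnD leq_mul2l leq_exp2l //; lia.
Qed.

(** * Uniform geometric convergence of the distribution functions *)

Section cauchy.
Context {R : realType}.
Implicit Types (s u : seq (int * R)) (x y th : R).

Definition l1 s : R := \sum_(t <- s) `|t.2|.
Definition invl1 s : R := \sum_(t <- s) `|t.2| / `|t.1|%:R.

Lemma l1_ge0 s : 0 <= l1 s. Proof. exact: sumr_ge0. Qed.

Lemma l1_cmul s u : l1 (cmul s u) = l1 s * l1 u.
Proof.
rewrite /l1 sum_cmul mulr_suml; apply: eq_bigr => a _.
rewrite mulr_sumr; apply: eq_bigr => b _ /=.
by rewrite !normrM [`|2^-1|]ger0_norm //; lra.
Qed.

(** The norm is multiplicative and a factor has norm at most 1 + 2 [scaleK m]; the product fits
    because [scaleR m] + 1 <= [scaleA m] and [scaleR] grows by 2 [scaleA m * scaleK m]. *)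
Lemma l1_rprod m : l1 (rprod (R := R) m) <= (scaleR m).+1%:R.
Proof.
elim: m => [|m IH]; first by rewrite /l1 big_seq1 normr1.
rewrite /= l1_cmul.
have h : l1 (rfac (R := R) m) <= (1 + 2 * scaleK m)%:R.
  have K0 := scaleK_gt0 m; rewrite /l1 big_cat big_seq1 /= normr1 !big_map.
  rewrite natrD natrM lerD2l -[X in iota 0 X]subn0 -/(index_iota 0 _) big_mkord.
  apply: (@le_trans _ _ (\sum_(d < scaleK m) 2)); last first.
    by rewrite sumr_const card_ord mulr_natr.
  apply: ler_sum => d _ /=; have /andP[w0 w1] := @weight_itv R m.
  have : 0 <= (1 - d.+1%:R / (scaleK m)%:R : R) <= 1.
    rewrite subr_ge0 ler_pdivrMr ?ltr0n // mul1r ler_nat ltn_ord /=.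
    by rewrite lerBlDr lerDl divr_ge0.
  move: (_ - _) => q /andP[q0 q1].
  rewrite normrM !ger0_norm ?mulr_ge0 //.
  rewrite mulrCA ler_piMr // mulr_ile1 //.
apply: (@le_trans _ _ ((scaleR m).+1%:R * (1 + 2 * scaleK m)%:R)).
  by apply: ler_pM => //; exact: l1_ge0.
rewrite -natrM ler_nat.
have := scaleR_lt m; have := scaleA_ge m; have := scaleK_gt0 m.
move: (scaleR m) (scaleK m) (scaleA m) => r k a; nia.
Qed.

Lemma prim_le_invl1 s x : all (fun t : int * R => t.1 != 0) s -> `|prim 0 s x| <= invl1 s.
Proof.
move=> /allP s0; rewrite /prim /invl1; apply: (le_trans (ler_norm_sum _ _ _)).
rewrite big_seq [leRHS]big_seq; apply: ler_sum => t /s0 t0.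
rewrite (negbTE t0) normrM; apply: ler_wpM2l => //.
rewrite normrM normfV normrM [`|2 * pi|]ger0_norm ?mulr_ge0 ?pi_ge0 // -intr_norm.
rewrite -natr_absz; have n0 : 0 < `|t.1|%:R :> R by rewrite ltr0n absz_gt0.
rewrite -[leRHS]mul1r ler_pM ?normr_ge0 ?invr_ge0 ?sin_max ?mulr_ge0 ?pi_ge0 //.
rewrite lef_pV2 ?posrE //; last by rewrite !mulr_gt0 ?pi_gt0.
by rewrite ler_peMl ?ler0n //; have := @pi_ge2 R; lra.
Qed.

(** A frequency of [s] is less than half of any frequency of [u], so sums and differences keep at
    least half of the modulus of the latter. *)
Lemma invl1_cmul r A s u : deg_le r s -> mult_of A u -> (2 * r < A)%N ->
  all (fun t : int * R => t.1 != 0) u -> invl1 (cmul s u) <= 2 * l1 s * invl1 u.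
Proof.
move=> /allP ds /allP mu rA /allP u0; rewrite /invl1 sum_cmul /l1 -mulrA mulr_suml mulr_sumr.
rewrite big_seq [leRHS]big_seq; apply: ler_sum => a /ds /= da.
rewrite mulr_sumr mulr_sumr.
rewrite big_seq [leRHS]big_seq; apply: ler_sum => b bu /=.
have lb : (A <= `|b.1|)%N by apply: dvdn_leq (mu b bu); rewrite absz_gt0 (u0 b bu).
have H (k : int) : (`|b.1| <= 2 * `|k|)%N -> `|k|%:R^-1 <= 2 * `|b.1|%:R^-1 :> R.
  move=> h; have b0 : (0 < `|b.1|)%N by lia.
  have k0 : (0 < `|k|)%N by lia.
  by rewrite ler_pdivlMr ?ltr0n // mulrC ler_pdivrMr ?ltr0n // -natrM ler_nat.
have h1 := H (a.1 + b.1); have h2 := H (a.1 - b.1).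
rewrite !normrM [`|2^-1|]ger0_norm // -mulrDr.
have -> : 2 * (`|a.2| * (`|b.2| / `|b.1|%:R)) =
   `|a.2| * `|b.2| / 2 * (2 * `|b.1|%:R^-1 + 2 * `|b.1|%:R^-1).
  by move: (`|a.2|) (`|b.2|) (`|b.1|%:R^-1) => p q z; field.
rewrite ler_wpM2l ?mulr_ge0 // lerD // ?h1 ?h2 //.
  by move: (a.1) (b.1) da lb {h1 h2} => k l; lia.
by move: (a.1) (b.1) da lb {h1 h2} => k l; lia.
Qed.

Lemma harmonic_expn2 L : \sum_(d < 2 ^ L) d.+1%:R^-1 <= L.+1%:R :> R.
Proof.
elim: L => [|L IH]; first by rewrite expn0 big_ord1 invr1.
rewrite expnS mul2n -addnn big_split_ord /= -[leRHS]natr1; apply: lerD => //.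
apply: (@le_trans _ _ (\sum_(i < 2 ^ L) (2 ^ L)%:R^-1)).
  by apply: ler_sum => i _; rewrite lef_pV2 ?posrE ?ltr0n ?expn_gt0 // ler_nat; lia.
by rewrite sumr_const card_ord -[_^-1 *+ _]mulr_natr mulVf // pnatr_eq0 -lt0n expn_gt0.
Qed.

Lemma invl1_fejer A L : (0 < A)%N ->
  invl1 (fejer (R := R) A (2 ^ L)) <= 2 * L.+1%:R / A%:R.
Proof.
move=> A0; have A0' : 0 < A%:R :> R by rewrite ltr0n.
rewrite /invl1 big_map -[X in iota 0 X]subn0 -/(index_iota 0 _) big_mkord.
apply: (@le_trans _ _ (2 / A%:R * \sum_(d < 2 ^ L) d.+1%:R^-1)); last first.
  by rewrite mulrAC ler_wpM2r ?invr_ge0 // ler_wpM2l // harmonic_expn2.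
rewrite mulr_sumr; apply: ler_sum => d _ /=.
have : 0 <= (1 - d.+1%:R / (2 ^ L)%:R : R) <= 1.
  rewrite subr_ge0 ler_pdivrMr ?ltr0n ?expn_gt0 // mul1r ler_nat ltn_ord /=.
  by rewrite lerBlDr lerDl divr_ge0.
move: (_ - _) => q /andP[q0 q1].
rewrite natrM invfM -[2 / _ * _]mulrA ler_wpM2r ?mulr_ge0 ?invr_ge0 //.
by rewrite ger0_norm ?mulr_ge0 // ler_piMr.
Qed.

Lemma all_neq0_fejer A K : (0 < A)%N -> all (fun t : int * R => t.1 != 0) (fejer A K).
Proof.
by move=> A0; apply/allP => _ /mapP[d _ ->] /=; rewrite mulf_neq0 // eqz_nat -lt0n.
Qed.

Definition cdf_approx m x : R := prim 0 (rprod m) x.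

(** The increment is the weight times the antiderivative of [rprod m] times the oscillating part of
    the Fejer kernel. All its frequencies are nonzero multiples of [scaleA m] up to a shift by at
    most [scaleR m], and integration divides by them: what remains is [scaleR m] times a harmonic
    sum over [scaleA m]. The constant is 4 times the 128 of [scale_cauchy]. *)
Lemma cdf_approxS m x : `|cdf_approx m.+1 x - cdf_approx m x| <= 512 / 2 ^+ m.
Proof.
set u := fejer (R := R) (scaleA m) (scaleK m).
have -> : cdf_approx m.+1 x - cdf_approx m x = @weight R m * prim 0 (cmul (rprod m) u) x.
  apply/eqP; rewrite subr_eq addrC; apply/eqP.
  rewrite /cdf_approx /= /prim !sum_cmul mulr_sumr -big_split; apply: eq_bigr => a _ /=.
  rewrite big_cat big_seq1 big_map mulr_sumr /= ?subr0 ?oppr0 !addr0; congr (_ + _).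
    by move: (a.2) (if _ then _ else _) => p q; lra.
  apply: eq_bigr => b _ /=; rewrite mulrDr.
  move: (a.2) (b.2) (@weight R m) (if _ then _ else _) (if _ then _ else _) => p q w y z.
  lra.
have /andP[w0 w1] := @weight_itv R m; have A0 := scaleA_gt0 m.
rewrite normrM ger0_norm //; apply: (@le_trans _ _ `|prim 0 (cmul (rprod m) u) x|).
  by rewrite ler_piMl.
have mu : mult_of (scaleA m) u by exact: mult_of_fejer.
have du := @deg_le_rprod R m.
have su : all (fun t : int * R => t.1 != 0) (cmul (rprod m) u).
  have := all_neq0_fejer (scaleK m) A0; rewrite -/u => /allP u0.
  rewrite all_cat; apply/andP; split;
  apply/allP => z /allpairsP[[a b] [/= /(allP du) /= da bu ->]] /=;
  have lb : (scaleA m <= `|b.1|)%N by [apply: dvdn_leq (allP mu b bu); rewrite absz_gt0 (u0 b bu)];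
  have := scaleR_lt m; move: (a.1) (b.1) da lb => k l; lia.
apply: (le_trans (prim_le_invl1 x su)).
apply: (le_trans (invl1_cmul du mu (scaleR_lt m) (all_neq0_fejer _ A0))).
apply: (@le_trans _ _ (2 * (scaleR m).+1%:R * (2 * (m.+1 * scale_exp m).+1%:R / (scaleA m)%:R))).
  apply: ler_pM => //; first by rewrite mulr_ge0 ?l1_ge0.
    by rewrite /invl1 sumr_ge0 // => t _; rewrite mulr_ge0 // invr_ge0.
    by rewrite ler_wpM2l // l1_rprod.
  exact: invl1_fejer.
have := scale_cauchy m; rewrite -(ler_nat R) !natrM natrX.
have A0' : 0 < (scaleA m)%:R :> R by rewrite ltr0n.
rewrite ler_pdivlMr ?exprn_gt0 //.
have -> (p q a b : R) : 2 * p * (2 * q / a) * b = 4 * (p * q * b) / a by move=> *; ring.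
rewrite ler_pdivrMr //; lra.
Qed.

End cauchy.

Section geometric.
Context {R : realType}.
Implicit Types (C e a b : R) (u : nat -> R).

Lemma geo_small C e : 0 < e -> exists m, C / 2 ^+ m < e.
Proof.
move=> e0; exists (Num.truncn (C / e)).+1.
rewrite ltr_pdivrMr ?exprn_gt0 // mulrC -ltr_pdivrMr //.
apply: (lt_le_trans (truncnS_gt _)); rewrite -natrX ler_nat.
exact/ltnW/ltn_expl.
Qed.

Lemma le_geo C a b : (forall m, a <= b + C / 2 ^+ m) -> a <= b.
Proof.
move=> h; apply/ler_addgt0Pr => e e0; have [m hm] := geo_small C e0.
by apply: (le_trans (h m)); rewrite lerD2l ltW.
Qed.

(* The limit of a sequence with [`|u m.+1 - u m| <= C / 2 ^+ m], which becomes
   nondecreasing once the tail bound is subtracted. *)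
Definition geo_lim C u := sup (range (fun m => u m - 2 * C / 2 ^+ m)).

Lemma geo_limP C u : (forall m, `|u m.+1 - u m| <= C / 2 ^+ m) ->
  forall m, `|geo_lim C u - u m| <= 2 * C / 2 ^+ m.
Proof.
move=> hu.
have e2 m : C / 2 ^+ m = 2 * C / 2 ^+ m - 2 * C / 2 ^+ m.+1.
  by rewrite exprS invfM; move: (2 ^+ m)^-1 => w; field.
have nd : {homo (fun m => u m - 2 * C / 2 ^+ m) : i j / (i <= j)%N >-> i <= j}.
  apply: homo_leq => //; first exact: le_trans.
  by move=> m; have := hu m; rewrite e2 ler_norml => /andP[? ?]; lra.
have ni : {homo (fun m => u m + 2 * C / 2 ^+ m) : i j / (i <= j)%N >-> j <= i}.
  apply: (@homo_leq _ _ (fun a b => b <= a)) => //.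
    by move=> a b c ab bc; exact: le_trans ab.
  by move=> m; have := hu m; rewrite e2 ler_norml => /andP[? ?]; lra.
have C0 m : 0 <= 2 * C / 2 ^+ m.
  rewrite mulr_ge0 ?invr_ge0 ?exprn_ge0 // mulr_ge0 //.
  by have := le_trans (normr_ge0 _) (hu 0%N); rewrite expr0 divr1.
have vw i j : u i - 2 * C / 2 ^+ i <= u j + 2 * C / 2 ^+ j.
  have h1 := nd _ _ (leq_maxl i j); have h2 := ni _ _ (leq_maxr i j).
  by have := C0 (maxn i j); move: h1 h2 => /=; lra.
have ub i : ubound (range (fun m => u m - 2 * C / 2 ^+ m)) (u i + 2 * C / 2 ^+ i).
  by move=> _ [j _ <-].
move=> m; rewrite ler_distl; apply/andP; split.
  by apply: ub_le_sup; [exists (u 0%N + 2 * C / 2 ^+ 0); exact: ub|exists m].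
apply: ge_sup; last exact: ub.
by exists (u 0%N - 2 * C / 2 ^+ 0); exists 0%N.
Qed.

End geometric.

Section rcdf.
Context {R : realType}.
Implicit Types (x y : R).

Definition rcdf x := geo_lim 512 (fun m => cdf_approx m x).

Lemma rcdf_approxP m x : `|rcdf x - cdf_approx m x| <= 1024 / 2 ^+ m.
Proof.
have -> : 1024 = 2 * 512 :> R by lra.
by apply: geo_limP => k; exact: cdf_approxS.
Qed.

Lemma cdf_approx_nd m x y : x <= y -> cdf_approx m x <= cdf_approx m y.
Proof.
move=> xy; apply: (is_derive_nondecr xy (fun z => is_derive_prim 0 (rprod m) z)).
by move=> z _; exact: rprod_ge0.
Qed.

Lemma rcdf_nd x y : x <= y -> rcdf x <= rcdf y.
Proof.
move=> xy; apply: (@le_geo _ 2048) => m.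
have := rcdf_approxP m x; have := rcdf_approxP m y; have := cdf_approx_nd m xy.
have -> : 2048 / 2 ^+ m = 1024 / 2 ^+ m + 1024 / 2 ^+ m :> R by rewrite -mulrDl; congr (_ / _); lra.
by rewrite !ler_distl => ? /andP[? ?] /andP[? ?]; lra.
Qed.

Lemma rcdf_const m a : (forall k, cdf_approx k a = m) -> rcdf a = m.
Proof.
move=> h; apply/eqP; rewrite eq_le; apply/andP; split;
by apply: (@le_geo _ 1024) => k; have := rcdf_approxP k a; rewrite h ler_distl => /andP[? ?]; lra.
Qed.

Lemma rcdf0 : rcdf 0 = 0.
Proof. by apply: rcdf_const => k; rewrite /cdf_approx prim00. Qed.

Lemma rcdf1 : rcdf 1 = 1.
Proof.
apply: rcdf_const => k; have := prim1B0 0 (rprod (R := R) k).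
by rewrite prim00 subr0 cos0 mul1r mean_rprod.
Qed.

Lemma rcdf_continuous : continuous rcdf.
Proof.
move=> x; apply/cvgrPdist_le => e e0.
have e3 : 0 < e / 3 by rewrite divr_gt0.
have [m hm] := geo_small 1024 e3.
have := is_derive_continuous (is_derive_prim 0 (rprod m) x).
move=> /cvgrPdist_le /(_ _ e3); apply: filterS => y.
have := rcdf_approxP m x; have := rcdf_approxP m y; rewrite -/(cdf_approx m) /cdf_approx.
move: (prim _ _ _) (prim _ _ _) => p q.
rewrite !ler_distl => /andP[? ?] /andP[? ?] /andP[? ?]; lra.
Qed.

End rcdf.

(** * Measures from distribution functions, Riemann-Stieltjes sums *)

Section measure_of_cdf.
Context {R : realType} (G : R -> R).
Hypothesis (G0 : G 0 = 0) (G1 : G 1 = 1) (Gc : continuous G) (Gnd : {homo G : x y / x <= y}).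

Definition clip_cdf (x : R) := G (Num.max 0 (Num.min x 1)).

Let nd : nondecreasing clip_cdf.
Proof.
move=> x y xy; apply: Gnd; rewrite ge_max le_max lexx /= le_max.
by rewrite le_min !ge_min xy lexx !orbT.
Qed.

Let rc : right_continuous clip_cdf.
Proof.
apply: right_continuousW => x.
apply: (@continuous_comp _ _ _ (fun x : R => Num.max 0 (Num.min x 1)) G); last exact: Gc.
have c (r : R) : {for x, continuous (cst r : R -> R^o)} by exact: cst_continuous.
have i : {for x, continuous (@id R : R -> R^o)} by [].
exact: (continuous_max (c 0) (continuous_min i (c 1))).
Qed.

HB.instance Definition _ := isCumulative.Build R _ R clip_cdf nd rc.

Let Ny0 : clip_cdf @ -oo --> (0 : R).
Proof.
apply: cvg_near_cst.
near=> x; rewrite /clip_cdf -[RHS]G0; congr G; apply/max_idPl.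
have x0 : x <= 0 by near: x; exact: nbhs_ninfty_le.
by rewrite ge_min x0.
Unshelve. all: end_near. Qed.

Let y1 : clip_cdf @ +oo --> (1 : R).
Proof.
apply: cvg_near_cst.
near=> x; rewrite /clip_cdf -[RHS]G1; congr G.
have x0 : 1 <= x by near: x; exact: nbhs_pinfty_ge.
by rewrite (min_idPr x0); apply/max_idPr.
Unshelve. all: end_near. Qed.

HB.instance Definition _ := isCumulativeBounded.Build R 0 1 clip_cdf Ny0 y1.

Lemma measure_of_cdf : exists mu : probability (measurableTypeR R) R,
  forall a b : R, 0 <= a -> a <= b -> b <= 1 -> mu `]a, b]%classic = (G b - G a)%:E.
Proof.
exists (lebesgue_stieltjes_measure clip_cdf) => a b a0 ab b1.
rewrite /= /lebesgue_stieltjes_measure /measure_extension measurable_mu_extE/=; last exact: is_ocitv.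
rewrite wlength_itv_bnd // /clip_cdf (min_idPl b1) (min_idPl (le_trans ab b1)).
by rewrite (max_idPr a0) (max_idPr (le_trans a0 ab)).
Qed.

End measure_of_cdf.

Section lipschitz.
Context {R : realType}.
Implicit Types (f : R -> R) (a b x y C th : R).

(** Both x - cos x and x + cos x are nondecreasing. *)
Lemma cos_lip a b : `|cos a - cos b| <= `|a - b|.
Proof.
wlog ab : a b / b <= a.
  move=> h; have [|/ltW] := leP b a; first exact: h.
  by move=> ba; rewrite distrC [leRHS]distrC; exact: h.
rewrite [leRHS]ger0_norm ?subr_ge0 // ler_norml.
have d1 x : is_derive x 1 (fun x => x - cos x) (1 - - sin x) by exact: is_deriveB.
have d2 x : is_derive x 1 (fun x => x + cos x) (1 + - sin x) by exact: is_deriveD.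
have h1 : b - cos b <= a - cos a.
  by apply: (is_derive_nondecr ab d1) => x _; have := sin_geN1 x; lra.
have h2 : b + cos b <= a + cos a.
  by apply: (is_derive_nondecr ab d2) => x _; have := sin_le1 x; lra.
by apply/andP; split; lra.
Qed.

Lemma lip_continuous f C : (forall x y, `|f x - f y| <= C * `|x - y|) -> continuous f.
Proof.
move=> h x; apply/cvgrPdist_lt => e e0.
have C0 : 0 <= C by have := h 1 0; rewrite subr0 normr1 mulr1; exact: le_trans.
have d0 : 0 < e / (C + 1) by rewrite divr_gt0 // ltr_wpDl.
near=> y; apply: (le_lt_trans (h x y)).
apply: (@le_lt_trans _ _ ((C + 1) * `|x - y|)).
  by rewrite ler_wpM2r // lerDl.
rewrite mulrC -ltr_pdivlMr; last by rewrite ltr_wpDl.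
by near: y; exists (e / (C + 1)).
Unshelve. all: end_near. Qed.

Lemma mode_lip th (n : int) x y :
  `|cos (2 * pi * (n%:~R * x) + th) - cos (2 * pi * (n%:~R * y) + th)| <=
  (2 * pi * `|n%:~R|) * `|x - y|.
Proof.
apply: (le_trans (cos_lip _ _)).
have -> : 2 * pi * (n%:~R * x) + th - (2 * pi * (n%:~R * y) + th) =
  2 * pi * n%:~R * (x - y) :> R by move: (pi : R) (n%:~R : R) => p k; ring.
by rewrite !normrM [`|pi|]ger0_norm ?pi_ge0 // [`|2|]ger0_norm.
Qed.

End lipschitz.

Section stieltjes.
Context {R : realType} (mu : probability (measurableTypeR R) R) (G : R -> R).
Hypothesis (G0 : G 0 = 0) (G1 : G 1 = 1) (Gc : continuous G).
Hypothesis muG : forall a b : R, 0 <= a -> a <= b -> b <= 1 ->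
  mu `]a, b]%classic = (G b - G a)%:E.
Implicit Types (f : R -> R) (C x y : R).

Lemma integrable_bounded f C (D : set R) : measurable (D : set (measurableTypeR R)) ->
  continuous f -> (forall x, D x -> `|f x| <= C) -> mu.-integrable D (EFin \o f).
Proof.
move=> mD fc fC; apply: measurable_bounded_integrable => //.
- by apply: le_lt_trans (probability_le1 mu mD) _; rewrite ltry.
- apply: measurable_funS (continuous_measurable_fun fc) => //.
- exists C; split; first exact: num_real.
  by move=> y Cy x Dx; exact: le_trans (fC x Dx) (ltW Cy).
Qed.

Lemma mu_oc01 : mu `]0, 1]%classic = 1%E.
Proof. by rewrite muG // G0 G1 subr0. Qed.

(** [muG] speaks of intervals open on the left, so [0,1) is reached from (0,1] through the point 1,
    where the continuity of [G] excludes an atom. *)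
Lemma mu_set1 : mu [set 1] = 0%E.
Proof.
apply/eqP; rewrite eq_le measure_ge0 andbT; apply/lee_addgt0Pr => e e0.
rewrite add0e; move: (Gc (x := 1)) => /cvgrPdist_lt /(_ _ e0) /nbhs_ballP[d /= d0 hd].
pose a : R := Num.max 0 (1 - d / 2).
have a1 : a < 1 by rewrite gt_max ltr01 /= ltrBlDr ltrDl divr_gt0.
have a0 : 0 <= a by rewrite le_max lexx.
apply: (@le_trans _ _ (mu `]a, 1]%classic)).
  by apply: le_measure; rewrite ?inE // => x /= ->; rewrite in_itv /= a1 lexx.
rewrite muG ?(ltW a1) // lee_fin; apply/ltW; apply: (le_lt_trans (ler_norm _)).
apply: hd; rewrite /ball /= ger0_norm ?subr_ge0 ?ltW //.
have : 1 - d / 2 <= a by rewrite le_max lexx orbT.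
have : 0 < d / 2 by rewrite divr_gt0.
move: d0; lra.
Qed.

Lemma mu_co01 : mu `[0, 1[%classic = 1%E.
Proof.
apply/eqP; rewrite eq_le probability_le1 //=.
rewrite -mu_oc01 -[leRHS]adde0 -mu_set1.
apply: le_trans (measureU2 mu _ _) => //.
apply: le_measure; rewrite ?inE //; first exact: measurableU.
move=> x /=; rewrite !in_itv /= => /andP[x0]; rewrite le_eqVlt => /orP[/eqP ->|x1].
  by right.
by left; rewrite (ltW x0) x1.
Qed.

Lemma Rintegral_full f C (D : set R) : measurable (D : set (measurableTypeR R)) ->
  mu D = 1%E -> continuous f -> (forall x, `|f x| <= C) ->
  \int[mu]_(x in D) f x = \int[mu]_x f x.
Proof.
move=> mD D1 fc fC; rewrite /Rintegral; congr fine; apply/esym.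
have := @negligible_integral _ _ _ mu setT (~` D) (EFin \o f).
rewrite setTD setCK; apply => //.
- exact: measurableC.
- by apply: (integrable_bounded (C := C)) => // x _.
- by have := probability_setC mu mD; rewrite D1 subee.
Qed.

(** On each cell the error is at most C / q times the mass of the cell. The induction over cells
    keeps the mass used so far as a factor, which ends at [G 1] = 1. *)
Lemma stieltjes_sum f C q : (0 < q)%N -> (forall x y, `|f x - f y| <= C * `|x - y|) ->
  `|\int[mu]_(x in `]0, 1]) f x -
    \sum_(k < q) f (k%:R / q%:R) * (G (k.+1%:R / q%:R) - G (k%:R / q%:R))| <= C / q%:R.
Proof.
move=> q0 lf; have fc := lip_continuous lf; have q0' : 0 < q%:R :> R by rewrite ltr0n.
have C0 : 0 <= C by have := lf 1 0; rewrite subr0 normr1 mulr1; exact: le_trans.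
have fb (D : set R) : measurable (D : set (measurableTypeR R)) -> D `<=` `]0, 1] ->
    mu.-integrable D (EFin \o f).
  move=> mD D1; apply: (integrable_bounded (C := `|f 0| + C)) => // z /D1 /=.
  rewrite in_itv /= => /andP[z0 z1].
  rewrite -[f z](subrK (f 0)) addrC; apply: (le_trans (ler_normD _ _)); rewrite lerD2l.
  apply: (le_trans (lf z 0)); rewrite subr0 ler_piMr // ger0_norm //; exact: ltW.
have sq k : (k <= q)%N -> k%:R / q%:R <= 1 :> R.
  by move=> kq; rewrite ler_pdivrMr // mul1r ler_nat.
have sub k : (k <= q)%N -> (`]0, (k%:R / q%:R)]%classic : set R) `<=` `]0, 1]%classic.
  by move=> /sq kq; apply: subset_itvl; rewrite bnd_simp.
suff H k : (k <= q)%N -> `|\int[mu]_(x in `]0%R, (k%:R / q%:R)]) f x -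
    \sum_(k < k) f (k%:R / q%:R) * (G (k.+1%:R / q%:R) - G (k%:R / q%:R))| <=
    C / q%:R * G (k%:R / q%:R).
  by have := H q (leqnn q); rewrite divff ?gt_eqF // G1 mulr1.
elim: k => [_|k IH kq].
  by rewrite mul0r set_itvoc0 Rintegral_set0 big_ord0 subrr normr0 G0 mulr0.
have kk : k%:R / q%:R <= k.+1%:R / q%:R :> R by rewrite ler_pM2r ?invr_gt0 // ler_nat.
have k0 : 0 <= k%:R / q%:R :> R by rewrite divr_ge0.
pose I : set R := `]k%:R / q%:R, k.+1%:R / q%:R]%classic.
have UI : `]0, (k.+1%:R / q%:R)]%classic = `]0, (k%:R / q%:R)]%classic `|` I :> set R.
  by rewrite /I (@itv_bndbnd_setU _ _ (BRight 0) (BRight (k%:R / q%:R)) (BRight _)) ?bnd_simp.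
have sI : I `<=` `]0, 1]%classic.
  by move=> x Ix; apply: (sub _ kq); rewrite UI; right.
have mI : measurable (I : set (measurableTypeR R)) by exact: measurable_itv.
have iI := fb I mI sI.
have ci (r : R) : mu.-integrable I (EFin \o (fun=> r)).
  apply: (integrable_bounded (C := `|r|)) => //.
  exact: cst_continuous.
rewrite UI Rintegral_setU //; last 2 first.
- by rewrite -UI; apply: fb => //; exact: sub.
- rewrite /I; apply/disj_setPS => x [] /=; rewrite !in_itv /= => /andP[_ h1] /andP[h2 _].
  by have := le_lt_trans h1 h2; rewrite ltxx.
rewrite big_ord_recr /= opprD addrACA; apply: (le_trans (ler_normD _ _)).
have e : G (k.+1%:R / q%:R) = G (k%:R / q%:R) + fine (mu I).
  by rewrite /I muG ?sq //=; lra.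
rewrite [in leRHS]e [leRHS]mulrDr; apply: lerD; first exact: IH (ltnW kq).
have -> : G (k.+1%:R / q%:R) - G (k%:R / q%:R) = fine (mu I) by rewrite /I muG ?sq.
rewrite -!Rintegral_cst; [|exact: mI..].
rewrite -RintegralB //.
have i2 : mu.-integrable I (EFin \o (fun x => f x - f (k%:R / q%:R))).
  exact: (integrableB mI iI (ci (f (k%:R / q%:R)))).
apply: (le_trans (le_normr_Rintegral _ i2)) => //.
apply: le_Rintegral => //.
  exact: integrable_norm.
move=> x; rewrite /I /= in_itv /= => /andP[xk xk1].
apply: (le_trans (lf _ _)); rewrite ler_wpM2l // ger0_norm ?subr_ge0 ?(ltW xk) //.
rewrite lerBlDr (le_trans xk1) // -natr1 mulrDl mul1r addrC //.
Qed.

End stieltjes.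

Section modes.
Context {R : realType}.
Implicit Types (s : seq (int * R)) (x y th C : R).

Lemma sum_telescope (u : R -> R) q : (0 < q)%N ->
  \sum_(k < q) (u (k.+1%:R / q%:R) - u (k%:R / q%:R)) = u 1 - u 0.
Proof.
move=> q0; rewrite -(big_mkord xpredT (fun k => u (k.+1%:R / q%:R) - u (k%:R / q%:R))).
rewrite (telescope_sumr (fun k => u (k%:R / q%:R))) // mul0r divff //.
by rewrite pnatr_eq0 -lt0n.
Qed.

(** The analogue of [stieltjes_sum] for the density [ev 0 s], without integrals: on a cell starting
    at [a], the antiderivative of [f] times the density is squeezed between f(a) - C/q and f(a) +
    C/q times [prim 0 s], because the differences are monotone. *)
Lemma prim_stieltjes th s n q (f := fun x => cos (2 * pi * (n%:~R * x) + th)) :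
  (0 < q)%N -> (forall x, 0 <= ev 0 s x) ->
  `|cos th * mean (cmul (mode n) s) -
    \sum_(k < q) f (k%:R / q%:R) * (prim 0 s (k.+1%:R / q%:R) - prim 0 s (k%:R / q%:R))|
  <= 2 * pi * `|n%:~R| / q%:R * mean s.
Proof.
move=> q0 s0; set C := 2 * pi * _.
have q0' : 0 < q%:R :> R by rewrite ltr0n.
rewrite -prim1B0 -(sum_telescope _ q0).
have -> : mean s = prim 0 s 1 - prim 0 s 0 by rewrite prim1B0 cos0 mul1r.
rewrite -(sum_telescope (prim 0 s) q0) mulr_sumr -sumrB.
apply: (le_trans (ler_norm_sum _ _ _)); apply: ler_sum => k _.
set a := k%:R / q%:R; set b := k.+1%:R / q%:R.
have ab : a <= b by rewrite ler_pM2r ?invr_gt0 // ler_nat.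
have lf x : a <= x <= b -> `|f x - f a| <= C / q%:R.
  move=> /andP[ax xb]; apply: (le_trans (mode_lip _ _ _ _)); rewrite ler_wpM2l //.
    by rewrite mulr_ge0 // mulr_ge0 // pi_ge0.
  rewrite ger0_norm ?subr_ge0 // lerBlDr (le_trans xb) // /b /a -natr1 mulrDl mul1r addrC //.
have d1 x := is_derive_prim th (cmul (mode n) s) x.
have d2 x := is_derive_prim 0 s x.
have evE x : ev th (cmul (mode n) s) x = f x * ev 0 s x by rewrite ev_cmul ev_seq1 mul1r.
set H := prim th _ in d1 *; set P := prim 0 s in d2 *.
have D c x : is_derive x 1 (fun x => H x + c * P x) ((f x + c) * ev 0 s x).
  have := is_deriveD (d1 x) (is_deriveZ c (d2 x)).
  by rewrite evE /GRing.scale /= -mulrDl.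
have D' c x : is_derive x 1 (fun x => - H x + c * P x) ((- f x + c) * ev 0 s x).
  have := is_deriveD (is_deriveN (d1 x)) (is_deriveZ c (d2 x)).
  by rewrite evE /GRing.scale /= -mulNr -mulrDl.
have h1 : H a + (- f a + C / q%:R) * P a <= H b + (- f a + C / q%:R) * P b.
  apply: (is_derive_nondecr ab (D _)) => x /lf; rewrite ler_distl => /andP[? ?].
  by rewrite mulr_ge0 //; lra.
have h2 : - H a + (f a + C / q%:R) * P a <= - H b + (f a + C / q%:R) * P b.
  apply: (is_derive_nondecr ab (D' _)) => x /lf; rewrite ler_distl => /andP[? ?].
  by rewrite mulr_ge0 //; lra.
by rewrite ler_norml; apply/andP; split; move: h1 h2; move: (H a) (H b) (P a) (P b) (f a) (C / q%:R) => *; lra.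
Qed.

Lemma mean_mode_cmulC s n : mean (cmul (mode n) s) = mean (cmul s (mode n)).
Proof. by apply: mean_eq => x; rewrite !ev_cmul mulrC. Qed.

Lemma mode_continuous th n : continuous (fun x : R => cos (2 * pi * (n%:~R * x) + th)).
Proof. exact: lip_continuous (mode_lip th n). Qed.

Lemma riesz_measure : exists mu : probability (measurableTypeR R) R,
  mu `[0, 1[%classic = 1%E /\
  forall th m n, (`|n| <= scaleR m)%N ->
    \int[mu]_x cos (2 * pi * (n%:~R * x) + th) = cos th * rcoef m n.
Proof.
have [mu muG] := measure_of_cdf rcdf0 rcdf1 (@rcdf_continuous R) (@rcdf_nd R).
exists mu; split; first exact: (mu_co01 rcdf0 rcdf1 (@rcdf_continuous R) muG).
move=> th m n nR.
set f := fun x : R => cos (2 * pi * (n%:~R * x) + th).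
have fc : continuous f by exact: mode_continuous.
rewrite -(@Rintegral_full R mu f 1 `]0%R, 1%R]) //; last 2 first.
- exact: mu_oc01 rcdf0 rcdf1 muG.
- by move=> x; exact: cos_max.
set C := 2 * pi * `|n%:~R : R|.
suff H k : `|\int[mu]_(x in `]0%R, 1%R]) f x - cos th * rcoef m n| <= 2 * C / 2 ^+ k.
  by apply/eqP; rewrite -subr_eq0 -normr_le0; apply: (@le_geo _ (2 * C)) => k; rewrite add0r.
set q := (2 ^ k)%N; have q0 : (0 < q)%N by rewrite expn_gt0.
rewrite -natrX -/q.
(* The mesh 1 / q stays fixed while the index [m + j] of the partial product grows: each of the q
   cells costs at most 1024 / 2^j at both of its ends. The outer parameter [k] then refines the
   mesh. *)
apply: (@le_geo _ (q%:R * 2048)) => j.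
have S1 := stieltjes_sum rcdf0 rcdf1 muG q0 (mode_lip th n).
have S2 := prim_stieltjes th n q0 (@rprod_ge0 R (m + j)).
rewrite mean_rprod mulr1 mean_mode_cmulC -/(rcoef (m + j) n) (rcoef_stable _ nR) in S2.
have S3 : `|\sum_(k < q) f (k%:R / q%:R) * (rcdf (k.+1%:R / q%:R) - rcdf (k%:R / q%:R)) -
  \sum_(k < q) f (k%:R / q%:R) * (prim 0 (rprod (m + j)) (k.+1%:R / q%:R) - prim 0 (rprod (m + j)) (k%:R / q%:R))|
  <= q%:R * 2048 / 2 ^+ j.
  rewrite -sumrB; apply: (le_trans (ler_norm_sum _ _ _)).
  rewrite -mulrA mulr_natl.
  apply: (@le_trans _ _ (\sum_(i < q) (2048 / 2 ^+ j))); last by rewrite sumr_const card_ord.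
  apply: ler_sum => i _; rewrite -mulrBr normrM.
  have e1 := rcdf_approxP (m + j) (i.+1%:R / q%:R : R).
  have e2 := rcdf_approxP (m + j) (i%:R / q%:R : R).
  have le : (2 ^+ (m + j))^-1 <= (2 ^+ j)^-1 :> R.
    rewrite lef_pV2 ?posrE ?exprn_gt0 // -!natrX ler_nat leq_exp2l //.
    exact: leq_addl.
  apply: (@le_trans _ _ (1 * (1024 / 2 ^+ (m + j) + 1024 / 2 ^+ (m + j)))); last first.
    rewrite mul1r; move: le; move: (2 ^+ (m + j))^-1 (2 ^+ j)^-1 => u v ?; lra.
  apply: ler_pM => //; first exact: cos_max.
  move: e1 e2; rewrite /cdf_approx; move: (rcdf _) (rcdf _) (prim _ _ _) (prim _ _ _) => p r u v e1 e2.
  move: e1 e2; rewrite !ler_norml => /andP[? ?] /andP[? ?].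
  by apply/andP; split; lra.
have -> : 2 * C / q%:R = C / q%:R + C / q%:R by rewrite -mulrDl -mulr2n mulr_natl.
move: S1 S2 S3; rewrite -/C -/f; move: (\sum_(_ < _) _) (\sum_(_ < _) _) (Rintegral _ _ _) (_ * rcoef _ _) => a b c d.
rewrite !ler_distl => /andP[? ?] /andP[? ?] /andP[? ?].
by apply/andP; split; lra.
Qed.

End modes.

(** * Decay of the Fourier coefficients *)

Lemma scaleR_ge m : (m <= scaleR m)%N.
Proof.
elim: m => // m IH; have -> : scaleR m.+1 = (scaleR m + 2 * (scaleA m * scaleK m))%N by [].
by have := scaleA_gt0 m; have := scaleK_gt0 m; move: (scaleA m) (scaleK m) => a k; nia.
Qed.

Lemma scaleR_between n : (0 < n)%N -> exists i, (scaleR i < n <= scaleR i.+1)%N.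
Proof.
move=> n0; have ex : exists m, (n <= scaleR m)%N by exists n; exact: scaleR_ge.
case: (ex_minnP ex) => [[|m]] nm min; first by move: nm; rewrite leqNgt n0.
by exists m; rewrite nm andbT ltnNge; apply/negP => /min; rewrite ltnn.
Qed.

Lemma scale_exp_le i : (scale_exp i <= (12 * i.+1) ^ i.+1)%N.
Proof.
elim: i => // i IH; have -> : scale_exp i.+1 = (3 * i.+2 * scale_exp i)%N by [].
rewrite expnS; apply: leq_mul; first by lia.
by apply: (leq_trans IH); rewrite leq_exp2r //; lia.
Qed.

Lemma eventually_weight_lt (R : realType) (e : R) : 0 < e -> exists M, forall n, (M <= n)%N ->
  exists2 i, (scaleR i < n <= scaleR i.+1)%N & weight i < e.
Proof.
move=> e0; pose i0 := (Num.truncn (2 / e)).+1.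
exists (scaleR i0).+1 => n hn.
have [i /andP[h1 h2]] := scaleR_between (leq_trans (ltn0Sn _) hn).
exists i; first by rewrite h1.
have ii : (i0 <= i)%N.
  by rewrite leqNgt; apply/negP => /leq_scaleR h; have := leq_trans (leq_trans hn h2) h; rewrite ltnn.
rewrite /weight ltr_pdivrMr ?ltr0n // mulrC -ltr_pdivrMr //.
by apply: (lt_le_trans (truncnS_gt _)); rewrite ler_nat; exact/leqW/leqW.
Qed.

Section fourier.
Context {R : realType} (mu : probability (measurableTypeR R) R).
Local Open Scope complex_scope.
Hypothesis mu01 : mu `[0, 1[%classic = 1%E.
Hypothesis mu_mode : forall th m n, (`|n| <= scaleR m)%N ->
    \int[mu]_x cos (2 * pi * (n%:~R * x) + th) = cos th * rcoef m n.

(** The phases 0 and -pi/2 yield the cosine and the sine integral; the second vanishes with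
    cos(pi/2), so the coefficients are real. *)
Lemma fourier_coefE m n : (`|n| <= scaleR m)%N -> fourier_coef mu n = (rcoef m n)%:C.
Proof.
move=> nR; have H th : \int[mu]_(x in `[0%R, 1%R[) cos (2 * pi * (n%:~R * x) + th) = cos th * rcoef m n.
  rewrite -mu_mode //; apply: (@Rintegral_full _ _ _ 1) => //.
    exact: mode_continuous.
  by move=> x; exact: cos_max.
rewrite /fourier_coef; congr (_ +i* _).
  have := H 0; rewrite cos0 mul1r => H'; rewrite -[RHS]H'; apply: eq_Rintegral => x _ /=.
  by rewrite addr0 mulrC [x * _]mulrC mulrC.
have := H (- (pi / 2)); rewrite cosN cos_pihalf mul0r => H'; rewrite -[RHS]H'; apply: eq_Rintegral => x _ /=.
by rewrite cosBpihalf [x * _]mulrC.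
Qed.

Lemma norm_fourier_coef m n : (`|n| <= scaleR m)%N ->
  `|fourier_coef mu n| = `|rcoef (R := R) m n|%:C.
Proof. by move=> /fourier_coefE ->; rewrite normc_def /= expr0n addr0 sqrtr_sqr. Qed.

Lemma fourier_coef_weight i n : (scaleR i < `|n| <= scaleR i.+1)%N ->
  `|fourier_coef mu n| <= (weight i)%:C.
Proof.
by move=> /andP[h1 h2]; rewrite (norm_fourier_coef h2) lecR; exact: rcoef_le_weight.
Qed.

Lemma rajchman_mu : rajchman mu.
Proof.
move=> eps e0; have [M hM] := eventually_weight_lt e0.
exists M => n /hM[i iR wi]; apply: (le_lt_trans (fourier_coef_weight iR)).
by rewrite ltcR.
Qed.

Lemma ln_scale_exp i : ln (scale_exp i)%:R <= i.+1%:R * (ln i.+1%:R + 12) :> R.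
Proof.
apply: (@le_trans _ _ (ln (((12 * i.+1) ^ i.+1)%:R))).
  rewrite ler_ln ?posrE ?ltr0n ?expn_gt0 ?muln_gt0 //; last first.
    by have := scale_exp_ge i; lia.
  by rewrite ler_nat scale_exp_le.
rewrite natrX lnXn ?ltr0n ?muln_gt0 // -[leLHS]mulr_natl ler_wpM2l //.
by rewrite natrM lnM ?posrE ?ltr0n // addrC lerD2l ltW // ln_sublinear.
Qed.

(** This converts the index of the range of [n] into log log n, through [scaleR i.+1] < 2^N with N =
    [scale_exp i.+1] and ln 2 <= 1. *)
Lemma lnln_scaleR i n : (1 < n)%N -> (n <= scaleR i.+1)%N ->
  ln (ln n%:R) <= i.+2%:R * (ln i.+2%:R + 12) :> R.
Proof.
move=> n1 nR; apply: le_trans (ln_scale_exp i.+1).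
have l0 : 0 < ln n%:R :> R by rewrite ln_gt0 // ltr1n.
rewrite ler_ln ?posrE //; last by rewrite ltr0n; have := scale_exp_ge i.+1; lia.
apply: (@le_trans _ _ (ln (2 ^ scale_exp i.+1)%:R)).
  rewrite ler_ln ?posrE ?ltr0n ?expn_gt0 ?(ltnW n1) // ler_nat.
  by apply: (leq_trans nR); have := scaleR_lt i.+1; rewrite /scaleA; lia.
rewrite natrX lnXn // -[leLHS]mulr_natl ler_piMr //.
have := @le_ln1Dx R 1; rewrite (_ : 1 + 1 = 2) //; apply.
by lra.
Qed.

Lemma ln_le_linear (k z : R) : 0 < k -> 0 < z -> ln z <= k * z - ln k.
Proof.
move=> k0 z0; rewrite lerBrDr -lnM ?posrE // mulrC.
by apply/ltW/ln_sublinear; rewrite mulr_gt0.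
Qed.

Lemma fourier_decay (kappa : R) : 0 < kappa -> exists2 C : R, 0 < C &
  forall n : int, C <= `|n|%:~R ->
    `|fourier_coef mu n| <= (ln (ln (`|n|%:~R : R)) `^ (-1 + kappa))%:C.
Proof.
move=> k0.
(* With t = i + 2 and y = log log n, the goal is (1 - kappa) ln y <= ln t - ln 2, where ln y <= (1 +
   kappa) ln t + 12 kappa - ln kappa. As (1 - kappa)(1 + kappa) = 1 - kappa^2, a surplus kappa^2 ln
   t remains; [T] is the value of ln t from which it covers the constants. *)
pose T := ((1 - kappa) * (kappa * 12 - ln kappa) + ln 2) / kappa ^+ 2.
pose i0 := (Num.truncn (expR T)).+1.
have hi0 : expR T < i0%:R by exact: truncnS_gt.
pose C := (scaleR i0)%:R + 1 + expR (expR 1) : R.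
have e0 : 0 < expR (expR 1) :> R by exact: expR_gt0.
exists C; first by rewrite /C ltr_wpDl // addr_ge0.
move=> n Cn; have nE : `|n|%:~R = `|n|%N%:R :> R by rewrite natr_absz.
rewrite nE in Cn *.
have n1 : expR (expR 1) <= `|n|%N%:R :> R.
  by apply: le_trans Cn; rewrite /C lerDr addr_ge0.
have n0 : 0 < `|n|%N%:R :> R by apply: lt_le_trans n1.
have hl : expR 1 <= ln `|n|%N%:R :> R by rewrite -[leLHS]expRK ler_ln ?posrE.
have l0 : 0 < ln `|n|%N%:R :> R by apply: lt_le_trans hl; exact: expR_gt0.
have hll : 1 <= ln (ln `|n|%N%:R) :> R by rewrite -[leLHS]expRK ler_ln ?posrE ?expR_gt0.
have nnat : (1 < `|n|)%N.
  by rewrite -(ltr1n R); apply: lt_le_trans n1; rewrite expR_gt1 expR_gt0.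
have iR : (scaleR i0 < `|n|)%N.
  by rewrite -(ltr_nat R); apply: lt_le_trans Cn; rewrite /C -addrA ltrDl addr_gt0.
have [i /andP[h1 h2]] := scaleR_between (ltnW nnat).
have ii : (i0 <= i)%N.
  by rewrite leqNgt; apply/negP => /leq_scaleR h; have := leq_trans (leq_trans iR h2) h; rewrite ltnn.
have hw := fourier_coef_weight (introT andP (conj h1 h2)).
apply: (le_trans hw); rewrite lecR /weight.
have hy := lnln_scaleR nnat h2.
set y := ln (ln _) in hll hy *.
have y0 : 0 < y by apply: lt_le_trans hll.
rewrite /powR gt_eqF //.
set t : R := i.+2%:R in hy *.
have t2 : 2 <= t by rewrite ler_nat.
have t0 : 0 < t by apply: lt_le_trans t2.
(* For kappa >= 1 the exponent is nonnegative, and y >= 1 by the last summand of [C], so the bound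
   of the weight by 1 is enough. *)
have [k1|k1] := leP 1 kappa.
  apply: (@le_trans _ _ 1); first by rewrite ler_pdivrMr // mul1r.
  rewrite -[leLHS]expR0 ler_expR mulr_ge0 ?ln_ge0 // addrC subr_ge0 //.
have -> : 2 / t = expR (ln 2 - ln t) by rewrite expRB !lnK ?posrE.
rewrite ler_expR.
have lt0 : 0 <= ln t by rewrite ln_ge0 // (le_trans _ t2) // ler1n.
have hlny : ln y <= ln t + ln (ln t + 12).
  rewrite -lnM ?posrE ?ltr_wpDl // ler_ln ?posrE // mulr_gt0 // ltr_wpDl //.
have h3 : ln (ln t + 12) <= kappa * (ln t + 12) - ln kappa.
  by apply: ln_le_linear; rewrite // ltr_wpDl.
have hT : T <= ln t.
  rewrite -[leLHS]expRK ler_ln ?posrE ?expR_gt0 //; apply/ltW/(lt_le_trans hi0).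
  by rewrite ler_nat; exact/leqW/leqW.
move: hT; rewrite /T ler_pdivrMr ?exprn_gt0 // => hT.
have h4 : (1 - kappa) * ln y <= (1 - kappa) * (ln t + (kappa * (ln t + 12) - ln kappa)).
  by rewrite ler_wpM2l ?subr_ge0 ?(ltW k1) // (le_trans hlny) // lerD2l.
by move: h4 hT; move: (ln y) (ln t) (ln kappa) (ln 2) => p q r s h4 hT; lra.
Qed.

End fourier.

(** * Failure of normality in even bases *)

Section near_integer.
Context {R : realType}.
Implicit Types (x y u : R).

(** With t = pi |y|: if cos t >= 1/2, then sin t >= t cos t >= t/2 >= |y|; otherwise the squared
    sine is at least 3/4. *)
Lemma sqr_le_sin2 y : `|y| <= 1 / 2 -> y ^+ 2 <= sin (pi * y) ^+ 2.
Proof.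
wlog y0 : y / 0 <= y.
  move=> h; have [/h //|/ltW y0] := leP 0 y; rewrite -normrN => hy.
  by have := h (- y); rewrite oppr_ge0 mulrN sinN !sqrrN; apply.
rewrite ger0_norm // => y1; have p0 := @pi_gt0 R; have p2 := @pi_ge2 R.
set t := pi * y; have t0 : 0 <= t by rewrite mulr_ge0 // ltW.
have th : t <= pi / 2 by rewrite /t ler_wpM2l ?(ltW p0) //; lra.
have c0 (s : R) : 0 <= s -> s <= t -> 0 <= cos s.
  move=> s0 st; apply: cos_ge0_pihalf; rewrite (le_trans st th) andbT (le_trans _ s0) //.
  by rewrite oppr_le0 divr_ge0 // ltW.
have s0 (s : R) : 0 <= s -> s <= t -> 0 <= sin s.
  move=> s0 st; have d (z : R) : is_derive z 1 sin (cos z) := is_derive_sin z.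
  rewrite -(@sin0 R); apply: (is_derive_nondecr s0 d) => z /andP[z0 zs].
  by apply: c0 => //; exact: le_trans zs st.
have tan : t * cos t <= sin t.
  have d (z : R) : is_derive z 1 (fun z : R => sin z - z * cos z) (z * sin z).
    have := is_deriveB (is_derive_sin z) (is_deriveM (is_derive_id z 1) (is_derive_cos z)).
    rewrite /GRing.scale /= mulr1 mulrN opprD opprK addrCA subrr addr0.
    exact.
  rewrite -subr_ge0; have -> : 0 = sin 0 - 0 * cos 0 :> R by rewrite sin0 mul0r subrr.
  apply: (is_derive_nondecr t0 d) => z /andP[z0 zt].
  by rewrite mulr_ge0 // s0.
have ct := c0 t t0 (lexx _); have st := s0 t t0 (lexx _).
have [ch|ch] := leP (1 / 2) (cos t).
  rewrite ler_sqr ?nnegrE //; apply: le_trans tan.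
  apply: (@le_trans _ _ (t * (1 / 2))); last by rewrite ler_wpM2l.
  by rewrite /t -mulrA mulrCA ler_peMr //; lra.
have e := cos2Dsin2 t; move: (cos t) (sin t) ct st ch e => c s *; nra.
Qed.

Lemma cosB_int (z : int) x : cos (2 * pi * (x - z%:~R)) = cos (2 * pi * x).
Proof. by rewrite mulrBr -[LHS](cos_intD z) subrK. Qed.

(** With y the signed distance to the nearest integer and u = sin(pi y)^2, the spike is (1 - u)^K.
    As (1 - u)^K (1 + K u) <= (1 - u^2)^K <= 1, a spike above 2^-i forces K u < 2^i, and y^2 <=
    u. *)
Lemma spike_near A K x i : (1 / 2) ^+ i < ev 0 (spike A K) x ->
  exists z : int, (A%:R * x - z%:~R) ^+ 2 * K%:R < 2 ^+ i.
Proof.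
rewrite ev_spike => h; exists (Num.floor (A%:R * x + 1 / 2)).
set z := Num.floor _; set y := A%:R * x - _.
have /andP[y1 y2] : z%:~R <= A%:R * x + 1 / 2 < (z + 1)%:~R by exact: floor_itv.
rewrite intrD in y2.
have yh : `|y| <= 1 / 2 by rewrite ler_norml /y; apply/andP; split; lra.
have := sqr_le_sin2 yh; set u := sin _ ^+ 2 => yu.
have eu : (1 + cos (2 * pi * (A%:R * x))) / 2 = 1 - u.
  rewrite -(cosB_int z) -/y -mulrA [2 * _]mulr_natl cos_mulr2n /u cos2sin2.
  by move: (sin _ ^+ 2) => v; lra.
rewrite eu in h.
have u0 : 0 <= u by exact: sqr_ge0.
have u1 : u <= 1 by rewrite /u sin2cos2 gerBl sqr_ge0.
have hK : (1 - u) ^+ K * (1 + K%:R * u) <= 1.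
  apply: (@le_trans _ _ ((1 - u) ^+ K * (1 + u) ^+ K)).
    rewrite ler_wpM2l ?exprn_ge0 ?subr_ge0 //.
    elim: K {h} => [|K IH]; first by rewrite mul0r addr0 expr0.
    rewrite exprS; apply: (@le_trans _ _ ((1 + u) * (1 + K%:R * u))).
      rewrite -[K.+1%:R]natr1; have : 0 <= K%:R * u ^+ 2 by rewrite mulr_ge0 // sqr_ge0.
      by move: (K%:R) => k hk; lra.
    by rewrite ler_wpM2l // addr_ge0.
  by rewrite -exprMn; apply: exprn_ile1; have := sqr_ge0 u; move: u0 u1 => *; nra.
have Ku : 0 <= K%:R * u by rewrite mulr_ge0.
apply: (@le_lt_trans _ _ (K%:R * u)); first by rewrite mulrC ler_wpM2l.
have h2 : (1 / 2) ^+ i * (1 + K%:R * u) < 1.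
  by apply: lt_le_trans hK; rewrite ltr_pM2r // ltr_wpDr.
have : (1 + K%:R * u) < 2 ^+ i.
  by move: h2; rewrite mul1r exprVn mulrC ltr_pdivrMr ?exprn_gt0 // mul1r.
by move: (K%:R * u) (2 ^+ i) => *; lra.
Qed.

End near_integer.

Section even_digits.
Context {R : realType}.
Implicit Types (x y : R).

(** As [2 ^ N] divides [b ^ N], for j >= N the number [b ^ j.+1 * x] is a multiple of [b] plus an
    error [del] of modulus less than 1, negative exactly when [y] is. Its floor is therefore 0 or -1
    modulo [b] according to the sign of [y], which does not depend on j. *)
Lemma digit_const (b N M : nat) x (z : int) : (2 <= b)%N -> ~~ odd b -> 0 <= x < 1 ->
  `|(2 ^ N)%:R * x - z%:~R| <= (2 ^ M)%:R^-1 -> (b ^ (4 * N) < 2 ^ M)%N ->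
  exists2 d : nat, (d == 0%N) || (d == b.-1) &
    forall j, (N <= j < 4 * N)%N -> digit b x j = d.
Proof.
move=> b2 bev /andP[x0 x1] hy hb; set y := _ - _ in hy.
have fx : frac_part x = x.
  rewrite /frac_part (_ : Num.floor x = 0) ?subr0 //.
  by apply/floor_def; rewrite x0.
have [c bE] : exists c, b = (2 * c)%N by exists (b./2); lia.
pose d := if 0 <= y then 0%N else b.-1.
exists d; first by rewrite /d; case: ifP; rewrite eqxx ?orbT.
move=> j /andP[Nj j4]; rewrite /digit fx.
pose Z : int := (b ^ (j - N) * c ^ N)%N%:Z * z.
pose del : R := (b ^ (j.+1 - N) * c ^ N)%N%:R * y.
have bN : (b ^ N = 2 ^ N * c ^ N)%N by rewrite bE expnMn.
have e : b%:R ^+ j.+1 * x = (b%:Z * Z)%:~R + del.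
  have hN : (b ^ (j.+1 - N) * c ^ N * 2 ^ N = b ^ j.+1)%N.
    by rewrite -mulnA [(c ^ N * _)%N]mulnC -bN -expnD subnK // ltnW.
  have hZ : (b%:Z * Z)%:~R = (b ^ (j.+1 - N) * c ^ N)%N%:R * z%:~R :> R.
    by rewrite /Z mulrA -PoszM intrM -pmulrn mulnA -expnS subSn.
  by rewrite hZ /del /y mulrBr addrC subrK mulrA -natrM hN natrX.
have dl : `|del| < 1.
  rewrite normrM normr_nat; apply: (@le_lt_trans _ _ ((b ^ (4 * N))%:R * (2 ^ M)%:R^-1)).
    apply: ler_pM => //; rewrite ler_nat.
    apply: (@leq_trans (b ^ (j.+1 - N) * b ^ N)); last by rewrite -expnD leq_exp2l //; lia.
    by rewrite leq_mul2l leq_exp2r ?bE ?orbT //; lia.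
  by rewrite ltr_pdivrMr ?ltr0n ?expn_gt0 // mul1r ltr_nat.
have fl : Num.floor (b%:R ^+ j.+1 * x) = b%:Z * Z - (~~ (0 <= y))%:Z.
  apply: floor_def; rewrite e; move: dl; rewrite ltr_norml => /andP[d1 d2].
  have dy : (0 <= del) = (0 <= y).
    rewrite /del pmulr_rge0 // ltr0n muln_gt0 !expn_gt0 (leq_trans _ b2) //=.
    by apply/orP; left; lia.
  rewrite -dy; case: (leP 0 del) => h; rewrite /= ?subr0 !intrD.
    by rewrite lerDl h /= ltrD2l.
  by rewrite rmorphN /= subrK lerD2l (ltW d1) /= -[ltRHS]addr0 ltrD2l h.
rewrite fl /d; have := floor_ge0 (b%:R ^+ j.+1 * x); rewrite fl mulr_ge0 ?exprn_ge0 // => h.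
case: (leP 0 y) h => _ /=.
  by rewrite subr0 => h; rewrite abszM mulnC modnMl.
move=> h; have : (0 < Z) by move: (Z) h => w; nia.
case: (Z) h => // w h w0.
have -> : `|(b%:Z * w - 1)%R|%N = (w.-1 * b + b.-1)%N by nia.
by rewrite modnMDl modn_small //; lia.
Qed.

(** A spike makes the digits from N to 4N constant, so that 0 or b - 1 has frequency at least 3/4
    among the first 4N digits. This recurs for arbitrarily large N, against a limit 1/b <= 1/2. *)
Lemma even_not_normal x : 0 <= x < 1 ->
  (forall I, exists2 i, (I <= i)%N & (1 / 2) ^+ i.+2 < ev 0 (spike (scaleA i) (scaleK i)) x) ->
  forall b : nat, (2 <= b)%N -> ~~ odd b -> ~ normal_in_base b x.
Proof.
move=> x01 hx b b2 bev nb.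
have b0 : (0 < b)%N by lia. have bp : (b.-1 < b)%N by lia.
have H (o : 'I_b) : \forall n \near \oo,
    (block_count x [tuple o] n)%:R / n%:R < 3 / 4 :> R.
  have := nb 1%N [tuple o] isT; rewrite expr1 => /cvgr_lt; apply.
  apply: (@le_lt_trans _ _ (2^-1)); last by lra.
  by rewrite lef_pV2 ?posrE ?ltr0n // ler_nat.
have [n0 _ H0] : \forall n \near \oo,
    (block_count x [tuple Ordinal b0] n)%:R / n%:R < 3 / 4 :> R /\
    (block_count x [tuple Ordinal bp] n)%:R / n%:R < 3 / 4 :> R.
  by near=> n; split; near: n; exact: H.
(* An index of at least 8 b makes the precision [M], about i N / 2, exceed the 4 N b required by
   [digit_const]; [n0] puts 4 N beyond the threshold for the two frequencies. *)
have [i hi] := hx (n0 + 8 * b)%N.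
have Ni := scale_exp_ge i; set N := scale_exp i in Ni *.
move=> /spike_near [z]; rewrite /scaleA /scaleK -/N => hz.
have hL : ((i.+1 * N) = i.+2 + (i.+1 * N - i.+2))%N by rewrite subnKC //; nia.
(* Halved because [hz] bounds the square of the distance. *)
pose M := ((i.+1 * N - i.+2)./2)%N.
have hM : (4 * N * b < M)%N by rewrite /M; nia.
have hy : `|(2 ^ N)%:R * x - z%:~R| <= (2 ^ M)%:R^-1.
  have P0 : 0 < (2 ^ M)%:R :> R by rewrite ltr0n expn_gt0.
  rewrite -ler_sqr ?nnegrE ?invr_ge0 ?(ltW P0) // real_normK ?num_real // exprVn.
  rewrite -[leRHS]mul1r ler_pdivlMr ?exprn_gt0 //.
  move: hz; rewrite hL expnD natrM mulrCA -[2 ^+ i.+2]natrX -[ltRHS]mulr1 ltr_pM2l ?ltr0n ?expn_gt0 //.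
  move=> /ltW; apply: le_trans; rewrite ler_wpM2l ?sqr_ge0 // -natrX ler_nat -expnM.
  by rewrite leq_exp2l // /M; lia.
have hb : (b ^ (4 * N) < 2 ^ M)%N.
  apply: (@leq_ltn_trans (2 ^ (b * (4 * N)))); last by rewrite ltn_exp2l // mulnC.
  by rewrite [leqRHS]expnM leq_exp2r; [exact/ltnW/ltn_expl|lia].
have [d dE dj] := digit_const b2 bev x01 hy hb.
have db : (d < b)%N by case/orP: dE => /eqP ->; lia.
have cnt : (3 * N <= block_count x [tuple Ordinal db] (4 * N))%N.
  rewrite /block_count -(big_mkord xpredT (fun j =>
    nat_of_bool [forall i0 : 'I_1, digit b x (j + i0) == tnth [tuple Ordinal db] i0 :> nat])).
  rewrite (big_cat_nat (n := N)) //=; last by lia.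
  apply: leq_trans (leq_addl _ _).
  rewrite big_nat (eq_bigr (fun=> 1%N)); last first.
    move=> j hj; apply/eqP; rewrite eqb1; apply/forallP => k.
    by rewrite (ord1 k) addn0 dj // (tnth_nth (Ordinal db)).
  by rewrite -big_nat sum_nat_const_nat muln1; lia.
have n4 : (n0 <= 4 * N)%N by nia.
have := H0 _ n4; rewrite /= => -[h1 h2].
have N0 : 0 < (4 * N)%:R :> R by rewrite ltr0n; lia.
suff : (block_count x [tuple Ordinal db] (4 * N))%:R / (4 * N)%:R < 3 / 4 :> R.
  rewrite ltr_pdivrMr // natrM mulrA divfK // -natrM ltr_nat; lia.
have : Ordinal db = Ordinal b0 \/ Ordinal db = Ordinal bp.
  by case/orP: dE => /eqP e; [left|right]; apply/val_inj.
by case=> ->.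
Unshelve. all: end_near. Qed.

End even_digits.

Section ev_facts.
Context {R : realType}.
Implicit Types (s : seq (int * R)).

Lemma ev_cons th t s x : ev th (t :: s) x =
  t.2 * cos (2 * pi * (t.1%:~R * x) + th) + ev th s x.
Proof. by rewrite /ev big_cons. Qed.

Lemma ev_continuous th s : continuous (ev th s).
Proof.
elim: s => [|t s IH] x.
  rewrite (_ : ev th [::] = cst 0); first exact: cst_continuous.
  by apply/funext => y; rewrite /ev big_nil.
rewrite (_ : ev th (t :: s) =
  (fun x => t.2 * cos (2 * pi * (t.1%:~R * x) + th)) + ev th s); last first.
  by apply/funext => y; rewrite ev_cons.
apply: continuousD; last exact: IH.
by apply: continuousM; [exact: cst_continuous|exact: mode_continuous].
Qed.

Lemma ev_le_l1 th s x : `|ev th s x| <= l1 s.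
Proof.
apply: (le_trans (ler_norm_sum _ _ _)); apply: ler_sum => t _.
by rewrite normrM ler_piMr // cos_max.
Qed.

Lemma mean_cmul_modes s u : mean (cmul s u) =
  \sum_(t <- u) t.2 * mean (cmul s (@mode R t.1)).
Proof.
elim: u => [|t u IH].
  rewrite big_nil (@mean_eq0 R) //.
  by rewrite all_cat; apply/andP; split; apply/allP => z /allpairsP[[a b] []].
rewrite big_cons -IH -mean_cscl -mean_cat; apply: mean_eq => x.
rewrite ev_cat ev_cscl !ev_cmul ev_mode ev_cons addr0.
by move: (cos _) (ev _ _ _) (ev _ _ _) => *; ring.
Qed.

End ev_facts.

Section markov.
Context {R : realType} (mu : probability (measurableTypeR R) R).

Lemma markov_set (f : R -> R) c C (B : set R) : measurable (B : set (measurableTypeR R)) ->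
  continuous f -> (forall x, 0 <= f x <= C) -> (forall x, B x -> c <= f x) ->
  c * fine (mu B) <= \int[mu]_x f x.
Proof.
move=> mB fc fC cf.
have fi (D : set R) : measurable (D : set (measurableTypeR R)) -> mu.-integrable D (EFin \o f).
  move=> mD; apply: (integrable_bounded mu (C := C)) => // x _.
  by have /andP[f0 f1] := fC x; rewrite ger0_norm.
have mB' : measurable (~` B : set (measurableTypeR R)) by exact: measurableC.
rewrite -Rintegral_cst // -(setUv B) Rintegral_setU //; last 2 first.
- by rewrite setUv; apply: fi.
- exact/disj_setPCl.
rewrite -[leLHS]addr0; apply: lerD.
  apply: le_Rintegral => //; last by exact: fi.
  by apply: (integrable_bounded mu (C := `|c|)) => //; exact: cst_continuous.
by apply: Rintegral_ge0 => x _; have /andP[] := fC x.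
Qed.

End markov.

(** * Almost every point meets infinitely many spikes *)

Section even_ae.
Context {R : realType} (mu : probability (measurableTypeR R) R).
Hypothesis mu_mode : forall th m n, (`|n| <= scaleR m)%N ->
    \int[mu]_x cos (2 * pi * (n%:~R * x) + th) = cos th * rcoef m n.
Implicit Types (s : seq (int * R)).

Lemma ev_integrable th s : mu.-integrable setT (EFin \o ev th s).
Proof.
apply: (integrable_bounded mu (C := l1 s)) => //; first exact: ev_continuous.
by move=> x _; exact: ev_le_l1.
Qed.

Lemma int_ev m s : deg_le (scaleR m) s -> \int[mu]_x ev 0 s x = mean (cmul (rprod m) s).
Proof.
elim: s => [_|t s IH /= /andP[dt ds]].
  rewrite mean_cmul_modes big_nil.
  rewrite (@eq_Rintegral _ _ _ _ _ (cst 0)) ?Rintegral_cst ?mul0r // => x _.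
  by rewrite /ev big_nil.
have -> : mean (cmul (rprod m) (t :: s)) =
    t.2 * rcoef m t.1 + mean (cmul (rprod m) s).
  by rewrite !mean_cmul_modes big_cons.
rewrite -IH // -[rcoef m t.1]mul1r -cos0 -mu_mode //.
have i1 : mu.-integrable setT (EFin \o (fun x => cos (2 * pi * (t.1%:~R * x) + 0))).
  apply: (integrable_bounded mu (C := 1)) => //; first exact: mode_continuous.
  by move=> x _; exact: cos_max.
rewrite -RintegralZl // -RintegralD //; last 2 first.
- exact: (integrableZl measurableT t.2 i1).
- exact: ev_integrable.
by apply: eq_Rintegral => x _; rewrite ev_cons.
Qed.

(** Indices below [I] get the factor 1, so that the product runs over the same range as [rprod] and
    can be paired with it factor by factor. *)
Let cob I i : seq (int * R) := if (i < I)%N then cone else cospike (scaleA i) (scaleK i).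

(** By independence and [mean_rfactor_cospike] the integral is at most the product of the 1 -
    [weight i] / 2 = (i + 1) / (i + 2), which telescopes. It tends to 0 with k because the sum of
    the weights diverges. *)
Lemma int_cospikes I k : \int[mu]_x ev 0 (iprod (cob I) (I + k)) x <= I.+1%:R / (I + k).+1%:R.
Proof.
have dc i : deg_le (scaleA i * scaleK i) (cob I i).
  by rewrite /cob; case: ifP => // _; exact: deg_le_cospike.
have mc i : mult_of (scaleA i) (cob I i).
  by rewrite /cob; case: ifP => _; [exact: mult_of_cone|exact: mult_of_cospike].
rewrite (@int_ev (I + k)); last by apply: deg_le_iprod => i; apply: deg_leW (dc i); lia.
have -> : mean (cmul (rprod (I + k)) (iprod (cob I) (I + k))) =
    mean (iprod (fun i => cmul (rfac i) (cob I i)) (I + k)).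
  apply: mean_eq => x; rewrite ev_cmul /rprod !ev_iprod -big_split.
  by apply: eq_bigr => i _; rewrite ev_cmul.
rewrite mean_iprod; last 2 first.
(* The factor 2 in [scaleR] is meant for this product: the factor and its cospike both have degree
   [scaleA i * scaleK i]. *)
- move=> i; rewrite mul2n -addnn; apply: deg_le_cmul (dc i); exact: deg_le_rfactor.
- by move=> i; apply: mult_of_cmul (mc i); exact: mult_of_rfac.
have m0 i : 0 <= mean (cmul (rfac i) (cob I i)).
  apply: mean_ge0 => x; rewrite ev_cmul mulr_ge0 ?rfac_ge0 //.
  by rewrite /cob; case: ifP => _; rewrite ?ev_cone ?cos0 // ev_cospike subr_ge0 spike_le1.
elim: k => [|k IH].
  rewrite addn0 divff // big1 // => i _; rewrite /cob ltn_ord.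
  rewrite -(mean_rfactor (weight i) (scaleK i) (scaleA_gt0 i)).
  by apply: mean_eq => x; rewrite ev_cmul ev_cone cos0 mulr1.
rewrite addnS big_ord_recr /=.
have h : mean (cmul (rfac (I + k)) (cob I (I + k))) <= (I + k).+1%:R / (I + k).+2%:R.
  rewrite /cob ltnNge leq_addr /=.
  apply: le_trans (mean_rfactor_cospike (scaleA_gt0 _) (scaleK_gt0 _) (weight_itv _)) _.
  rewrite /weight -[(I + k).+2%:R]natr1; set z : R := (I + k).+1%:R.
  have z0 : 0 < z + 1 by rewrite ltr_wpDl.
  rewrite ler_pdivlMr // mulrBl mul1r; have -> : 2 / (z + 1) / 2 * (z + 1) = 1.
    by field; rewrite gt_eqF.
  by rewrite addrK.
apply: (le_trans (ler_pM _ (m0 _) IH h)); first by apply: prodr_ge0 => i _; exact: m0.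
by rewrite mulrA divfK.
Qed.

(* Outside [far_from I] some factor of index at least [I] has a spike at [x]. *)
Definition far_from I : set R :=
  [set x | forall i, (I <= i)%N -> ev 0 (spike (scaleA i) (scaleK i)) x <= (1 / 2) ^+ i.+2].

Lemma closed_far_from I : closed (far_from I).
Proof.
rewrite (_ : far_from I = \bigcap_(i in [set i | (I <= i)%N])
   [set x | ev 0 (spike (scaleA i) (scaleK i)) x <= (1 / 2) ^+ i.+2]); last first.
  by apply/seteqP; split => x h i; exact: h.
apply: closed_bigI => i _.
apply: (@preimage_closed _ _ (ev 0 (spike (scaleA i) (scaleK i)))
  [set y | y <= (1 / 2) ^+ i.+2]); last exact: closed_le.
by move=> x _; exact: ev_continuous.
Qed.

(** The Weierstrass product inequality. *)
Lemma prod_sub_sum (f : nat -> R) n : (forall i, 0 <= f i <= 1) ->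
  1 - \sum_(i < n) f i <= \prod_(i < n) (1 - f i).
Proof.
move=> f01; elim: n => [|n IH]; first by rewrite !big_ord0 subr0.
rewrite !big_ord_recr /=; have /andP[a b] := f01 n.
have s0 : 0 <= \sum_(i < n) f i by apply: sumr_ge0 => i _; have /andP[] := f01 i.
apply: (@le_trans _ _ ((1 - \sum_(i < n) f i) * (1 - f n))).
  by move: (\sum_(_ < _) _) (f n) s0 a b => u v *; nra.
by rewrite ler_wpM2r // subr_ge0.
Qed.

Lemma sum_half n : \sum_(i < n) (1 / 2) ^+ i.+2 <= 1 / 2 :> R.
Proof.
suff -> : \sum_(i < n) (1 / 2) ^+ i.+2 = 1 / 2 - (1 / 2) ^+ n.+1 :> R.
  by rewrite gerBl exprn_ge0.
elim: n => [|n IH]; first by rewrite big_ord0 expr1 subrr.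
by rewrite big_ord_recr /= IH !exprS; move: ((1 / 2) ^+ n) => z; field.
Qed.

(** On [far_from I] the spikes are at most 2^-(i+2), of sum at most 1/2, so the product of the
    cospikes is at least 1/2 there, whereas its integral tends to 0: Markov's inequality applies. *)
Lemma null_far_from I : mu (far_from I) = 0%E.
Proof.
have mI : measurable (far_from I : set (measurableTypeR R)).
  by apply: closed_measurable; exact: closed_far_from.
rewrite -[LHS]fineK ?fin_num_measure //; congr EFin.
apply/eqP; rewrite eq_le fine_ge0 // andbT; apply/ler_addgt0Pr => e e0; rewrite add0r.
have h k : fine (mu (far_from I)) <= 2 * (I.+1%:R / (I + k).+1%:R).
  rewrite -ler_pdivrMl // mulrC; apply: le_trans (int_cospikes I k).
  rewrite mulrC; apply: (markov_set mu (C := 1)) => //.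
  - exact: ev_continuous.
  - move=> x; rewrite ev_iprod.
    have c i : 0 <= ev 0 (cob I i) x <= 1.
      rewrite /cob; case: ifP => _; first by rewrite ev_cone cos0 ler01 lexx.
      by rewrite ev_cospike subr_ge0 spike_le1 gerBl spike_ge0.
    by rewrite prodr_ge0 ?prodr_ile1 // => i _; have /andP[] := c i.
  - move=> x fx; rewrite ev_iprod.
    pose f i : R := if (i < I)%N then 0 else ev 0 (spike (scaleA i) (scaleK i)) x.
    have f01 i : 0 <= f i <= 1.
      by rewrite /f; case: ifP => _; rewrite ?lexx ?ler01 // spike_ge0 spike_le1.
    have -> : \prod_(i < I + k) ev 0 (cob I i) x = \prod_(i < I + k) (1 - f i).
      apply: eq_bigr => i _; rewrite /cob /f; case: ifP => _; first by rewrite ev_cone cos0 subr0.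
      exact: ev_cospike.
    apply: le_trans (prod_sub_sum _ f01).
    have : \sum_(i < I + k) f i <= \sum_(i < I + k) (1 / 2) ^+ i.+2.
      apply: ler_sum => i _; rewrite /f; case: ltnP => [_|/fx //].
      by rewrite exprn_ge0.
    move=> /le_trans /(_ (sum_half _)); rewrite div1r; lra.
pose k := Num.truncn (2 * I.+1%:R / e).
apply: (le_trans (h k)); rewrite mulrA ler_pdivrMr ?ltr0n // [leRHS]mulrC -ler_pdivrMr //.
apply/ltW/(lt_le_trans (truncnS_gt _)); rewrite -/k ler_nat ltnS leq_addl //.
Qed.

Lemma null_bigcup_far_from : mu (\bigcup_I far_from I) = 0%E.
Proof.
have mI I : measurable (far_from I : set (measurableTypeR R)).
  by apply: closed_measurable; exact: closed_far_from.
apply/negligibleP; first exact: bigcup_measurable.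
by apply: negligible_bigcup => I; apply/negligibleP => //; exact: null_far_from.
Qed.

End even_ae.

(** * Normality in odd bases *)

Section lifting.
Implicit Types (b d n N : nat).

Lemma subn1_expM b d e : (b ^ (d * e) - 1 = (b ^ d - 1) * \sum_(i < e) b ^ (d * i))%N.
Proof.
rewrite expnM !subn1 predn_exp; congr muln.
by apply: eq_bigr => i _; rewrite expnM.
Qed.

(** A weak form of lifting the exponent at 2. When d is odd, the cofactor of b^e - 1 in b^(ed) - 1
    is a sum of an odd number of odd terms. When d = 2e with e even, b^e + 1 is 2 modulo 4, so
    halving d costs a single factor 2. *)
Lemma dvdn_exp_sub1 b : odd b -> forall d n, (2 ^ n %| b ^ d - 1)%N ->
  (2 ^ n %| d * (b ^ 2 - 1))%N.
Proof.
move=> ob; have b0 : (0 < b)%N by case: b ob.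
have osum e d : odd d -> odd (\sum_(i < d) b ^ (e * i)).
  have -> : odd (\sum_(i < d) b ^ (e * i)) = odd d.
    elim: d => [|d IH]; first by rewrite big_ord0.
    by rewrite big_ord_recr /= oddD IH oddX ob orbT addbT.
  by [].
have oddcase e d n : odd d -> (2 ^ n %| b ^ (e * d) - 1)%N -> (2 ^ n %| b ^ e - 1)%N.
  move=> od; have co : coprime (2 ^ n) (\sum_(i < d) b ^ (e * i)).
    by rewrite coprimeXl // coprime2n osum.
  by rewrite subn1_expM Gauss_dvdl.
have bsq : (b ^ 2 - 1 = (b - 1) * (b + 1))%N by rewrite -{2}(exp1n 2) subn_sqr.
elim/ltn_ind => d IH n.
have [od|ed] := boolP (odd d).
  rewrite -[X in (b ^ X)%N]mul1n => /(oddcase _ _ _ od); rewrite expn1 => h.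
  by rewrite bsq dvdn_mull // dvdn_mulr.
have dE : d = (2 * d./2)%N by lia.
have [d0|d0] := posnP d; first by rewrite d0 mul0n dvdn0.
set e := d./2 in dE *; have [oe|ee] := boolP (odd e).
  by rewrite {1}dE => /(oddcase _ _ _ oe) h; rewrite dvdn_mull.
case: n => [|n]; first by rewrite dvd1n.
have be0 : (0 < b ^ e)%N by rewrite expn_gt0 b0.
have -> : (b ^ d - 1 = (b ^ e - 1) * (b ^ e + 1))%N.
  by rewrite dE mulnC expnM -{2}(exp1n 2) subn_sqr.
have [q hq] : exists q, (b ^ e + 1 = 2 * (2 * q + 1))%N.
  have eE : e = (2 * e./2)%N by lia.
  rewrite eE expnM; have : odd (b ^ 2) by rewrite oddX ob orbT.
  have : (b ^ 2 %% 4 = 1)%N.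
    have : (b %% 4 == 1)%N || (b %% 4 == 3)%N by lia.
    by case/orP => /eqP h; rewrite -modnXm h.
  move=> h4 _; have : (((b ^ 2) ^ e./2) %% 4 = 1)%N by rewrite -modnXm h4 exp1n.
  by move: ((b ^ 2) ^ e./2)%N => w hw; exists (w %/ 4)%N; lia.
rewrite hq mulnCA expnS dvdn_pmul2l // Gauss_dvdl; last first.
  by rewrite coprimeXl // coprime2n; lia.
move=> /(IH e) h; rewrite dE -mulnA dvdn_pmul2l //; apply: h; lia.
Qed.

(** Two members of [P] are at least M / c apart, so j -> floor(j c / M) is injective on them. *)
Lemma card_congr (N c M : nat) (P : pred nat) : (0 < M)%N -> (0 < c)%N ->
  (forall i j, (i < j)%N -> P i -> P j -> (M %| c * (j - i))%N) ->
  (\sum_(j < N) P j <= N * c %/ M + 1)%N.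
Proof.
move=> M0 c0 hP.
rewrite -(big_mkord xpredT (fun j => nat_of_bool (P j))) -big_mkcond /= sum1_count.
rewrite -size_filter.
set s := [seq _ <- _ | _].
rewrite -(size_map (fun j => j * c %/ M)%N) -[leqRHS](size_iota 0).
apply: uniq_leq_size.
  rewrite map_inj_in_uniq ?filter_uniq ?iota_uniq // => i j.
  rewrite !mem_filter => /andP[Pi _] /andP[Pj _] e.
  have H u v : (u < v)%N -> P u -> P v -> (u * c %/ M = v * c %/ M)%N -> False.
    move=> uv Pu Pv euv; have := hP u v uv Pu Pv => /dvdn_leq.
    rewrite muln_gt0 c0 subn_gt0 uv => /(_ isT) h.
    have := divn_eq (u * c) M; have := divn_eq (v * c) M; rewrite euv.
    have := ltn_pmod (u * c) M0; have := ltn_pmod (v * c) M0.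
    move: (v * c %/ M)%N (u * c %% M)%N (v * c %% M)%N => q r1 r2 ? ? ? ?.
    have : (c * (v - u) = v * c - u * c)%N by rewrite mulnC mulnBl.
    lia.
  by case: (ltngtP i j) => // [ij|ji]; [have := H i j ij Pi Pj e|have := H j i ji Pj Pi (esym e)].
move=> z /mapP[j]; rewrite mem_filter mem_index_iota mem_iota => /andP[_ /andP[_ jN]] ->.
by rewrite add0n addn1 ltnS leq_div2r // leq_mul2r ltnW ?orbT.
Qed.

(** Two solutions i < j make 2^n divide h (b^(j-i) - 1), as b^i is odd, and then h (b^2 - 1)(j - i):
    the solutions are far apart. *)
Lemma count_congr (b h N n : nat) (r : int) : odd b -> (1 < b)%N -> (0 < h)%N ->
  (\sum_(j < N) ((2 ^ n)%:Z %| ((h * b ^ j)%N%:Z - r)%R)%Z <=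
   N * (h * (b ^ 2 - 1)) %/ 2 ^ n + 1)%N.
Proof.
move=> ob b1 h0.
apply: (@card_congr N _ _ (fun j => ((2 ^ n)%:Z %| (h * b ^ j)%N%:Z - r)%Z)).
- by rewrite expn_gt0.
- by rewrite muln_gt0 h0 subn_gt0 -{1}(exp1n 2) ltn_exp2r.
move=> i j ij hi hj.
have : ((2 ^ n)%:Z %| (h * b ^ j)%N%:Z - (h * b ^ i)%N%:Z)%Z.
  have -> : (h * b ^ j)%N%:Z - (h * b ^ i)%N%:Z = ((h * b ^ j)%N%:Z - r) - ((h * b ^ i)%N%:Z - r).
    by rewrite opprB addrA subrK.
  by rewrite rpredB.
have bij : (b ^ i <= b ^ j)%N by rewrite leq_exp2l // ltnW.
have -> : (h * b ^ j)%N%:Z - (h * b ^ i)%N%:Z = (b ^ i * (h * (b ^ (j - i) - 1)))%N%:Z.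
  rewrite subzn ?leq_mul2l ?bij ?orbT //; congr Posz.
  rewrite -mulnBr mulnCA; congr muln.
  by rewrite mulnBr muln1 -expnD subnKC // ltnW.
rewrite dvdzE /= Gauss_dvdr; last by rewrite coprimeXl // coprimeXr // coprime2n.
(* The power of 2 in [h] is split off, since [dvdn_exp_sub1] concerns b^d - 1 alone. *)
have [v [w ow hE]] : exists v, exists2 w, odd w & h = (2 ^ v * w)%N.
  case: (pfactor_coprime (isT : prime 2) h0) => w cw hE.
  by exists (logn 2 h), w; rewrite -?coprime2n // mulnC.
have [nv|vn] := leqP n v.
  by move=> _; rewrite hE -!mulnA dvdn_mulr // dvdn_exp2l.
rewrite hE -!mulnA -{1 2}(subnKC (ltnW vn)) expnD !dvdn_pmul2l ?expn_gt0 //.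
rewrite Gauss_dvdr; last by rewrite coprimeXl // coprime2n.
by move=> /(dvdn_exp_sub1 ob) hd; rewrite dvdn_mull // mulnC.
Qed.

End lifting.

Lemma scale_exp_between p : (12 <= p)%N -> exists i, (scale_exp i <= p < scale_exp i.+1)%N.
Proof.
move=> p0; have ex : exists m, (p < scale_exp m)%N.
  by exists p; have := scale_exp_ge p; lia.
case: (ex_minnP ex) => [[|m]] pm min; first by move: pm => /=; lia.
by exists m; rewrite pm andbT leqNgt; apply/negP => /min; rewrite ltnn.
Qed.

(** With N = [scale_exp i], the quotient of [scaleR i] by [scaleA i] is at most 2^(-N/2), while p +
    1 <= 3 N^2. The quotient thus stays below a multiple of (p + 1)^-2, which makes the second
    moments summable in p. *)
Lemma scale_square_bound i p : (p < scale_exp i.+1)%N ->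
  ((2 * scaleR i).+1 * p.+1 ^ 2 <= 2 ^ 21 * scaleA i)%N.
Proof.
have hR := scaleR_expn2 i; have hN := scale_exp_ge i.
have -> : scale_exp i.+1 = (3 * i.+2 * scale_exp i)%N by [].
rewrite /scaleA; have hd := leq_expn_div (scale_exp i) (isT : (0 < 16)%N).
move: (scale_exp i) (scaleR i) hR hN hd => N r hR hN hd hp.
have hp2 : (p.+1 <= 3 * N ^ 2)%N by apply: (leq_trans hp); nia.
have hN2 : (N ^ 2 <= (16 * 2 ^ (N %/ 16)) ^ 2)%N by rewrite leq_sqr.
have hp3 : (p.+1 ^ 2 <= (3 * (16 * 2 ^ (N %/ 16)) ^ 2) ^ 2)%N.
  by rewrite leq_sqr; apply: (leq_trans hp2); rewrite leq_mul2l hN2 orbT.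
have h2 : ((2 * r).+1 <= 3 * 2 ^ N./2)%N by have : (0 < 2 ^ N./2)%N; [rewrite expn_gt0|lia].
apply: (leq_trans (leq_mul h2 hp3)).
have -> : (3 * 2 ^ N./2 * (3 * (16 * 2 ^ (N %/ 16)) ^ 2) ^ 2 =
  27 * (16 ^ 4 * (2 ^ N./2 * (2 ^ (N %/ 16)) ^ 4)))%N.
  by move: (2 ^ N./2)%N (2 ^ (N %/ 16))%N => u v; ring.
have -> : (16 ^ 4 = 2 ^ (4 * 4))%N by rewrite expnM.
rewrite -expnM -!expnD.
apply: (@leq_trans (2 ^ 5 * 2 ^ (4 * 4 + (N./2 + N %/ 16 * 4)))); first by rewrite leq_mul2r orbT.
rewrite -expnD leq_exp2l //; lia.
Qed.

(** * Second moments of Weyl sums *)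

Section energy.
Context {R : realType}.
Implicit Types (b h N m : nat) (x : R).

(* The squared modulus of the Weyl sum of [e(h b^j x)], [j < N]. *)
Definition energy h b N : seq (int * R) :=
  [seq ((h * b ^ j)%N%:Z - (h * b ^ l)%N%:Z, 1) | j <- iota 0 N, l <- iota 0 N].

Lemma sum_energy h b N (F : int * R -> R) : \sum_(t <- energy h b N) F t =
  \sum_(j < N) \sum_(l < N) F ((h * b ^ j)%N%:Z - (h * b ^ l)%N%:Z, 1).
Proof.
rewrite big_allpairs_dep /= -[N in iota 0 N]subn0 -/(index_iota 0 N) big_mkord.
by apply: eq_bigr => j _; rewrite big_mkord.
Qed.

Lemma ev_energy h b N x : ev 0 (energy h b N) x =
  (\sum_(j < N) cos (2 * pi * ((h * b ^ j)%:R * x))) ^+ 2 +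
  (\sum_(j < N) sin (2 * pi * ((h * b ^ j)%:R * x))) ^+ 2.
Proof.
rewrite /ev sum_energy !expr2 !mulr_suml -big_split; apply: eq_bigr => j _ /=.
rewrite !mulr_sumr -big_split; apply: eq_bigr => l _ /=.
by rewrite addr0 mul1r intrB -!pmulrn mulrBl mulrBr cosB.
Qed.

Lemma energy_ge0 h b N x : 0 <= ev 0 (energy h b N) x.
Proof. by rewrite ev_energy addr_ge0 // sqr_ge0. Qed.

Variable mu : probability (measurableTypeR R) R.
Hypothesis mu_mode : forall th m n, (`|n| <= scaleR m)%N ->
    \int[mu]_x cos (2 * pi * (n%:~R * x) + th) = cos th * rcoef m n.

(** The expanded square integrates to the coefficients at the h b^j - h b^l. Each is at most 1, and
    it vanishes unless the frequency is within [scaleR i] of a multiple of [scaleA i]; for each l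
    and each of the 2 [scaleR i] + 1 offsets, [count_congr] counts the j. *)
Lemma int_energy h b N i : odd b -> (1 < b)%N -> (0 < h)%N ->
  \int[mu]_x ev 0 (energy h b N) x <=
  (N * (2 * scaleR i).+1 * (N * (h * (b ^ 2 - 1)) %/ scaleA i + 1))%:R.
Proof.
(* [m] only has to be an index for which [scaleR m] exceeds all the frequencies involved. *)
move=> ob b1 h0; pose m := (h * b ^ N)%N.
rewrite (int_ev mu_mode (m := m)); last first.
  apply: deg_leW (scaleR_ge m) _.
  apply/allP => _ /allpairsP[[j l] [/= + + ->]]; rewrite !mem_iota !add0n /= => jN lN.
  have H k : (k < N)%N -> (h * b ^ k <= m)%N by move=> kN; rewrite leq_mul2l leq_exp2l // ltnW ?orbT.
  have := H _ jN; have := H _ lN; lia.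
rewrite mean_cmul_modes sum_energy /=.
pose Rr := scaleR i.
have hc n : mean (cmul (rprod m) (@mode R n)) <=
    (\sum_(r < (2 * Rr).+1) ((scaleA i)%:Z %| (n - (r%:Z - Rr%:Z))%R)%Z)%:R.
  have [c0|c0] := eqVneq (rcoef (R := R) m n) 0.
    by rewrite -/(rcoef m n) c0.
  apply: (le_trans (ler_norm _)); apply: (le_trans (rcoef_le1 m n)); rewrite ler1n.
  have [r rR ra] := rcoef_spec c0 i.
  have hr : (`|(r + Rr%:Z)%R| < (2 * Rr).+1)%N by rewrite /Rr; lia.
  rewrite (bigD1 (Ordinal hr)) //= (_ : `|(r + Rr%:Z)%R|%N%:Z - Rr%:Z = r); last by rewrite /Rr; lia.
  by rewrite ra.
rewrite exchange_big /=.
apply: (@le_trans _ _ (\sum_(l < N) \sum_(j < N)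
   (\sum_(r < (2 * Rr).+1) ((scaleA i)%:Z %|
      ((h * b ^ j)%N%:Z - (h * b ^ l)%N%:Z - (r%:Z - Rr%:Z))%R)%Z)%:R)).
  by apply: ler_sum => l _; apply: ler_sum => j _; rewrite mul1r; exact: hc.
set B := (N * _ %/ _ + 1)%N.
apply: (@le_trans _ _ (\sum_(l < N) ((2 * Rr).+1 * B)%:R)); last first.
  by rewrite sumr_const card_ord -mulnA [leRHS]natrM mulr_natl.
apply: ler_sum => l _; rewrite -natr_sum ler_nat exchange_big /=.
apply: (@leq_trans (\sum_(r < (2 * Rr).+1) B)%N); last by rewrite sum_nat_const card_ord.
apply: leq_sum => r _.
have := count_congr N (scale_exp i) ((h * b ^ l)%N%:Z + (r%:Z - Rr%:Z)) ob b1 h0.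
rewrite -/(scaleA i); apply: leq_trans; apply: leq_sum => j _.
by move: (r%:Z - Rr%:Z) => z; rewrite opprD addrA.
Qed.

(** The index i with [scale_exp i] <= p < [scale_exp i.+1] has [scaleA i] <= N, so the rounding term
    1 in the count is absorbed, and [scale_square_bound] gives the decay in p. *)
Lemma int_energy_dyadic h b m p : odd b -> (1 < b)%N -> (0 < h)%N -> (0 < m)%N -> (12 <= p)%N ->
  \int[mu]_x ev 0 (energy h b (2 ^ p * m)) x <=
  (2 ^ 21 * (h * b ^ 2))%:R * (2 ^ p * m)%:R ^+ 2 / p.+1%:R ^+ 2.
Proof.
move=> ob b1 h0 m0 p12; have [i /andP[ip pi]] := scale_exp_between p12.
apply: (le_trans (int_energy _ i ob b1 h0)).
set N := (2 ^ p * m)%N.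
have NA : (scaleA i <= N)%N.
  by rewrite /N /scaleA -[leqLHS]muln1; apply: leq_mul => //; rewrite leq_exp2l.
rewrite ler_pdivlMr ?exprn_gt0 ?ltr0n // -!natrX -!natrM ler_nat.
have hs := scale_square_bound pi.
set c := (h * (b ^ 2 - 1))%N; have hc : (c.+1 <= h * b ^ 2)%N.
  by rewrite /c; move: (b ^ 2)%N (expn_gt0 b 2) => w; rewrite (ltnW b1) /= => w0; nia.
have A0 := scaleA_gt0 i.
have hq : ((N * c %/ scaleA i + 1) * scaleA i <= N * (h * b ^ 2))%N.
  rewrite mulnDl mul1n; apply: (@leq_trans (N * c + N)).
    by apply: leq_add NA; exact: leq_trunc_div.
  by rewrite -mulnSr leq_mul2l hc orbT.
rewrite -(leq_pmul2l A0).
move: (2 ^ 21)%N hs => G hs.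
have := leq_mul (leq_mul hs hq) (leqnn N).
move: (scaleA i) (N * c %/ scaleA i + 1)%N (h * b ^ 2)%N (p.+1 ^ 2)%N (2 * scaleR i).+1 => a q w s t.
move=> H; apply: leq_trans (leq_trans H _).
  by apply: eq_leq; ring.
by apply: eq_leq; ring.
Qed.

End energy.

Section odd_ae.
Context {R : realType}.
Implicit Types (b h N m : nat) (x : R).

Lemma sum_inv_sqr n : \sum_(i < n) i.+1%:R ^- 2 <= 2 :> R.
Proof.
suff H k : \sum_(i < k.+1) i.+1%:R ^- 2 <= 2 - k.+1%:R^-1 :> R.
  case: n => [|n]; first by rewrite big_ord0.
  by apply: le_trans (H n) _; rewrite gerBl invr_ge0.
elim: k => [|k IH]; first by rewrite big_ord1 expr1n invr1; lra.
rewrite big_ord_recr /=; apply: (@le_trans _ _ (2 - k.+1%:R^-1 + k.+2%:R ^- 2)).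
  by rewrite lerD2r.
rewrite -addrA lerD2l -[k.+2%:R]natr1; set z : R := k.+1%:R.
have z0 : 0 < z by rewrite ltr0n.
have -> : - z^-1 + (z + 1) ^- 2 = - (z + 1)^-1 - (z * (z + 1) ^+ 2)^-1.
  by field; rewrite !gt_eqF // addr_gt0.
by rewrite gerBl invr_ge0 mulr_ge0 ?sqr_ge0 ?ltW.
Qed.

(* Convergence to 0 of the Weyl sums of [b^j h x] along all the sequences of
   lengths [2^p m]; it propagates to all lengths. *)
Definition weyl_dyadic h b x := forall m k, (0 < m)%N ->
  exists P, forall p, (P <= p)%N ->
    ev 0 (energy h b (2 ^ p * m)) x < k.+1%:R^-1 * (2 ^ p * m)%:R ^+ 2.

Variable mu : probability (measurableTypeR R) R.
Hypothesis mu_mode : forall th m n, (`|n| <= scaleR m)%N ->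
    \int[mu]_x cos (2 * pi * (n%:~R * x) + th) = cos th * rcoef m n.

Definition large_energy h b m k p : set R :=
  [set x | k.+1%:R^-1 * (2 ^ p * m)%:R ^+ 2 <= ev 0 (energy h b (2 ^ p * m)) x].

Lemma measurable_large_energy h b m k p :
  measurable (large_energy h b m k p : set (measurableTypeR R)).
Proof.
apply: closed_measurable; rewrite /large_energy; set c := _ * _.
apply: (@preimage_closed _ _ (ev 0 (energy h b (2 ^ p * m))) [set y | c <= y]).
  by move=> x _; exact: ev_continuous.
exact: closed_ge.
Qed.

(** Markov's inequality and Borel-Cantelli. The shift by 12 = [scale_exp 0] leaves out the lengths
    to which [int_energy_dyadic] does not apply. *)
Lemma null_large_energy h b m k : odd b -> (1 < b)%N -> (0 < h)%N -> (0 < m)%N ->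
  mu (lim_sup_set (fun p => large_energy h b m k (p + 12))) = 0%E.
Proof.
move=> ob b1 h0 m0; apply: lim_sup_set_cvg0.
  by move=> p; exact: measurable_large_energy.
pose D : R := k.+1%:R * (2 ^ 21 * (h * b ^ 2))%:R.
have D0 : 0 <= D by rewrite mulr_ge0.
apply: (@le_lt_trans _ _ (D * 2)%:E); last exact: ltry.
apply: lime_le; first by apply: is_cvg_nneseries => n _ _; exact: measure_ge0.
apply: nearW => n; rewrite /= big_mkord.
apply: (@le_trans _ _ (\sum_(i < n) (D * i.+1%:R ^- 2)%:E)%E); last first.
  by rewrite sumEFin lee_fin -mulr_sumr ler_wpM2l // sum_inv_sqr.
apply: lee_sum => p _; have mF := measurable_large_energy h b m k (p + 12).
rewrite -[leLHS]fineK ?fin_num_measure // lee_fin.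
set N := (2 ^ (p + 12) * m)%N.
have N0 : 0 < N%:R ^+ 2 :> R by rewrite exprn_gt0 // ltr0n muln_gt0 expn_gt0.
have h1 := int_energy_dyadic mu_mode ob b1 h0 m0 (leq_addl p 12).
have h2 : k.+1%:R^-1 * N%:R ^+ 2 * fine (mu (large_energy h b m k (p + 12))) <=
    \int[mu]_x ev 0 (energy h b N) x.
  apply: (markov_set mu (C := l1 (energy h b N))) => //; first exact: ev_continuous.
  by move=> x; rewrite energy_ge0 (le_trans (ler_norm _) (ev_le_l1 _ _ _)).
have := le_trans h2 h1; rewrite -/N.
have le : (p + 12).+1%:R ^- 2 <= p.+1%:R ^- 2 :> R.
  by rewrite lef_pV2 ?posrE ?exprn_gt0 ?ltr0n // ler_sqr ?nnegrE // ler_nat ltnS leq_addr.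
rewrite /D; have : 0 <= (2 ^ 21 * (h * b ^ 2))%:R :> R by rewrite ler0n.
move: (2 ^ 21 * (h * b ^ 2))%:R (fine _) => G f G0 hf.
have : f <= k.+1%:R * G * (p + 12).+1%:R ^- 2.
  rewrite -(ler_pM2l N0) -(ler_pM2l (x := k.+1%:R^-1)) ?invr_gt0 ?ltr0n //.
  rewrite mulrA; apply: (le_trans hf).
  have -> : k.+1%:R^-1 * (N%:R ^+ 2 * (k.+1%:R * G * (p + 12).+1%:R ^- 2)) =
     k.+1%:R^-1 * k.+1%:R * (G * N%:R ^+ 2 * (p + 12).+1%:R ^- 2).
    by ring.
  by rewrite mulVf ?mul1r // pnatr_eq0.
move=> /le_trans; apply; rewrite ler_wpM2l // mulr_ge0 //.
Qed.

Definition weyl_odd_bases : set R := [set x | forall b h, odd b -> (3 <= b)%N -> (0 < h)%N ->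
  weyl_dyadic h b x].

Lemma negligible_weyl_odd_basesC : mu.-negligible (~` weyl_odd_bases).
Proof.
pose Z b h m k := if odd b && (1 < b)%N then
  lim_sup_set (fun p => large_energy h.+1 b m.+1 k (p + 12)) else set0.
apply: (@negligibleS _ _ _ mu (\bigcup_b \bigcup_h \bigcup_m \bigcup_k Z b h m k)); last first.
  do 4 (apply: negligible_bigcup => ?).
  rewrite /Z; case: ifP => [/andP[ob b1]|_]; last exact: negligible_set0.
  apply/negligibleP; last exact: null_large_energy.
  apply: bigcap_measurable => // j _; apply: bigcup_measurable => p _.
  exact: measurable_large_energy.
move=> x; apply: contra_notP => nZ b h ob b3 h0 m k m0.
apply: contrapT => nP.
apply: nZ; exists b => //; exists h.-1 => //; exists m.-1 => //; exists k => //.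
rewrite /Z ob (ltnW b3) !prednK // => P _.
have /existsNP[p] := fun hP => nP (ex_intro _ (P + 12)%N hP).
move=> /not_implyP[Pp /negP]; rewrite -leNgt => hp.
exists (p - 12)%N; first by rewrite /= leq_subRL //; lia.
rewrite /large_energy /= subnK //; lia.
Qed.

End odd_ae.

(** * From Weyl sums to block frequencies *)

Section averages.
Context {R : realType}.
Implicit Types (x y e : R).

Lemma common_bound (P : nat -> nat -> Prop) n : (forall m, exists p0, forall p, (p0 <= p)%N -> P m p) ->
  exists p0, forall m p, (m < n)%N -> (p0 <= p)%N -> P m p.
Proof.
move=> h; elim: n => [|n [p0 IH]]; first by exists 0%N.
have [p1 h1] := h n; exists (maxn p0 p1) => m p.
rewrite ltnS leq_eqVlt geq_max => /orP[/eqP -> /andP[_ /h1 //]|mn /andP[pp _]].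
exact: IH.
Qed.

(** Every large N exceeds some 2^p m with E <= m < 2E by less than 2^p <= N / E. So finitely many
    multipliers m suffice for a given precision, and their thresholds have a common bound. *)
Lemma avg_dyadic (u : nat -> R) : (forall j, `|u j| <= 1) ->
  (forall m k, (0 < m)%N -> exists P, forall p, (P <= p)%N ->
    (\sum_(j < 2 ^ p * m) u j) ^+ 2 < k.+1%:R^-1 * (2 ^ p * m)%:R ^+ 2) ->
  forall e, 0 < e -> exists N0, forall N, (N0 <= N)%N -> `|\sum_(j < N) u j| <= e * N%:R.
Proof.
move=> u1 hu e e0; have e2 : 0 < e / 2 by rewrite divr_gt0.
pose E := (Num.truncn (e / 2)^-1).+1.
have hE : E%:R^-1 <= e / 2.
  by rewrite invf_ple ?posrE ?ltr0n //; apply/ltW; exact: truncnS_gt.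
pose k := Num.truncn ((e / 2) ^- 2).
have hk : k.+1%:R^-1 <= (e / 2) ^+ 2.
  by rewrite invf_ple ?posrE ?ltr0n ?exprn_gt0 //; apply/ltW; exact: truncnS_gt.
have [m|P0 hP] := @common_bound (fun m p => (0 < m)%N ->
    (\sum_(j < 2 ^ p * m) u j) ^+ 2 < k.+1%:R^-1 * (2 ^ p * m)%:R ^+ 2) (2 * E).
  have [->|m0] := posnP m; first by exists 0%N.
  by have [P h] := hu m k m0; exists P => p hp _; exact: h.
have E0 : (0 < E)%N by [].
exists (2 ^ P0 * E)%N => N hN.
have NE : (2 ^ P0 <= N %/ E)%N by rewrite leq_divRL.
pose p := trunc_log 2 (N %/ E).
have Q0 : (0 < N %/ E)%N by apply: leq_trans NE; rewrite expn_gt0.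
have /andP[p1 p2] : (2 ^ p <= N %/ E < 2 ^ p.+1)%N by exact: trunc_log_bounds.
have pP : (P0 <= p)%N by rewrite -ltnS -(@ltn_exp2l 2) //; exact: leq_ltn_trans NE p2.
pose m := (N %/ 2 ^ p)%N; have tp0 : (0 < 2 ^ p)%N by rewrite expn_gt0.
have pE : (2 ^ p * E <= N)%N by rewrite -leq_divRL.
have mE : (E <= m)%N by rewrite leq_divRL // mulnC.
have m2 : (m < 2 * E)%N.
  by rewrite ltn_divLR // mulnAC -expnS -ltn_divLR.
have mN : (2 ^ p * m <= N)%N by rewrite mulnC leq_trunc_div.
have Nm : (N - 2 ^ p * m < 2 ^ p)%N.
  by rewrite {1}(divn_eq N (2 ^ p)) -/m [(m * _)%N]mulnC addKn ltn_pmod.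
have h1 : `|\sum_(j < 2 ^ p * m) u j| <= e / 2 * N%:R.
  apply: (@le_trans _ _ (e / 2 * (2 ^ p * m)%:R)); last by rewrite ler_wpM2l ?(ltW e2) // ler_nat.
  rewrite -ler_sqr ?nnegrE ?mulr_ge0 ?(ltW e0) // real_normK ?num_real // exprMn.
  apply: (le_trans (ltW (hP m p m2 pP (leq_trans E0 mE)))).
  by rewrite ler_wpM2r ?sqr_ge0.
have h2 : `|\sum_(j < N) u j - \sum_(j < 2 ^ p * m) u j| <= e / 2 * N%:R.
  rewrite -(big_mkord xpredT u) -(big_mkord xpredT u) (big_cat_nat (n := (2 ^ p * m)%N)) //= addrAC subrr add0r.
  apply: (le_trans (ler_norm_sum _ _ _)).
  apply: (@le_trans _ _ (\sum_(2 ^ p * m <= i < N) 1)); first by apply: ler_sum => i _; exact: u1.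
  rewrite sumr_const_nat; apply: (@le_trans _ _ (E%:R^-1 * N%:R)); last by rewrite ler_wpM2r.
  rewrite mulrC ler_pdivlMr ?ltr0n // -natrM ler_nat.
  apply: leq_trans pE; rewrite leq_mul2r (ltnW Nm) orbT //.
rewrite -[\sum_(j < N) u j](subrK (\sum_(j < 2 ^ p * m) u j)).
apply: (le_trans (ler_normD _ _)); apply: (le_trans (lerD h2 h1)).
by rewrite -mulrDl -splitr.
Qed.

End averages.

Section fejer_partition.
Context {R : realType}.
Implicit Types (x y : R) (Q : nat).

Lemma one_sub_cos_ge (d w : R) : 0 <= d -> d <= w -> w <= 1 - d ->
  2 * d ^+ 2 <= 1 - cos (2 * pi * w).
Proof.
move=> d0 dw wd.
have H (v : R) : `|v| <= 1 / 2 -> 2 * v ^+ 2 <= 1 - cos (2 * pi * v).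
  move=> hv; have := sqr_le_sin2 hv.
  rewrite -mulrA [2 * (pi * v)]mulr_natl cos_mulr2n cos2sin2.
  by move: (sin _ ^+ 2) (v ^+ 2) => a b *; lra.
have [w2|w2] := leP w (1 / 2).
  apply: le_trans (H w _); last by rewrite ger0_norm //; lra.
  by rewrite ler_wpM2l // ler_sqr ?nnegrE //; lra.
rewrite -(cosB_int 1) mulr1z; apply: le_trans (H _ _); last by rewrite ler_norml; lra.
by rewrite ler_wpM2l // -[leRHS]sqrrN opprB ler_sqr ?nnegrE; lra.
Qed.

(** Summation over the translates multiplies frequency d by a sum of Q-th roots of unity, which
    vanishes for 0 < d < Q: at its angle t one has cos(Q t) = 1 and cos t <> 1, so [csum_ssum_eq]
    annihilates both parts. *)
Lemma fejer_partition Q x : (0 < Q)%N ->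
  \sum_(s < Q) (1 + ev 0 (fejer 1 Q) (x - s%:R / Q%:R)) = Q%:R.
Proof.
move=> Q0; have Q0' : Q%:R != 0 :> R by rewrite pnatr_eq0 -lt0n.
rewrite big_split /= sumr_const card_ord -[RHS]addr0; congr (_ + _).
rewrite /ev exchange_big /= big_map big_seq big1 // => d.
rewrite mem_iota add0n => /andP[_ dQ] /=; rewrite -mulr_sumr.
(* The list ends with frequency Q, whose coefficient is 0. *)
have [->|dQ'] := eqVneq d.+1 Q; first by rewrite divff // subrr mulr0 mul0r.
have {dQ'}dQ : (d.+1 < Q)%N by rewrite ltn_neqAle dQ' dQ.
set t : R := 2 * pi * (d.+1%:R / Q%:R).
have e : (csum Q t ^+ 2 + ssum Q t ^+ 2) * (1 - cos t) = 0.
  rewrite csum_ssum_eq (_ : Q%:R * t = 0 + 2 * pi * (d.+1%:Z)%:~R).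
    by rewrite cos_intD cos0 subrr.
  by rewrite add0r /t -pmulrn; move: (pi : R) (d.+1%:R : R) => p z; field.
have c0 : 1 - cos t != 0.
  rewrite gt_eqF //; have Qi : 0 < Q%:R^-1 :> R by rewrite invr_gt0 ltr0n.
  apply: lt_le_trans (one_sub_cos_ge (d := Q%:R^-1) _ _ _).
  - by rewrite mulr_gt0 // exprn_gt0.
  - exact: ltW.
  - by rewrite ler_peMl ?(ltW Qi) // ler1n.
  - by rewrite lerBrDr -{2}[Q%:R^-1]mul1r -mulrDl natr1 ler_pdivrMr ?ltr0n // mul1r ler_nat.
move/eqP: e; rewrite mulf_eq0 (negbTE c0) orbF paddr_eq0 ?sqr_ge0 // !sqrf_eq0.
move=> /andP[/eqP c /eqP s].
rewrite (eq_bigr (fun i : 'I_Q => cos (2 * pi * (d.+1%:R * x)) * cos (i%:R * t) +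
    sin (2 * pi * (d.+1%:R * x)) * sin (i%:R * t))).
  by rewrite big_split /= -!mulr_sumr -/(csum Q t) -/(ssum Q t) c s !mulr0 addr0 mulr0.
move=> i _; rewrite -cosB addr0 mul1r -pmulrn; congr cos.
by rewrite /t; move: (pi : R) (d.+1%:R : R) (i%:R : R) (Q%:R^-1 : R) => p z w q; ring.
Qed.

End fejer_partition.

Section blocks.
Context {R : realType}.
Implicit Types (x y : R) (b g V : nat).

(* A nonnegative trigonometric polynomial of mean [1/V + 2/g] that is close to
   1 on [[v/V, (v+1)/V]] modulo 1. *)
Definition majorant V g (v : nat) y : R :=
  (V * g ^ 4)%:R^-1 * \sum_(s < g ^ 4 + 2 * (V * g ^ 3))
    (1 + ev 0 (fejer 1 (V * g ^ 4)) (y - (v%:R / V%:R - g%:R^-1) - s%:R / (V * g ^ 4)%:R)).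

Lemma majorant_ge0 V g v y : (0 < V)%N -> (0 < g)%N -> 0 <= majorant V g v y.
Proof.
move=> V0 g0; rewrite mulr_ge0 // sumr_ge0 // => s _.
by rewrite fejer_ge0 // muln_gt0 V0 expn_gt0 g0.
Qed.

(** All Q = V g^4 translates together would give 1. The retained centres cover the interval with a
    margin 1/g on both sides, so an omitted one is at distance at least 1/g from [y] modulo 1, where
    the kernel is at most g^2 / Q; the normalised loss is at most g^2 / Q <= 1/g. *)
Lemma majorant_ge V g v (z : int) y : (1 < V)%N -> (3 < g)%N ->
  v%:R / V%:R <= y - z%:~R <= v.+1%:R / V%:R -> 1 - g%:R^-1 <= majorant V g v y.
Proof.
move=> V1 g3 /andP[y1 y2].
have g0 : 0 < g%:R :> R by rewrite ltr0n; lia.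
have V0 : 0 < V%:R :> R by rewrite ltr0n; lia.
set Q := (V * g ^ 4)%N; set n := (g ^ 4 + 2 * (V * g ^ 3))%N.
have Q0 : (0 < Q)%N by rewrite muln_gt0 expn_gt0; lia.
have Qr : 0 < Q%:R :> R by rewrite ltr0n.
have nQ : (n <= Q)%N.
  rewrite /n /Q expnS; have : (0 < g ^ 3)%N by rewrite expn_gt0; lia.
  by move: (g ^ 3)%N => w; nia.
set a : R := v%:R / V%:R - g%:R^-1.
have := fejer_partition (y - a) Q0.
rewrite -(big_mkord xpredT (fun s => 1 + ev 0 (fejer 1 Q) (y - a - s%:R / Q%:R))).
rewrite (big_cat_nat (n := n)) //= big_mkord => e.
rewrite /majorant -/Q -/n -/a.
have -> : \sum_(i < n) (1 + ev 0 (fejer 1 Q) (y - a - i%:R / Q%:R)) =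
  Q%:R - \sum_(n <= i < Q) (1 + ev 0 (fejer 1 Q) (y - a - i%:R / Q%:R)).
  by rewrite -[X in _ = X - _]e addrK.
rewrite mulrBr mulVf ?gt_eqF // lerD2l lerN2.
have gQ : g%:R ^+ 2 / Q%:R <= g%:R^-1 :> R.
  rewrite ler_pdivrMr // mulrC ler_pdivlMr // -exprSr -natrX ler_nat /Q.
  rewrite expnS; have : (0 < g ^ 3)%N by rewrite expn_gt0; lia.
  by move: (g ^ 3)%N => w; nia.
apply: le_trans gQ; rewrite mulrC ler_pdivrMr //.
apply: (@le_trans _ _ (\sum_(n <= i < Q) (g%:R ^+ 2 / Q%:R))); last first.
  rewrite sumr_const_nat -[_ *+ (Q - n)]mulr_natr ler_wpM2l ?divr_ge0 ?sqr_ge0 // ler_nat.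
  exact: leq_subr.
rewrite big_nat [leRHS]big_nat; apply: ler_sum => i /andP[ni iQ].
set w := y - a - _.
have hw : 2 * g%:R^-1 ^+ 2 <= 1 - cos (2 * pi * w).
  have -> : cos (2 * pi * w) = cos (2 * pi * (w - z%:~R - (-1)%:~R)).
    by rewrite !cosB_int.
  have hiQ : i%:R / Q%:R < 1 :> R by rewrite ltr_pdivrMr // mul1r ltr_nat.
  have hni : V%:R^-1 + 2 * g%:R^-1 <= i%:R / Q%:R :> R.
    rewrite ler_pdivlMr //; apply: (@le_trans _ _ n%:R); last by rewrite ler_nat.
    rewrite /n /Q natrD [(2 * _)%:R]natrM [(V * g ^ 3)%:R]natrM [(V * g ^ 4)%:R]natrM !natrX.
    by rewrite le_eqVlt; apply/orP; left; apply/eqP; field; rewrite !gt_eqF.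
  have hv : v.+1%:R / V%:R = v%:R / V%:R + V%:R^-1 :> R by rewrite -natr1 mulrDl mul1r.
  rewrite hv in y2; rewrite mulrNz mulr1z opprK.
  have gi : 0 < g%:R^-1 :> R by rewrite invr_gt0.
  apply: one_sub_cos_ge; first exact: ltW.
    by rewrite /w /a; move: y1 y2 hiQ hni gi => *; lra.
  by rewrite /w /a; move: y1 y2 hiQ hni gi => *; lra.
have := fejer_cos 1 w Q0; rewrite mul1r.
have F0 := fejer_ge0 1 w Q0.
move: (1 + ev 0 _ w) F0 hw => F F0 hw hF.
have gg : 0 < 2 * g%:R^-1 ^+ 2 :> R by rewrite mulr_gt0 // exprn_gt0 // invr_gt0.
rewrite -(ler_pM2r gg); apply: (@le_trans _ _ (F * (1 - cos (2 * pi * w)))).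
  by rewrite ler_wpM2l.
rewrite hF; have -> : g%:R ^+ 2 / Q%:R * (2 * g%:R^-1 ^+ 2) = 2 / Q%:R :> R.
  by move: (Q%:R : R) Qr (g%:R : R) g0 => r r0 t t0; field; rewrite !gt_eqF.
rewrite ler_wpM2r ?invr_ge0 ?(ltW Qr) //.
by have := cos_geN1 (2 * pi * ((1 * Q)%:R * w)); lra.
Qed.

(** Equidistribution of the b^j x modulo 1 in the form of Weyl's criterion, with real and imaginary
    parts separate; negative [h] give the same sums up to sign. *)
Definition equidistributed b x := forall h, (0 < h)%N -> forall e, 0 < e ->
  exists N0, forall N, (N0 <= N)%N ->
   `|\sum_(j < N) cos (2 * pi * ((h * b ^ j)%:R * x))| <= e * N%:R /\
   `|\sum_(j < N) sin (2 * pi * ((h * b ^ j)%:R * x))| <= e * N%:R.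

Lemma equidistributed_weyl b x : (forall h, (0 < h)%N -> weyl_dyadic h b x) ->
  equidistributed b x.
Proof.
move=> hx h h0 e e0.
have hw := hx h h0.
have [|N1 h1] := @avg_dyadic R (fun j => cos (2 * pi * ((h * b ^ j)%:R * x))) (fun j => cos_max _) _ _ e0.
  move=> m k m0; have [P hP] := hw m k m0; exists P => p /hP.
  by rewrite ev_energy; apply: le_lt_trans; rewrite lerDl sqr_ge0.
have [|N2 h2] := @avg_dyadic R (fun j => sin (2 * pi * ((h * b ^ j)%:R * x))) (fun j => sin_max _) _ _ e0.
  move=> m k m0; have [P hP] := hw m k m0; exists P => p /hP.
  by rewrite ev_energy; apply: le_lt_trans; rewrite lerDr sqr_ge0.
by exists (maxn N1 N2) => N; rewrite geq_max => /andP[/h1 ? /h2 ?].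
Qed.

(** The mean of the majorant is the share 1/V + 2/g of retained translates. Its other frequencies
    are finite in number, and equidistribution makes their total at most N / g. *)
Lemma sum_majorant V g v b x : equidistributed b x -> (0 < V)%N -> (3 < g)%N ->
  exists N0, forall N, (N0 <= N)%N ->
    \sum_(j < N) majorant V g v ((b ^ j)%:R * x) <= (V%:R^-1 + 3 / g%:R) * N%:R.
Proof.
move=> hx V0 g3; set Q := (V * g ^ 4)%N; set n := (g ^ 4 + 2 * (V * g ^ 3))%N.
have g0 : 0 < g%:R :> R by rewrite ltr0n; lia.
have V0' : 0 < V%:R :> R by rewrite ltr0n; lia.
have Q0 : (0 < Q)%N by rewrite muln_gt0 expn_gt0; lia.
have Qr : 0 < Q%:R :> R by rewrite ltr0n.
set a : R := v%:R / V%:R - g%:R^-1.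
(* Each of the n translates has Q frequencies with an error of at most 4 e N; this [e] keeps the
   total below 1/g, and the 1 keeps the denominator positive. *)
pose e : R := (g%:R * (4 * n * Q)%:R + 1)^-1.
have e0 : 0 < e by rewrite invr_gt0 ltr_wpDl // mulr_ge0.
have [m|N0 hN] := @common_bound (fun d N =>
   `|\sum_(j < N) cos (2 * pi * ((d.+1 * b ^ j)%:R * x))| <= e * N%:R /\
   `|\sum_(j < N) sin (2 * pi * ((d.+1 * b ^ j)%:R * x))| <= e * N%:R) Q.
  exact: hx.
exists N0 => N NN.
rewrite /majorant -mulr_sumr exchange_big /= -/Q -/n -/a.
have H s : \sum_(j < N) (1 + ev 0 (fejer 1 Q) ((b ^ j)%:R * x - a - s%:R / Q%:R)) <=
   N%:R + (4 * Q)%:R * e * N%:R.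
  rewrite big_split /= sumr_const card_ord; apply: lerD => //.
  rewrite /ev exchange_big /= big_map.
  apply: (@le_trans _ _ (\sum_(d <- iota 0 Q) 4 * e * N%:R)); last first.
    by rewrite big_const_seq count_predT size_iota iter_addr_0 -mulr_natl natrM; rewrite le_eqVlt; apply/orP; left; apply/eqP; ring.
  rewrite big_seq [leRHS]big_seq; apply: ler_sum => d.
  rewrite mem_iota add0n => /andP[_ dQ] /=; rewrite -mulr_sumr.
  have [hc hs] := hN d N dQ NN.
  have w0 : 0 <= (d.+1%:R / Q%:R : R) <= 1.
    by rewrite divr_ge0 //= ler_pdivrMr // mul1r ler_nat.
  pose al := 2 * pi * (d.+1%:R * (a + s%:R / Q%:R)).
  have -> : \sum_(j < N) cos (2 * pi * ((1%:Z * d.+1%:Z)%:~R * ((b ^ j)%:R * x - a - s%:R / Q%:R)) + 0) =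
    cos al * \sum_(j < N) cos (2 * pi * ((d.+1 * b ^ j)%:R * x)) +
    sin al * \sum_(j < N) sin (2 * pi * ((d.+1 * b ^ j)%:R * x)).
    rewrite !mulr_sumr -big_split /=; apply: eq_bigr => j _.
    rewrite -cosB -[RHS]cosN addr0 mul1r -pmulrn natrM; congr cos; rewrite /al /a.
    by move: (v%:R / V%:R - g%:R^-1) (pi : R) (d.+1%:R : R) ((b ^ j)%:R : R) (s%:R / Q%:R : R) => *; ring.
  set c := \sum_(j < N) _ in hc *; set t := \sum_(j < N) _ in hs *.
  have hh : `|cos al * c + sin al * t| <= 2 * (e * N%:R).
    apply: (le_trans (ler_normD _ _)); rewrite !normrM mulr2n mulrDl mul1r.
    by apply: lerD; [apply: le_trans hc|apply: le_trans hs]; rewrite ler_piMl // ?cos_max ?sin_max.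
  apply: (le_trans (ler_norm _)); rewrite normrM.
  have -> : 4 * e * N%:R = 2 * (2 * (e * N%:R)) by ring.
  move: w0; move: (d.+1%:R / Q%:R : R) => w /andP[w0 w1].
  by apply: ler_pM => //; rewrite ger0_norm; lra.
apply: (@le_trans _ _ (Q%:R^-1 * \sum_(s < n) (N%:R + (4 * Q)%:R * e * N%:R))).
  by rewrite ler_wpM2l ?invr_ge0 ?(ltW Qr) //; apply: ler_sum => s _; exact: H.
rewrite sumr_const card_ord -[_ *+ n]mulr_natl.
have he : (4 * n * Q)%:R * e <= g%:R^-1.
  rewrite /e ler_pdivrMr ?ltr_wpDl ?mulr_ge0 // mulrDr mulrA mulVf ?gt_eqF // mul1r mulr1 lerDl.
  by rewrite invr_ge0 ltW.
have hn : n%:R / Q%:R = V%:R^-1 + 2 / g%:R :> R.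
  by rewrite /n /Q natrD [(2 * _)%:R]natrM [(V * g ^ 3)%:R]natrM [(V * g ^ 4)%:R]natrM !natrX; field; rewrite !gt_eqF.
have hQ1 : Q%:R^-1 <= 1 :> R by rewrite invf_le1 // ler1n.
have -> : Q%:R^-1 * (n%:R * (N%:R + (4 * Q)%:R * e * N%:R)) =
   n%:R / Q%:R * N%:R + Q%:R^-1 * ((4 * n * Q)%:R * e) * N%:R.
  by rewrite !natrM; ring.
rewrite hn -mulrDl ler_wpM2r //.
have : Q%:R^-1 * ((4 * n * Q)%:R * e) <= g%:R^-1.
  rewrite -[leRHS]mul1r; apply: ler_pM => //.
  by rewrite mulr_ge0 // ltW.
by move: (_ * (_ * e)) => q; lra.
Qed.

End blocks.

Section normal.
Context {R : realType}.
Implicit Types (x : R) (b : nat).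

Definition nfloor x : nat := `|Num.floor x|%N.

Lemma nfloor_itv x : 0 <= x -> (nfloor x)%:R <= x < (nfloor x).+1%:R.
Proof.
move=> x0; have fE : Num.floor x = (nfloor x)%:Z by rewrite /nfloor gez0_abs ?floor_ge0.
by have := floor_itv x; rewrite fE intrD mulr1z -pmulrn natr1.
Qed.

Lemma nfloor_digit b x j : (0 < b)%N -> 0 <= x < 1 ->
  nfloor (b%:R ^+ j.+1 * x) = (b * nfloor (b%:R ^+ j * x) + digit b x j)%N.
Proof.
move=> b0 /andP[x0 x1].
have fx : frac_part x = x.
  rewrite /frac_part (_ : Num.floor x = 0) ?subr0 //.
  by apply/floor_def; rewrite x0.
have b0' : 0 < b%:R :> R by rewrite ltr0n.
have p0 i : 0 <= b%:R ^+ i * x by rewrite mulr_ge0 // exprn_ge0.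
have /andP[h1 h2] := nfloor_itv (p0 j); have /andP[h3 h4] := nfloor_itv (p0 j.+1).
rewrite /digit fx -/(nfloor _).
move: (nfloor (_ ^+ j * x)) (nfloor (_ ^+ j.+1 * x)) h1 h2 h3 h4 => u v h1 h2 h3 h4.
rewrite exprS -mulrA in h3 h4.
have l1 : (b * u < v.+1)%N.
  by rewrite -(ltr_nat R) natrM; apply: le_lt_trans h4; rewrite ler_pM2l.
have l2 : (v < b * u.+1)%N.
  by rewrite -(ltr_nat R) natrM; apply: le_lt_trans h3 _; rewrite ltr_pM2l.
have -> : v = (u * b + (v - b * u))%N by lia.
by rewrite modnMDl modn_small; lia.
Qed.

Fixpoint block_val b (w : nat -> nat) k : nat :=
  if k is i.+1 then (b * block_val b w i + w i)%N else 0%N.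

Lemma nfloor_block b x j (w : nat -> nat) k : (0 < b)%N -> 0 <= x < 1 ->
  (forall i, (i < k)%N -> digit b x (j + i) = w i) ->
  nfloor (b%:R ^+ (j + k) * x) = (b ^ k * nfloor (b%:R ^+ j * x) + block_val b w k)%N.
Proof.
move=> b0 x01; elim: k => [|k IH] h; first by rewrite expn0 mul1n !addn0.
rewrite addnS nfloor_digit // IH; last by move=> i ik; rewrite h // ltnS ltnW.
by rewrite h // expnS /=; lia.
Qed.

(** A block at position j confines b^j x modulo 1 to a b-adic interval. The right end is included,
    which is harmless as only upper bounds on counts are drawn from it. *)
Lemma block_itv b x j (w : nat -> nat) k : (0 < b)%N -> 0 <= x < 1 ->
  (forall i, (i < k)%N -> digit b x (j + i) = w i) ->
  (block_val b w k)%:R / (b ^ k)%:R <= (b ^ j)%:R * x - (nfloor (b%:R ^+ j * x))%:Z%:~R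
    <= (block_val b w k).+1%:R / (b ^ k)%:R.
Proof.
move=> b0 x01 /(nfloor_block b0 x01) h.
have p0 : 0 <= b%:R ^+ (j + k) * x by case/andP: x01 => *; rewrite mulr_ge0 // exprn_ge0.
have := nfloor_itv p0; rewrite h; move: (nfloor (b%:R ^+ j * x)) (block_val b w k) => u v.
have B0 : 0 < (b ^ k)%:R :> R by rewrite ltr0n expn_gt0 b0.
rewrite -pmulrn exprD -!natrX => /andP[h1 h2].
rewrite ler_pdivrMr // ler_pdivlMr // mulrBl.
move: h1 h2; rewrite -[(_ + v).+1%:R]natr1 -[v.+1%:R]natr1 natrD natrM.
by move: ((b ^ k)%:R : R) ((b ^ j)%:R : R) (u%:R : R) (v%:R : R) => B J U W h1 h2; apply/andP; split; lra.
Qed.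

Lemma block_count_upper b x k (w : k.-tuple 'I_b) (eta : R) : (1 < b)%N -> 0 <= x < 1 -> (0 < k)%N ->
  equidistributed b x -> 0 < eta ->
  exists N0, forall N, (N0 <= N)%N ->
    (block_count x w N)%:R <= ((b ^ k)%:R^-1 + eta) * N%:R.
Proof.
move=> b1 x01 k0 hx eta0; have b0 : (0 < b)%N by exact: ltnW.
(* Of the error 4/g <= eta, 3/g comes from [sum_majorant] and 1/g from the defect in
   [majorant_ge]. *)
pose g := (Num.truncn (4 / eta) + 4)%N.
have g3 : (3 < g)%N by rewrite /g; lia.
have g0 : 0 < g%:R :> R by rewrite ltr0n; lia.
have hg : 4 / g%:R <= eta.
  rewrite ler_pdivrMr // mulrC -ler_pdivrMr //; apply/ltW/(lt_le_trans (truncnS_gt _)).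
  by rewrite ler_nat /g -addn1 leq_add2l.
set V := (b ^ k)%N; have V1 : (1 < V)%N by rewrite /V -{1}(expn0 b) ltn_exp2l.
pose wn i := nth 0%N [seq nat_of_ord d | d <- w] i.
have [N0 hN] := sum_majorant (block_val b wn k) hx (ltnW V1) g3.
exists N0 => N /hN h.
have cN : (block_count x w N)%:R <= N%:R :> R.
  rewrite ler_nat /block_count; apply: (@leq_trans (\sum_(j < N) 1)%N).
    by apply: leq_sum => j _; case: [forall _, _].
  by rewrite sum_nat_const card_ord muln1.
have hc : (1 - g%:R^-1) * (block_count x w N)%:R <= ((V%:R^-1 + 3 / g%:R) * N%:R : R).
  apply: le_trans h; rewrite /block_count natr_sum mulr_sumr; apply: ler_sum => j _.
  case: forallP => [m|_] /=; last by rewrite mulr0 majorant_ge0 //; lia.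
  rewrite mulr1; apply: (majorant_ge (z := (nfloor (b%:R ^+ j * x))%:Z) V1 g3).
  apply: block_itv => // i ik; have /eqP := m (Ordinal ik); rewrite /= => ->.
  by rewrite /wn (nth_map (tnth w (Ordinal ik))) ?size_tuple // {1}(tnth_nth (tnth w (Ordinal ik))).
have hgc : g%:R^-1 * (block_count x w N)%:R <= g%:R^-1 * N%:R :> R.
  by rewrite ler_wpM2l // invr_ge0 ltW.
have := ler_wpM2r (ler0n R N) hg.
move: hc hgc; move: (block_count x w N)%:R (V%:R^-1) (g%:R^-1) (N%:R) => c *; lra.
Qed.

Lemma sum_block_count b x k N : (0 < b)%N ->
  (\sum_(w : k.-tuple 'I_b) block_count x w N = N)%N.
Proof.
move=> b0; rewrite /block_count exchange_big /=.
rewrite -[RHS](card_ord N) -sum1_card; apply: eq_bigr => j _.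
have dlt l : (digit b x l < b)%N by rewrite /digit ltn_pmod.
pose w0 : k.-tuple 'I_b := [tuple Ordinal (dlt (j + i)%N) | i < k].
rewrite (bigD1 w0) //= big1 ?addn0 => [|w ww].
  by apply/eqP; rewrite eqb1; apply/forallP => i; rewrite tnth_mktuple.
apply/eqP; rewrite eqb0; apply: contra ww => /forallP h.
by apply/eqP/eq_from_tnth => i; apply/val_inj; rewrite tnth_mktuple /= (eqP (h i)).
Qed.

(** Upper bounds are enough: the counts of all V = b^k blocks add up to N, so bounds for the others
    bound the count of [w] from below. The V - 1 errors are why [eta] is e / V. *)
Lemma equidistributed_normal b x : (1 < b)%N -> 0 <= x < 1 -> equidistributed b x ->
  normal_in_base b x.
Proof.
move=> b1 x01 hx k w k0; have b0 := ltnW b1.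
set V := (b ^ k)%N; have V0 : (0 < V)%N by rewrite expn_gt0 b0.
have V0' : 0 < V%:R :> R by rewrite ltr0n.
apply/cvgrPdist_le => e e0.
pose eta := e / V%:R; have eta0 : 0 < eta by rewrite divr_gt0.
have hw (w' : k.-tuple 'I_b) := block_count_upper w' b1 x01 k0 hx eta0.
have [N0 hN] : exists N0, forall N, (N0 <= N)%N -> forall w' : k.-tuple 'I_b,
    (block_count x w' N)%:R <= (V%:R^-1 + eta) * N%:R :> R.
  pose N0 w' := sval (cid (hw w')).
  exists (\max_w' N0 w') => N hN w'; apply: (svalP (cid (hw w'))).
  by apply: leq_trans hN; exact: leq_bigmax.
exists (maxn 1 N0) => // N; rewrite /= geq_max => /andP[N1 NN].
have NR : 0 < N%:R :> R by rewrite ltr0n.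
rewrite -natrX -/V ler_distlC; apply/andP; split; last first.
  rewrite ler_pdivrMr //; apply: (le_trans (hN N NN w)); rewrite ler_wpM2r // lerD2l.
  by rewrite /eta ler_pdivrMr // ler_peMr ?(ltW e0) // ler1n.
rewrite ler_pdivlMr //.
have := sum_block_count x k N b0 => /(congr1 (fun n => n%:R : R)).
rewrite (bigD1 w) //= natrD natr_sum => e1.
have : \sum_(w' | w' != w) (block_count x w' N)%:R <= \sum_(w' : k.-tuple 'I_b | w' != w) ((V%:R^-1 + eta) * N%:R).
  by apply: ler_sum => w' _; exact: hN.
rewrite sumr_const -[_ *+ _]mulr_natl.
have -> : #|[pred w' : k.-tuple 'I_b | w' != w]| = V.-1.
  by rewrite (eq_card (B := predC1 w)) // cardC1 card_tuple card_ord.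
have -> : V.-1%:R = V%:R - 1 :> R by rewrite -subn1 natrB.
move: e1; move: (block_count x w N)%:R (\sum_(_ | _) _) => c s e1 h.
have h2 : (V%:R - 1) * ((V%:R^-1 + eta) * N%:R) = (1 + e - V%:R^-1 - eta) * N%:R.
  by rewrite /eta; move: (V%:R : R) V0' => v v0; field; rewrite gt_eqF.
rewrite h2 in h; have en : 0 <= eta * N%:R by rewrite mulr_ge0 // ltW.
move: en h e1; move: (V%:R^-1) (N%:R : R) => v n en h e1; lra.
Qed.

Lemma weyl_odd_bases_normal x : 0 <= x < 1 -> weyl_odd_bases x ->
  forall b, (3 <= b)%N -> odd b -> normal_in_base b x.
Proof.
move=> x01 hx b b3 ob; apply: equidistributed_normal => //; first exact: ltnW.
by apply: equidistributed_weyl => h h0; exact: hx.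
Qed.

End normal.

(** * Borel measurability of normality *)

Section measurability.
Context {R : realType}.
Local Notation T := (measurableTypeR R).
Implicit Types (b : nat) (x : R).

Lemma measurable_frac_part : measurable_fun [set: T] (@frac_part R).
Proof.
apply: measurable_funB => //.
apply: nondecreasing_measurable => // x y xy.
by rewrite ler_int le_floor.
Qed.

Lemma measurable_digit b j d : measurable ([set x | digit b x j = d] : set T).
Proof.
have mg : measurable_fun [set: T] (fun x : R => b%:R ^+ j.+1 * frac_part x).
  by apply: measurable_funM => //; exact: measurable_frac_part.
rewrite (_ : [set x | _] = \bigcup_(n : int) ([set x | (`|n| %% b)%N = d] `&`
    (fun x : R => b%:R ^+ j.+1 * frac_part x) @^-1` `[n%:~R, (n + 1)%:~R[%classic)); last first.
  apply/seteqP; split => x /=.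
    move=> <-; exists (Num.floor (b%:R ^+ j.+1 * frac_part x)) => //; split => //=.
    by rewrite in_itv /=; exact: floor_itv.
  by move=> [n _ [<- /=]]; rewrite in_itv /= => h; rewrite /digit (floor_def h).
apply: countable_bigcupT_measurable; first exact: countableP.
move=> n; have [e|ne] := eqVneq (`|n| %% b)%N d.
  rewrite (_ : [set x | _] = setT) ?setTI; last by apply/seteqP; split.
  by rewrite -[X in measurable X]setTI; apply: mg => //; exact: measurable_itv.
rewrite (_ : [set x | _] = set0) ?set0I //.
by apply/seteqP; split => // x /= e; rewrite e eqxx in ne.
Qed.

Lemma measurable_block_count b k (w : k.-tuple 'I_b) N :
  measurable_fun [set: T] (fun x : R => (block_count x w N)%:R : R).
Proof.
pose M j : set T := \bigcap_(i in [set: 'I_k]) [set x | digit b x (j + i)%N = tnth w i].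
rewrite (_ : (fun x => _) = (fun x => \sum_(j < N) \1_(M j) x)); last first.
  apply/funext => x; rewrite /block_count natr_sum; apply: eq_bigr => j _.
  rewrite indicE; congr (nat_of_bool _)%:R; apply/idP/idP.
    by move=> /forallP h; rewrite inE => i _; apply/eqP.
  by rewrite inE => h; apply/forallP => i; apply/eqP/h.
apply: measurable_sum => j; apply: measurable_indic.
apply: fin_bigcap_measurable; first exact: finite_finset.
by move=> i _; exact: measurable_digit.
Qed.

Lemma measurable_normal b : measurable ([set x | normal_in_base b x] : set T).
Proof.
rewrite (_ : [set x | _] = \bigcap_k \bigcap_(w in [set: k.+1.-tuple 'I_b])
  \bigcap_m \bigcup_N0 \bigcap_(N in [set N | (N0 <= N)%N])
   [set x : R | `|(b%:R ^- k.+1 : R) - (block_count x w N)%:R / N%:R| <= m.+1%:R^-1]); last first.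
  apply/seteqP; split => x /=.
    move=> nx k _ w _ m _; have := nx k.+1 w isT => /cvgrPdist_le /(_ m.+1%:R^-1).
    by rewrite invr_gt0 ltr0n => /(_ isT) [N0 _ h]; exists N0.
  move=> h [//|k] w _; apply/cvgrPdist_le => e e0.
  have [N0 _ hN] := h k I w I (Num.truncn e^-1) I.
  exists N0 => // N /hN /= /le_trans; apply.
  by rewrite invf_ple ?posrE ?ltr0n //; apply/ltW; exact: truncnS_gt.
apply: bigcapT_measurable => k; apply: fin_bigcap_measurable; first exact: finite_finset.
move=> w _; apply: bigcapT_measurable => m; apply: bigcupT_measurable => N0.
apply: bigcap_measurableType => N _.
rewrite -[X in measurable X]setTI.
have mf : measurable_fun [set: T] (fun x : R => `|(b%:R ^- k.+1 : R) - (block_count x w N)%:R / N%:R|).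
  apply: measurableT_comp => //; apply: measurable_funB => //.
  by apply: measurable_funM => //; exact: measurable_block_count.
have := @measurable_fun_ler _ _ _ [set: T] _ (cst (m.+1%:R^-1 : R)) mf (measurable_cst _).
move=> /(_ measurableT [set true]); rewrite (_ : _ @^-1` _ = [set x : R | `|(b%:R ^- k.+1 : R) - (block_count x w N)%:R / N%:R| <= m.+1%:R^-1]) //.
by apply.
Qed.

Lemma measurable_odd_not_even : measurable (normal_odd_not_even R : set T).
Proof.
rewrite (_ : normal_odd_not_even R =
   (\bigcap_b [set x | (3 <= b)%N -> odd b -> normal_in_base b x]) `&`
   (\bigcap_b [set x | (2 <= b)%N -> ~~ odd b -> ~ normal_in_base b x])); last first.
  by apply/seteqP; split => x [h1 h2]; split => b; [move=> _|move=> _|exact: h1|exact: h2]; [exact: h1|exact: h2].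
apply: measurableI; apply: bigcapT_measurable => b.
  have [h|h] := boolP ((3 <= b)%N && odd b).
    rewrite (_ : [set x | _] = [set x | normal_in_base b x]); first exact: measurable_normal.
    by case/andP: h => h1 h2; apply/seteqP; split => x /=; [apply|].
  rewrite (_ : [set x | _] = setT) //; apply/seteqP; split => // x _ /= h1 h2.
  by rewrite h1 h2 in h.
have [h|h] := boolP ((2 <= b)%N && ~~ odd b).
  rewrite (_ : [set x | _] = ~` [set x | normal_in_base b x]); first by apply: measurableC; exact: measurable_normal.
  by case/andP: h => h1 h2; apply/seteqP; split => x /=; [apply|].
rewrite (_ : [set x | _] = setT) //; apply/seteqP; split => // x _ /= h1 h2.
by rewrite h1 h2 in h.
Qed.

End measurability.

Lemma normal_odd_not_even_mu (R : realType) (mu : probability (measurableTypeR R) R) :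
  mu `[0, 1[%classic = 1%E ->
  (forall th m n, (`|n| <= scaleR m)%N ->
    \int[mu]_x cos (2 * pi * (n%:~R * x) + th) = cos th * rcoef m n) ->
  mu (normal_odd_not_even R `&` `[0, 1[) = 1%E.
Proof.
move=> mu01 mu_mode.
set E := _ `&` _; have mE : measurable (E : set (measurableTypeR R)).
  by apply: measurableI => //; exact: measurable_odd_not_even.
have nE : mu.-negligible (~` E).
  apply: (@negligibleS _ _ _ mu ((~` `[0, 1[%classic) `|` ((\bigcup_I far_from I) `|` ~` weyl_odd_bases))).
    move=> x nx; apply: contrapT => /not_orP[/contrapT x01 /not_orP[xf /contrapT xo]].
    apply: nx; move: (x01); rewrite /= in_itv /= => x01'; split => //; split.
      by move=> b b3 ob; exact: weyl_odd_bases_normal.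
    apply: even_not_normal => // I; apply: contrapT => h; apply: xf; exists I => // i Ii.
    by rewrite leNgt; apply/negP => hi; apply: h; exists i.
  apply: negligibleU; last (apply: negligibleU; last exact: negligible_weyl_odd_basesC).
    apply/negligibleP; first exact: measurableC.
    by have := probability_setC mu (measurable_itv `[0, 1[); rewrite mu01 subee.
  apply/negligibleP; last exact: null_bigcup_far_from.
  by apply: bigcup_measurable => I _; apply: closed_measurable; exact: closed_far_from.
have h0 : mu (~` E) = 0%E by apply/negligibleP => //; exact: measurableC.
by have := probability_setC mu (measurableC mE); rewrite setCK h0 sube0.
Qed.

(** * Multiplicity *)

Section regularity.
Context {R : realType} (mu : probability (measurableTypeR R) R).
Local Notation T := (measurableTypeR R).

Definition regular (A : set R) := forall e : R, 0 < e -> exists C U : set R,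
  [/\ closed C, open U, C `<=` A, A `<=` U & (mu (U `\` C) < e%:E)%E].

Let mopen (U : set R) : open U -> measurable (U : set T).
Proof. exact: open_measurable. Qed.

Let mclosed (U : set R) : closed U -> measurable (U : set T).
Proof. exact: closed_measurable. Qed.

Lemma mu_decr_lt (F : nat -> set R) (e : R) : 0 < e ->
  (forall n, measurable (F n : set T)) -> (forall n m, (n <= m)%N -> F m `<=` F n) ->
  \bigcap_n F n = set0 -> exists n, (mu (F n) < e%:E)%E.
Proof.
move=> e0 mF dF F0.
have : mu (F n) @[n --> \oo] --> mu (\bigcap_n F n).
  apply: nonincreasing_cvg_mu => //.
  - by apply: le_lt_trans (probability_le1 mu (mF 0%N)) _; rewrite ltry.
  - exact: bigcapT_measurable.
  - by move=> n m nm; apply/subsetPset; exact: dF.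
rewrite F0 measure0 => /fine_cvgP[fF /cvgrPdist_lt /(_ _ e0) h].
have [n _ /(_ n (leqnn n)) [h1 h2]] : \forall n \near \oo, mu (F n) \is a fin_num /\ `|0 - fine (mu (F n))| < e.
  by near=> n; split; near: n.
exists n; move: h2; rewrite sub0r normrN ger0_norm ?fine_ge0 // => h2.
by rewrite -[X in (X < _)%E]fineK // lte_fin.
Unshelve. all: end_near. Qed.

Lemma regular_ray (a : R) : regular `]a, +oo[%classic.
Proof.
move=> e e0.
have [n hn] : exists n, (mu (`]a, (a + n.+1%:R^-1)%R[%classic : set R) < e%:E)%E.
  apply: (@mu_decr_lt (fun n => `]a, (a + n.+1%:R^-1)%R[%classic)) => //.
    move=> n m nm x /=; rewrite !in_itv /= => /andP[-> h] /=; apply: (lt_le_trans h).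
    by rewrite lerD2l lef_pV2 ?posrE ?ltr0n // ler_nat ltnS.
  apply/seteqP; split => // x h.
  have ax : 0 < x - a by have := h 0%N I; rewrite /= in_itv /= subr_gt0 => /andP[].
  have := h (Num.truncn (x - a)^-1) I; rewrite /= in_itv /= => /andP[_].
  rewrite addrC -ltrBlDr => hx; have := truncnS_gt (x - a)^-1.
  rewrite invf_plt ?posrE ?ltr0n // => h2; have := lt_trans hx h2; by rewrite ltxx.
exists `[a + n.+1%:R^-1, +oo[%classic, `]a, +oo[%classic; split => //.
- exact: interval_closed.
- move=> x /=; rewrite !in_itv /= !andbT; apply: lt_le_trans.
  by rewrite ltrDl invr_gt0 ltr0n.
rewrite (_ : _ `\` _ = `]a, (a + n.+1%:R^-1)%R[%classic) //.
apply/seteqP; split => x /=; rewrite !in_itv /= !andbT.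
  by move=> [-> /negP]; rewrite -ltNge.
by move=> /andP[-> h]; split => //; apply/negP; rewrite -ltNge.
Qed.

Lemma regular0 : regular set0.
Proof.
move=> e e0; exists set0, set0; split => //; first exact: closed0.
by rewrite setD0 measure0 lte_fin.
Qed.

Lemma regularC A : regular A -> regular (~` A).
Proof.
move=> rA e e0; have [C [U [cC oU CA AU h]]] := rA e e0.
exists (~` U), (~` C); split.
- exact: open_closedC.
- exact: closed_openC.
- exact: subsetC.
- exact: subsetC.
by rewrite setDE setCK setIC -setDE.
Qed.

Lemma regular_bigcup (A : nat -> set R) : (forall n, regular (A n)) -> regular (\bigcup_n A n).
Proof.
move=> rA e e0; have e2 : 0 < e / 2 by rewrite divr_gt0.
have hr n : exists CU : set R * set R, [/\ closed CU.1, open CU.2, CU.1 `<=` A n, A n `<=` CU.2 &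
    (mu (CU.2 `\` CU.1) < (e / 2 / (2 ^ n.+1)%:R)%:E)%E].
  have en : 0 < e / 2 / (2 ^ n.+1)%:R by rewrite divr_gt0 // ltr0n expn_gt0.
  by have [C [U h]] := rA n _ en; exists (C, U).
pose CU n := sval (cid (hr n)).
have hCU n : [/\ closed (CU n).1, open (CU n).2, (CU n).1 `<=` A n, A n `<=` (CU n).2 &
    (mu ((CU n).2 `\` (CU n).1) < (e / 2 / (2 ^ n.+1)%:R)%:E)%E] by exact: (svalP (cid (hr n))).
pose C := \bigcup_n (CU n).1; pose CN N := \big[setU/set0]_(i < N) (CU i).1.
pose U := \bigcup_n (CU n).2.
have CNE N x : CN N x <-> exists2 i, (i < N)%N & (CU i).1 x.
  rewrite /CN -(bigcup_mkord N (fun i => (CU i).1)).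
  by split=> [[i /= iN Cx]|[i iN Cx]]; exists i.
have mC n : measurable ((CU n).1 : set T) by apply: mclosed; have [] := hCU n.
have mU n : measurable ((CU n).2 : set T) by apply: mopen; have [] := hCU n.
have mCT : measurable (C : set T) by exact: bigcupT_measurable.
have mCN N : measurable (CN N : set T) by exact: bigsetU_measurable.
have mUT : measurable (U : set T) by exact: bigcupT_measurable.
(* The union [C] of the closed parts need not be closed; a finite subunion is, and it loses less
   than e / 2. *)
have [N hN] : exists N, (mu (C `\` CN N) < (e / 2)%:E)%E.
  apply: (@mu_decr_lt (fun N => C `\` CN N)) => //.
  - by move=> n; exact: measurableD.
  - move=> n m nm; move=> x [Cx nC]; split => // nx; apply: nC.
    by move: nx => /CNE[i im ix]; apply/CNE; exists i => //; exact: leq_trans im nm.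
  - apply/seteqP; split => // x h; have [[n _ Cx] _] := h 0%N I.
    by have [_] := h n.+1 I; apply; apply/CNE; exists n.
have cCN : closed (CN N).
  rewrite /CN; elim/big_ind: _ => //; [exact: closed0|exact: closedU|].
  by move=> i _; have [] := hCU i.
exists (CN N), U; split => //.
- by apply: bigcup_open => n _; have [] := hCU n.
- move=> x /CNE[n _ Cx]; exists n => //.
  by have [_ _ h _ _] := hCU n; exact: h.
- by move=> x [n _ Ax]; exists n => //; have [_ _ _ h _] := hCU n; exact: h.
apply: (@le_lt_trans _ _ (mu (U `\` C) + mu (C `\` CN N))%E).
  apply: le_trans (measureU2 mu _ _); [|exact: measurableD|exact: measurableD].
  apply: le_measure; rewrite ?inE; [exact: measurableD|by apply: measurableU; exact: measurableD|].
  by move=> x [Ux nx]; have [Cx|nCx] := pselect (C x); [right|left].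
rewrite [e in e%:E]splitr EFinD; apply: lee_ltD => //.
  by rewrite ge0_fin_numE ?measure_ge0 // (le_lt_trans (probability_le1 mu (measurableD mUT mCT))) // ltry.
apply: (@le_trans _ _ (mu (\bigcup_n ((CU n).2 `\` (CU n).1)))).
  apply: le_measure; rewrite ?inE; [exact: measurableD|by apply: bigcupT_measurable => n; exact: measurableD|].
  by move=> x [[n _ Ux] nC]; exists n => //; split => // Cx; apply: nC; exists n.
apply: (@le_trans _ _ (\sum_(n <oo) mu ((CU n).2 `\` (CU n).1))%E).
  apply: measure_sigma_subadditive => //.
  - by move=> n; exact: measurableD.
  - by apply: bigcupT_measurable => n; exact: measurableD.
apply: le_trans (epsilon_trick0 xpredT (ltW e2)).
by apply: lee_nneseries => // n _; have [_ _ _ _ /ltW] := hCU n.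
Qed.

(** Sets approximable from both sides form a sigma-algebra, complements exchanging the two sides,
    and it contains the open rays. *)
Lemma measurable_regular (A : set R) : measurable (A : set T) -> regular A.
Proof.
have := RGenOInfty.measurableE R; rewrite /measurable /= => ->.
apply: smallest_sub.
  split; [exact: regular0|by move=> B rB; rewrite setTD; exact: regularC|exact: regular_bigcup].
by move=> _ [a ->]; exact: regular_ray.
Qed.

Lemma inner_regular (A : set R) : measurable (A : set T) -> (0 < mu A)%E ->
  exists C, [/\ closed C, C `<=` A & (0 < mu C)%E].
Proof.
move=> mA A0; have fA : mu A \is a fin_num by exact: fin_num_measure.
have A0' : 0 < fine (mu A) by rewrite fine_gt0 // A0 -ge0_fin_numE ?measure_ge0.
have [C [U [cC oU CA AU h]]] := measurable_regular mA A0'.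
exists C; split => //; rewrite lt_neqAle measure_ge0 andbT eq_sym; apply/negP => /eqP C0.
move: h; rewrite fineK // => h.
have := lt_le_trans h (_ : (mu A <= mu (U `\` C))%E); rewrite ltxx => F.
suff : false by []. apply: F.
have mC := mclosed cC; have mUC : measurable (U `\` C : set T) by apply: measurableD => //; exact: mopen.
rewrite -[leRHS]adde0 -C0; apply: le_trans (measureU2 mu _ _) => //.
apply: le_measure; rewrite ?inE //; first exact: measurableU.
by move=> x Ax; have [Cx|nC] := pselect (C x); [right|left; split => //; exact: AU].
Qed.

End regularity.

(** * A Riemann-Lebesgue lemma for the measure *)

Section riemann_lebesgue.
Context {R : realType} (mu : probability (measurableTypeR R) R).
Local Notation T := (measurableTypeR R).
Implicit Types (f g : R -> R) (e C x y th : R).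

Definition bounded_mfun f :=
  measurable_fun [set: T] (f : T -> R) /\ exists C, forall x, `|f x| <= C.

Definition osc n th y : R := cos (2 * pi * (n%:~R * y) + th).

(** The bound is uniform in the phase because the phase will depend on [n] when partial sums are
    evaluated at a point. *)
Definition osc_null f := forall e, 0 < e -> exists M : nat, forall (n : nat) th,
  (M <= n)%N -> `|\int[mu]_y (f y * osc n th y)| <= e.

Lemma bounded_mfun_continuous f C : continuous f -> (forall x, `|f x| <= C) -> bounded_mfun f.
Proof. by move=> fc fC; split; [exact: continuous_measurable_fun|exists C]. Qed.

Lemma bounded_mfun_osc n th : bounded_mfun (osc n th).
Proof.
by apply: (bounded_mfun_continuous (C := 1)); [exact: mode_continuous|move=> x; exact: cos_max].
Qed.

Lemma bounded_mfun_cst C : bounded_mfun (fun=> C).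
Proof. by apply: (bounded_mfun_continuous (C := `|C|)) => // x; exact: cst_continuous. Qed.

Lemma bounded_mfunD f g : bounded_mfun f -> bounded_mfun g -> bounded_mfun (fun x => f x + g x).
Proof.
move=> [mf [C fC]] [mg [D gD]]; split; first exact: measurable_funD.
by exists (C + D) => x; apply: (le_trans (ler_normD _ _)); exact: lerD.
Qed.

Lemma bounded_mfunM f g : bounded_mfun f -> bounded_mfun g -> bounded_mfun (fun x => f x * g x).
Proof.
move=> [mf [C fC]] [mg [D gD]]; split; first exact: measurable_funM.
by exists (C * D) => x; rewrite normrM ler_pM.
Qed.

Lemma bounded_mfunB f g : bounded_mfun f -> bounded_mfun g -> bounded_mfun (fun x => f x - g x).
Proof.
move=> [mf [C fC]] [mg [D gD]]; split; first exact: measurable_funB.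
by exists (C + D) => x; apply: (le_trans (ler_normB _ _)); exact: lerD.
Qed.

Lemma bounded_mfun_norm f : bounded_mfun f -> bounded_mfun (fun x => `|f x|).
Proof.
move=> [mf [C fC]]; split; last by exists C => x; rewrite normr_id.
exact: measurableT_comp.
Qed.

Lemma bounded_mfun_indic (A : set R) : measurable (A : set T) -> bounded_mfun (\1_A : R -> R).
Proof.
move=> mA; split; first exact: measurable_indic.
by exists 1 => x; rewrite indicE; case: (_ \in _); rewrite ?normr1 ?normr0.
Qed.

Lemma bounded_mfun_integrable f : bounded_mfun f -> mu.-integrable setT (EFin \o f).
Proof.
move=> [mf [C fC]]; apply: measurable_bounded_integrable => //.
- by apply: le_lt_trans (probability_le1 mu _) _ => //; rewrite ltry.
- by exists C; split; [exact: num_real|move=> y Cy x _; exact: le_trans (fC x) (ltW Cy)].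
Qed.

Lemma Rintegral_le f g : bounded_mfun f -> bounded_mfun g -> (forall x, f x <= g x) ->
  \int[mu]_x f x <= \int[mu]_x g x.
Proof.
by move=> bf bg fg; apply: le_Rintegral => //; apply: bounded_mfun_integrable.
Qed.

Lemma norm_Rintegral_le f : bounded_mfun f -> `|\int[mu]_x f x| <= \int[mu]_x `|f x|.
Proof. by move=> bf; apply: le_normr_Rintegral => //; exact: bounded_mfun_integrable. Qed.

Lemma Rintegral_add f g : bounded_mfun f -> bounded_mfun g ->
  \int[mu]_x (f x + g x) = \int[mu]_x f x + \int[mu]_x g x.
Proof. by move=> bf bg; apply: RintegralD => //; exact: bounded_mfun_integrable. Qed.

Lemma Rintegral_sub f g : bounded_mfun f -> bounded_mfun g ->
  \int[mu]_x (f x - g x) = \int[mu]_x f x - \int[mu]_x g x.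
Proof. by move=> bf bg; apply: RintegralB => //; exact: bounded_mfun_integrable. Qed.

Lemma Rintegral_scale C f : bounded_mfun f -> \int[mu]_x (C * f x) = C * \int[mu]_x f x.
Proof. by move=> bf; apply: RintegralZl => //; exact: bounded_mfun_integrable. Qed.

Lemma Rintegral_const C : \int[mu]_x C = C.
Proof. by rewrite Rintegral_cst // [X in fine X]probability_setT mulr1. Qed.

(** As |[osc]| <= 1, replacing [f] by [g] changes every integral by at most their distance in
    L^1(mu). *)
Lemma osc_null_approx f : bounded_mfun f ->
  (forall e, 0 < e -> exists g, [/\ bounded_mfun g, osc_null g & \int[mu]_x `|f x - g x| <= e]) ->
  osc_null f.
Proof.
move=> bf h e e0; have e2 : 0 < e / 2 by rewrite divr_gt0.
have [g [bg /(_ _ e2)[M hM] fg]] := h _ e2.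
exists M => n th /(hM n th) hn.
have bo := bounded_mfun_osc n th.
rewrite (_ : \int[mu]_y _ = \int[mu]_y ((f y - g y) * osc n th y + g y * osc n th y)); last first.
  by apply: eq_Rintegral => y _; rewrite mulrBl subrK.
rewrite Rintegral_add; [|by apply: bounded_mfunM => //; exact: bounded_mfunB|exact: bounded_mfunM].
rewrite [e]splitr; apply: (le_trans (ler_normD _ _)); apply: lerD => //; apply: le_trans fg.
have bd := bounded_mfunB bf bg.
apply: (le_trans (norm_Rintegral_le _)); first exact: bounded_mfunM.
apply: Rintegral_le => [||x].
- by apply: bounded_mfun_norm; exact: bounded_mfunM.
- exact: bounded_mfun_norm.
- by rewrite normrM ler_piMr // cos_max.
Qed.

Lemma osc_nullD f g : bounded_mfun f -> bounded_mfun g -> osc_null f -> osc_null g ->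
  osc_null (fun x => f x + g x).
Proof.
move=> bf bg nf ng e e0; have e2 : 0 < e / 2 by rewrite divr_gt0.
have [M hM] := nf _ e2; have [N hN] := ng _ e2.
exists (maxn M N) => n th; rewrite geq_max => /andP[/(hM n th) h1 /(hN n th) h2].
have bo := bounded_mfun_osc n th.
rewrite (_ : \int[mu]_y _ = \int[mu]_y (f y * osc n th y + g y * osc n th y)); last first.
  by apply: eq_Rintegral => y _; rewrite mulrDl.
rewrite Rintegral_add; [|exact: bounded_mfunM|exact: bounded_mfunM].
by rewrite [e]splitr; apply: (le_trans (ler_normD _ _)); exact: lerD.
Qed.

Lemma osc_nullZ c f : bounded_mfun f -> osc_null f -> osc_null (fun x => c * f x).
Proof.
move=> bf nf e e0; have c0 : 0 < `|c| + 1 by rewrite ltr_wpDl.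
have [M hM] := nf _ (divr_gt0 e0 c0); exists M => n th /(hM n th) h.
rewrite (_ : \int[mu]_y _ = \int[mu]_y (c * (f y * osc n th y))); last first.
  by apply: eq_Rintegral => y _; rewrite mulrA.
rewrite Rintegral_scale; last by apply: bounded_mfunM => //; exact: bounded_mfun_osc.
rewrite normrM; apply: (le_trans (ler_wpM2l (normr_ge0 c) h)).
by rewrite mulrCA ler_piMr ?(ltW e0) // ler_pdivrMr // mul1r lerDl.
Qed.

Lemma osc_null0 : osc_null (fun=> 0).
Proof.
move=> e e0; exists 0%N => n th _; rewrite (_ : \int[mu]_y _ = 0) ?normr0 ?ltW //.
by rewrite -[RHS](Rintegral_const 0); apply: eq_Rintegral => y _; rewrite mul0r.
Qed.

Lemma osc_null_sum (q : nat) (f : nat -> R -> R) : (forall s, bounded_mfun (f s)) ->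
  (forall s, osc_null (f s)) ->
  bounded_mfun (fun x => \sum_(s < q) f s x) /\ osc_null (fun x => \sum_(s < q) f s x).
Proof.
move=> bf nf; elim: q => [|q [IHb IHn]].
  rewrite (_ : (fun x => \sum_(s < 0) f s x) = fun=> 0); last first.
    by apply/funext => x; rewrite big_ord0.
  by split; [exact: bounded_mfun_cst|exact: osc_null0].
rewrite (_ : (fun x => \sum_(s < q.+1) f s x) = fun x => \sum_(s < q) f s x + f q x); last first.
  by apply/funext => x; rewrite big_ord_recr.
by split; [exact: bounded_mfunD|exact: osc_nullD].
Qed.

Hypothesis mu_osc : forall e, 0 < e -> exists M : nat, forall (n : int) th,
  (M <= `|n|)%N -> `|\int[mu]_y osc n th y| <= e.

(** Product-to-sum leaves the frequencies n + k and n - k, which still tend to infinity. *)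
Lemma osc_null_osc (k : int) ph : osc_null (osc k ph).
Proof.
move=> e e0; have [M hM] := mu_osc e0; exists (M + `|k|)%N => n th hn.
rewrite (_ : \int[mu]_y _ = \int[mu]_y (1 / 2 * (osc (n%:Z + k) (th + ph) y + osc (n%:Z - k) (th - ph) y))); last first.
  apply: eq_Rintegral => y _; rewrite /osc.
  have -> : 2 * pi * ((n%:Z + k)%:~R * y) + (th + ph) =
    (2 * pi * (n%:Z%:~R * y) + th) + (2 * pi * (k%:~R * y) + ph) :> R.
    by rewrite intrD; move: (pi : R) (k%:~R : R) (n%:~R : R) => p a b; ring.
  have -> : 2 * pi * ((n%:Z - k)%:~R * y) + (th - ph) =
    (2 * pi * (n%:Z%:~R * y) + th) - (2 * pi * (k%:~R * y) + ph) :> R.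
    by rewrite intrB; move: (pi : R) (k%:~R : R) (n%:~R : R) => p a b; ring.
  set p := _ + th; set q := _ + ph; rewrite [cos (p + q)]cosD cosB; move: (cos _) (cos _) (sin _) (sin _) => a b c d; lra.
rewrite Rintegral_scale; last by apply: bounded_mfunD; exact: bounded_mfun_osc.
rewrite Rintegral_add; [|exact: bounded_mfun_osc|exact: bounded_mfun_osc].
have h1 := hM (n%:Z + k) (th + ph) ltac:(lia); have h2 := hM (n%:Z - k) (th - ph) ltac:(lia).
have := ler_normD (\int[mu]_y osc (n%:Z + k) (th + ph) y) (\int[mu]_y osc (n%:Z - k) (th - ph) y).
rewrite normrM [`|1 / 2|]ger0_norm ?divr_ge0 // => h3; lra.
Qed.

Lemma osc_null_ev u c : bounded_mfun (fun y => ev 0 u (y - c)) /\ osc_null (fun y => ev 0 u (y - c)).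
Proof.
elim: u => [|t u [IHb IHn]].
  rewrite (_ : (fun y => ev 0 [::] (y - c)) = fun=> 0); last first.
    by apply/funext => x; rewrite /ev big_nil.
  by split; [exact: bounded_mfun_cst|exact: osc_null0].
rewrite (_ : (fun y => ev 0 (t :: u) (y - c)) =
  fun y => t.2 * osc t.1 (- (2 * pi * (t.1%:~R * c))) y + ev 0 u (y - c)); last first.
  apply/funext => x; rewrite ev_cons addr0 /osc; congr (_ * cos _ + _).
  move: (pi : R) (t.1%:~R : R) => p a; ring.
have bo := bounded_mfun_osc t.1 (- (2 * pi * (t.1%:~R * c))).
have bc := bounded_mfunM (bounded_mfun_cst t.2) bo.
split; first exact: bounded_mfunD.
apply: osc_nullD => //; apply: osc_nullZ => //; exact: osc_null_osc.
Qed.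

End riemann_lebesgue.

(** * The chordal metric and Fejer approximation *)

Section chord.
Context {R : realType}.
Implicit Types (f g : R -> R) (C x y : R).

(** Half the distance of e(x) and e(y) on the unit circle: Lipschitz functions for it are
    1-periodic, as approximation by trigonometric polynomials requires. *)
Definition chord x y := `|sin (pi * (x - y))|.

Lemma chord_ge0 x y : 0 <= chord x y. Proof. exact: normr_ge0. Qed.

Lemma chord_le1 x y : chord x y <= 1. Proof. exact: sin_max. Qed.

Lemma chordC x y : chord x y = chord y x.
Proof. by rewrite /chord -opprB mulrN sinN normrN. Qed.

Lemma chord_xx x : chord x x = 0.
Proof. by rewrite /chord subrr mulr0 sin0 normr0. Qed.

Lemma chord_triangle x y z : chord x z <= chord x y + chord y z.
Proof.
rewrite /chord; have -> : pi * (x - z) = pi * (x - y) + pi * (y - z) by ring.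
rewrite sinD; apply: (le_trans (ler_normD _ _)).
by apply: lerD; rewrite normrM ?ler_piMr ?ler_piMl // cos_max.
Qed.

Lemma chord_sqr x y : 2 * chord x y ^+ 2 = 1 - cos (2 * pi * (x - y)).
Proof.
rewrite /chord -normrX ger0_norm ?sqr_ge0 //.
have -> : 2 * pi * (x - y) = pi * (x - y) + pi * (x - y) by ring.
rewrite cosD; have := cos2Dsin2 (pi * (x - y)); move: (cos _) (sin _) => c s; lra.
Qed.

Lemma chord_le x y : chord x y <= pi * `|x - y|.
Proof.
have := cos_lip (pi * (x - y) - pi / 2) (- (pi / 2)).
by rewrite cosBpihalf cosN cos_pihalf subr0 opprK subrK normrM [`|pi|]ger0_norm ?pi_ge0.
Qed.

Definition chord_lip C f := forall x y, `|f x - f y| <= C * chord x y.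

Lemma chord_lip_continuous C f : 0 <= C -> chord_lip C f -> continuous f.
Proof.
move=> C0 h; apply: (@lip_continuous _ f (C * pi)) => x y.
by apply: (le_trans (h x y)); rewrite -mulrA ler_wpM2l // chord_le.
Qed.

Lemma chord_lip_bounded C f x : 0 <= C -> chord_lip C f -> `|f x| <= `|f 0| + C.
Proof.
move=> C0 h; rewrite -[f x](subrK (f 0)) addrC; apply: (le_trans (ler_normD _ _)).
by rewrite lerD2l; apply: (le_trans (h _ _)); rewrite ler_piMr // chord_le1.
Qed.

Lemma bounded_mfun_chord_lip C f : 0 <= C -> chord_lip C f -> bounded_mfun f.
Proof.
move=> C0 h; apply: (bounded_mfun_continuous (C := `|f 0| + C)).
  exact: chord_lip_continuous C0 h.
by move=> x; exact: chord_lip_bounded.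
Qed.

Lemma chord_lipM A B C D f g : 0 <= C -> 0 <= D -> (forall x, `|f x| <= A) -> (forall x, `|g x| <= B) ->
  chord_lip C f -> chord_lip D g -> chord_lip (C * B + A * D) (fun x => f x * g x).
Proof.
move=> C0 D0 fA gB hf hg x y.
have -> : f x * g x - f y * g y = (f x - f y) * g x + f y * (g x - g y) by ring.
apply: (le_trans (ler_normD _ _)); rewrite !normrM mulrDl mulrAC -mulrA; apply: lerD.
  by rewrite mulrA ler_pM.
by rewrite -mulrA ler_pM.
Qed.

(** A discrete Fejer mean: sampling replaces convolution, and the weights sum to Q by
    [fejer_partition]. With c the chord and F the kernel, c <= 1/m + m c^2 and F c^2 <= 1/Q, so c F
    <= F/m + 1/m when Q = m^2. *)
Lemma fejer_chord C f Q m y : 0 <= C -> chord_lip C f -> (0 < m)%N -> Q = (m ^ 2)%N ->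
  `|f y - Q%:R^-1 * \sum_(s < Q) f (s%:R / Q%:R) * (1 + ev 0 (fejer 1 Q) (y - s%:R / Q%:R))| <=
  C * (2 / m%:R).
Proof.
move=> C0 h m0 QE; have Q0 : (0 < Q)%N by rewrite QE expn_gt0 m0.
have Q0' : 0 < Q%:R :> R by rewrite ltr0n.
have m0' : 0 < m%:R :> R by rewrite ltr0n.
have QE' : Q%:R = m%:R ^+ 2 :> R by rewrite QE natrX.
pose F s : R := 1 + ev 0 (fejer 1 Q) (y - s%:R / Q%:R).
have F0 s : 0 <= F s by exact: fejer_ge0.
have FQ : \sum_(s < Q) F s = Q%:R by exact: fejer_partition.
have -> : f y - Q%:R^-1 * \sum_(s < Q) f (s%:R / Q%:R) * F s =
    Q%:R^-1 * \sum_(s < Q) (f y - f (s%:R / Q%:R)) * F s.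
  under [in RHS]eq_bigr do rewrite mulrBl.
  by rewrite sumrB -mulr_sumr FQ mulrBr mulrCA mulVf ?gt_eqF // mulr1.
have Fs s : chord y (s%:R / Q%:R) * F s <= m%:R^-1 * F s + m%:R^-1.
  have := chord_sqr y (s%:R / Q%:R); set c := chord _ _ => hc.
  have hF : F s * (2 * c ^+ 2) <= 2 / Q%:R.
    have := fejer_cos 1 (y - s%:R / Q%:R) Q0; rewrite !mul1r -/(F s) -hc mul1n => ->.
    by rewrite ler_pM2r ?invr_gt0 //; have := cos_geN1 (2 * pi * (Q%:R * (y - s%:R / Q%:R))); lra.
  have c1 : c <= m%:R^-1 + m%:R * c ^+ 2.
    rewrite -(ler_pM2l m0') mulrDr divff ?gt_eqF // mulrA -expr2 -exprMn.
    by have := sqr_ge0 (m%:R * c - 1); have := sqr_ge0 (m%:R * c); move: (m%:R * c) => t; nra.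
  apply: (le_trans (ler_wpM2r (F0 s) c1)); rewrite mulrDl lerD2l.
  have -> : m%:R * c ^+ 2 * F s = m%:R / 2 * (F s * (2 * c ^+ 2)) by field.
  apply: (le_trans (ler_wpM2l _ hF)); first by rewrite divr_ge0.
  by rewrite QE' le_eqVlt; apply/orP; left; apply/eqP; field; rewrite gt_eqF.
rewrite normrM ger0_norm ?invr_ge0 // mulrC ler_pdivrMr //.
apply: (le_trans (ler_norm_sum _ _ _)).
apply: (@le_trans _ _ (\sum_(s < Q) C * (m%:R^-1 * F s + m%:R^-1))).
  apply: ler_sum => s _; rewrite normrM (ger0_norm (F0 s)).
  by apply: (le_trans (ler_wpM2r (F0 s) (h _ _))); rewrite -mulrA ler_wpM2l.
rewrite -mulr_sumr big_split /= -mulr_sumr FQ sumr_const card_ord -[m%:R^-1 *+ Q]mulr_natr.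
by rewrite -mulrA ler_wpM2l // -mulrDl [2 * _]mulr_natl mulr2n.
Qed.

End chord.

Section riemann_lebesgue_chord.
Context {R : realType} (mu : probability (measurableTypeR R) R).
Local Notation T := (measurableTypeR R).
Implicit Types (f g : R -> R) (e C x y th : R).
Hypothesis mu_osc : forall e, 0 < e -> exists M : nat, forall (n : int) th,
  (M <= `|n|)%N -> `|\int[mu]_y osc n th y| <= e.

Lemma osc_null_chord_lip C f : 0 <= C -> chord_lip C f -> osc_null mu f.
Proof.
move=> C0 h; apply: osc_null_approx; first exact: bounded_mfun_chord_lip C0 h.
move=> e e0; pose m := (Num.truncn (C * 2 / e)).+1; pose Q := (m ^ 2)%N.
have m0 : 0 < m%:R :> R by rewrite ltr0n.
have hm : C * (2 / m%:R) <= e.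
  rewrite mulrA ler_pdivrMr // [e * _]mulrC -ler_pdivrMr //; apply/ltW; exact: truncnS_gt.
pose F s y := 1 + ev 0 (fejer 1 Q) (y - s%:R / Q%:R).
have nF (s : nat) : bounded_mfun (fun y => f (s%:R / Q%:R) * F s y) /\
    osc_null mu (fun y => f (s%:R / Q%:R) * F s y).
  have := osc_null_ev mu_osc (cone ++ fejer 1 Q) (s%:R / Q%:R).
  rewrite (_ : (fun y => _) = F s); last first.
    by apply/funext => y; rewrite ev_cat ev_cone cos0.
  move=> [b n]; split; last exact: osc_nullZ.
  by apply: bounded_mfunM => //; exact: bounded_mfun_cst.
have [b n] := @osc_null_sum _ mu Q _ (fun s => (nF s).1) (fun s => (nF s).2).
have b' := bounded_mfunM (bounded_mfun_cst Q%:R^-1) b.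
exists (fun y => Q%:R^-1 * \sum_(s < Q) f (s%:R / Q%:R) * F s y); split => //.
  exact: osc_nullZ.
rewrite -[e](Rintegral_const mu); apply: Rintegral_le => [||x].
- by apply: bounded_mfun_norm; apply: bounded_mfunB => //; exact: bounded_mfun_chord_lip C0 h.
- exact: bounded_mfun_cst.
- by apply: (le_trans _ hm); exact: fejer_chord C0 h _ _.
Qed.

End riemann_lebesgue_chord.

Section chord_distance.
Context {R : realType} (K : set R).
Implicit Types (x y z d : R).

Definition chord_dist x := inf [set chord x z | z in K].
Definition tent (j : nat) x := Num.max 0 (1 - j.+1%:R * chord_dist x).

Hypothesis K0 : K !=set0.

Lemma chord_dist_le x z : K z -> chord_dist x <= chord x z.
Proof.
move=> Kz; apply: ge_inf; last by exists z.
by exists 0 => _ [w _ <-]; exact: chord_ge0.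
Qed.

Lemma chord_dist_ge x d : (forall z, K z -> d <= chord x z) -> d <= chord_dist x.
Proof.
move=> h; apply: lb_le_inf; first by have [z Kz] := K0; exists (chord x z); exists z.
by move=> _ [z Kz <-]; exact: h.
Qed.

Lemma chord_dist_ge0 x : 0 <= chord_dist x.
Proof. by apply: chord_dist_ge => z _; exact: chord_ge0. Qed.

Lemma chord_dist_eq0 x : K x -> chord_dist x = 0.
Proof.
by move=> Kx; apply/eqP; rewrite eq_le chord_dist_ge0 andbT -(chord_xx x) chord_dist_le.
Qed.

Lemma chord_dist_lip : chord_lip 1 chord_dist.
Proof.
have H x y : chord_dist x <= chord_dist y + chord x y.
  rewrite -lerBlDr; apply: chord_dist_ge => z Kz; rewrite lerBlDr addrC.
  exact: le_trans (chord_dist_le x Kz) (chord_triangle _ _ _).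
move=> x y; rewrite mul1r ler_norml lerBlDl addrC H andbT.
by have := H y x; rewrite (chordC y x); lra.
Qed.

Lemma tent_lip j : chord_lip j.+1%:R (tent j).
Proof.
move=> x y; have := chord_dist_lip x y; rewrite mul1r /tent => h.
have j0 : 0 <= j.+1%:R :> R by [].
apply: (@le_trans _ _ `|j.+1%:R * (chord_dist x - chord_dist y)|); last first.
  by rewrite normrM ger0_norm // ler_wpM2l.
rewrite mulrBr; move: (j.+1%:R * _) (j.+1%:R * _) => a b.
rewrite [leRHS]distrC; have := ler_norm (b - a); have := ler_norm (a - b); rewrite distrC => h1 h2.
have h3 := normr_ge0 (b - a).
rewrite /Num.max ler_norml; case: ltP => ha; case: ltP => hb; apply/andP; split; lra.
Qed.

Lemma tent_itv j x : 0 <= tent j x <= 1.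
Proof.
rewrite /tent le_max lexx /= ge_max ler01 /= lerBlDr lerDl.
by rewrite mulr_ge0 ?chord_dist_ge0.
Qed.

Lemma tent_eq1 j x : K x -> tent j x = 1.
Proof. by move=> Kx; rewrite /tent chord_dist_eq0 // mulr0 subr0; apply/max_idPr. Qed.

Lemma tent_eq0 j x : j.+1%:R^-1 <= chord_dist x -> tent j x = 0.
Proof.
move=> h; apply/max_idPl; rewrite subr_le0 mulrC -ler_pdivrMr ?ltr0n //.
by rewrite div1r.
Qed.

Hypotheses (Kc : closed K) (K01 : K `<=` `[0, 1[).

(** The chord distance wraps around, so points of [K] near 1 could approach x = 0. They do not: [K]
    is closed and avoids 1, hence stays at a distance [d1] from it. *)
Lemma chord_dist_gt0 x : 0 <= x < 1 -> ~ K x -> 0 < chord_dist x.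
Proof.
move=> /andP[x0 x1] nKx.
have sep y : ~ K y -> exists2 d, 0 < d & forall z, K z -> d <= `|y - z|.
  move=> nKy; have : nbhs y (~` K) by apply: open_nbhs_nbhs; split => //; exact: closed_openC.
  move=> /nbhs_ballP[d /= d0 hd]; exists d => // z Kz; rewrite leNgt; apply/negP => h.
  by have := hd z h.
have [d0 d00 h0] := sep x nKx.
have [d1 d10 h1] : exists2 d, 0 < d & forall z, K z -> d <= `|1 - z|.
  by apply: sep => /K01 /=; rewrite in_itv /= ltxx andbF.
pose d := Num.min d0 (Num.min d1 (1 - x)).
have dp : 0 < d by rewrite !lt_min d00 d10 subr_gt0.
have [dd0 dd1 ddx] : [/\ d <= d0, d <= d1 & d <= 1 - x].
  by split; rewrite /d !ge_min lexx ?orbT.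
apply: (lt_le_trans dp); apply: chord_dist_ge => z Kz.
have /andP[z0 z1] : 0 <= z < 1 by have := K01 Kz; rewrite /= in_itv.
have w1 : d <= `|x - z| by exact: le_trans dd0 (h0 z Kz).
have w2 : `|x - z| <= 1 - d.
  have := h1 z Kz; rewrite ger0_norm ?subr_ge0 ?(ltW z1) // => hz.
  have [xz|/ltW xz] := leP z x; first by rewrite ger0_norm ?subr_ge0 //; lra.
  by rewrite distrC ger0_norm ?subr_ge0 //; lra.
have := one_sub_cos_ge (ltW dp) w1 w2.
have -> : cos (2 * pi * `|x - z|) = cos (2 * pi * (x - z)).
  by have [_|_] := ger0P (x - z); [|rewrite mulrN cosN].
rewrite -chord_sqr ler_pM2l // ler_sqr ?nnegrE ?chord_ge0 //; exact: ltW.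
Qed.

End chord_distance.

Section closed_set_transform.
Context {R : realType} (mu : probability (measurableTypeR R) R) (K : set R).
Local Notation T := (measurableTypeR R).
Implicit Types (f : R -> R) (e C x y th : R).
Hypothesis mu01 : mu `[0, 1[%classic = 1%E.
Hypothesis mu_osc : forall e, 0 < e -> exists M : nat, forall (n : int) th,
  (M <= `|n|)%N -> `|\int[mu]_y osc n th y| <= e.
Hypotheses (K0 : K !=set0) (Kc : closed K) (K01 : K `<=` `[0, 1[).

Lemma Rintegral_indic (A : set R) : measurable (A : set T) -> \int[mu]_x \1_A x = fine (mu A).
Proof. by move=> mA; rewrite /Rintegral integral_indic // setIT. Qed.

(** Inside [0,1) the tent differs from the indicator only off [K] at chord distance less than
    1/(j+1), and these sets decrease to the empty set. Tents are periodic and the indicator is not,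
    so the null complement of [0,1) is put into [B]. *)
Lemma tent_cvg e : 0 < e -> exists j (B : set R), [/\ measurable (B : set T), (mu B < e%:E)%E &
  forall x, `|\1_K x - tent K j x| <= \1_B x].
Proof.
move=> e0; pose I : set R := `[0, 1[%classic.
have mK : measurable (K : set T) by exact: closed_measurable.
have mI : measurable (I : set T) by apply: measurable_itv.
pose V j : set R := [set x | chord_dist K x < j.+1%:R^-1].
have mV j : measurable (V j : set T).
  have cf : continuous (chord_dist K) by exact: chord_lip_continuous ler01 (chord_dist_lip K0).
  rewrite (_ : V j = setT `&` chord_dist K @^-1` `]-oo, j.+1%:R^-1[%classic).
    exact: (continuous_measurable_fun cf).
  by rewrite setTI; apply/seteqP; split => x; rewrite /V /= in_itv.
have [j hj] : exists j, (mu ((V j `\` K) `&` I) < e%:E)%E.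
  apply: (@mu_decr_lt _ _ (fun j => (V j `\` K) `&` I)) => //.
  - by move=> j; apply: measurableI => //; exact: measurableD.
  - move=> n m nm x [[Vx nK] Ix]; split => //; split => //; apply: (lt_le_trans Vx).
    by rewrite lef_pV2 ?posrE ?ltr0n // ler_nat ltnS.
  apply/seteqP; split => // x h; have [[_ nKx] Ix] := h 0%N Logic.I.
  have d0 : 0 < chord_dist K x by apply: chord_dist_gt0 => //; move: Ix; rewrite /I /= in_itv.
  have [[hx _] _] := h (Num.truncn (chord_dist K x)^-1) Logic.I.
  have := truncnS_gt (chord_dist K x)^-1; rewrite invf_plt ?posrE ?ltr0n // => h2.
  by have := lt_trans hx h2; rewrite ltxx.
have mB : measurable ((V j `\` K) `&` I `|` ~` I : set T).
  apply: measurableU; last exact: measurableC.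
  by apply: measurableI => //; exact: measurableD.
exists j, ((V j `\` K) `&` I `|` ~` I); split => //.
  have nI : mu (~` I) = 0%E by have := probability_setC mu mI; rewrite mu01 subee.
  apply: (@le_lt_trans _ _ (mu ((V j `\` K) `&` I) + mu (~` I))%E).
    apply: measureU2; last exact: measurableC.
    by apply: measurableI => //; exact: measurableD.
  by rewrite [X in (_ + X)%E]nI adde0.
move=> x; rewrite !indicE; have [Kx|nKx] := pselect (K x).
  by rewrite tent_eq1 // mem_set // subrr normr0.
have /andP[t0 t1] := tent_itv K0 j x.
rewrite memNset // sub0r normrN ger0_norm //; case: (boolP (x \in _)) => //= /negP hB.
rewrite tent_eq0 // leNgt; apply/negP => Vx; apply: hB; apply: mem_set.
by have [Ix|nI] := pselect (I x); [left|right].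
Qed.

Lemma osc_null_indic C f : 0 <= C -> chord_lip C f -> osc_null mu (fun y => \1_K y * f y).
Proof.
move=> C0 h; pose A := `|f 0| + C.
have fA x : `|f x| <= A by exact: chord_lip_bounded.
have A0 : 0 <= A by rewrite addr_ge0.
have A1 : 0 < A + 1 by rewrite ltr_wpDl.
have mK : measurable (K : set T) by exact: closed_measurable.
have bf := bounded_mfun_chord_lip C0 h; have bK := bounded_mfun_indic mK.
apply: osc_null_approx; first exact: bounded_mfunM.
move=> e e0; have [j [B [mB Be hB]]] := tent_cvg (divr_gt0 e0 A1).
have bt : bounded_mfun (tent K j) by exact: bounded_mfun_chord_lip (ler0n _ _) (tent_lip K0 j).
exists (fun y => tent K j y * f y); split; first exact: bounded_mfunM.
  have t1 x : `|tent K j x| <= 1 by have /andP[t0 t1] := tent_itv K0 j x; rewrite ger0_norm.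
  apply: (osc_null_chord_lip mu_osc (C := j.+1%:R * A + 1 * C)).
    by rewrite addr_ge0 ?mulr_ge0.
  exact: chord_lipM (ler0n _ _) C0 t1 fA (tent_lip K0 j) h.
apply: (@le_trans _ _ (\int[mu]_x (A * \1_B x))).
  apply: Rintegral_le => [||x].
  - by apply: bounded_mfun_norm; apply: bounded_mfunB; exact: bounded_mfunM.
  - by apply: bounded_mfunM; [exact: bounded_mfun_cst|exact: bounded_mfun_indic].
  - by rewrite -mulrBl normrM mulrC ler_pM.
rewrite Rintegral_scale; last exact: bounded_mfun_indic.
rewrite Rintegral_indic //.
have hm : fine (mu B) <= e / (A + 1) by rewrite -lee_fin fineK ?fin_num_measure // ltW.
apply: (le_trans (ler_wpM2l A0 hm)); rewrite mulrCA ler_piMr ?(ltW e0) // ler_pdivrMr // mul1r lerDl //.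
Qed.

End closed_set_transform.

(** * The trigonometric series of the restricted measure *)

Section multiplicity.
Context {R : realType} (mu : probability (measurableTypeR R) R) (K : set R).
Local Notation T := (measurableTypeR R).
Local Open Scope complex_scope.
Implicit Types (f : R -> R) (e x y th : R).
Hypothesis mu01 : mu `[0, 1[%classic = 1%E.
Hypothesis mu_osc : forall e, 0 < e -> exists M : nat, forall (n : int) th,
  (M <= `|n|)%N -> `|\int[mu]_y osc n th y| <= e.
Hypotheses (Kc : closed K) (K01 : K `<=` `[0, 1[) (muK : (0 < mu K)%E).

Let mK : measurable (K : set T). Proof. exact: closed_measurable. Qed.

Let K0 : K !=set0.
Proof. by apply/set0P; apply/eqP => K0; move: muK; rewrite K0 measure0 ltxx. Qed.

Let bK : bounded_mfun (\1_K : R -> R). Proof. exact: bounded_mfun_indic. Qed.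

Let bKosc n th : bounded_mfun (fun y => \1_K y * osc n th y).
Proof. by apply: bounded_mfunM => //; exact: bounded_mfun_osc. Qed.

(* [restr_coef] is the Fourier transform, with the kernel e(-ny), of [mu]
   restricted to [K]. *)
Definition restr_mode n th : R := \int[mu]_y (\1_K y * osc n th y).
Definition restr_coef n : R[i] := restr_mode n 0 +i* - restr_mode n (- (pi / 2)).

Lemma restr_modeE n th :
  restr_mode n th = cos th * restr_mode n 0 - sin th * restr_mode n (- (pi / 2)).
Proof.
rewrite /restr_mode -!Rintegral_scale // -Rintegral_sub; last 2 first.
- by apply: bounded_mfunM => //; exact: bounded_mfun_cst.
- by apply: bounded_mfunM => //; exact: bounded_mfun_cst.
apply: eq_Rintegral => y _; rewrite /osc addr0 cosBpihalf [cos (_ + th)]cosD.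
move: (\1_K y) (cos _) (cos _) (sin _) (sin _) => *; ring.
Qed.

Lemma restr_modeN n th : restr_mode (- n) th = restr_mode n (- th).
Proof.
apply: eq_Rintegral => y _; rewrite /osc; congr (_ * _).
by rewrite -cosN mulrNz; congr cos; ring.
Qed.

(** The coefficients at n and -n are conjugate, so the pair is twice a real part, an oscillating
    integral whose phase carries [x]. *)
Lemma restr_coef_pair n x :
  restr_coef n * e2pi (n%:~R * x) + restr_coef (- n) * e2pi ((- n)%:~R * x) =
  (2 * restr_mode n (- (2 * pi * (n%:~R * x))))%:C.
Proof.
rewrite (restr_modeE n (- _)) /restr_coef !restr_modeN oppr0 opprK.
rewrite (restr_modeE n (pi / 2)) cos_pihalf sin_pihalf mul0r mul1r sub0r.
rewrite /e2pi mulrNz mulNr mulrN cosN sinN.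
move: (restr_mode _ _) (restr_mode _ _) (cos _) (sin _) => a b c s.
by apply/eqP; rewrite eq_complex /=; apply/andP; split; apply/eqP; ring.
Qed.

Lemma trig_partial_sumS (a : int -> R[i]) x M : trig_partial_sum a x M.+1 =
  trig_partial_sum a x M + (a M.+1%:Z * e2pi (M.+1%:Z%:~R * x) +
    a (- M.+1%:Z) * e2pi ((- M.+1%:Z)%:~R * x)).
Proof.
rewrite /trig_partial_sum (_ : (2 * M.+1).+1 = (2 * M).+3); last by lia.
rewrite big_ord_recl big_ord_recr /= sub0r.
rewrite (_ : bump 0 (2 * M).+1 = (2 * M).+2) //.
have -> : (2 * M).+2%:Z - M.+1%:Z = M.+1%:Z by lia.
rewrite [LHS]addrC -[LHS]addrA; congr (_ + _).
apply: eq_bigr => k _; rewrite (_ : (bump 0 k)%:Z - M.+1%:Z = k%:Z - M%:Z) //.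
by rewrite /bump /=; lia.
Qed.

Variables (x d : R).
Hypotheses (d0 : 0 < d) (Kd : forall y, K y -> d <= chord x y ^+ 2).

(** On [K] this is sin(pi (x - y))^2, half the denominator 1 - cos of the Dirichlet kernel; the
    truncation at [d] makes its inverse bounded and chord-Lipschitz everywhere. *)
Definition dirichlet_denom y : R := Num.max d (chord x y ^+ 2).

Lemma dirichlet_denom_on y : K y -> dirichlet_denom y = chord x y ^+ 2.
Proof. by move=> Ky; apply/max_idPr; exact: Kd. Qed.

Lemma chord_lip_dirichlet_denom : chord_lip (2 / d ^+ 2) (fun y => (2 * dirichlet_denom y)^-1).
Proof.
move=> y z; have p (w : R) : d <= dirichlet_denom w by rewrite le_max lexx.
have lip : `|dirichlet_denom y - dirichlet_denom z| <= 2 * chord y z.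
  have h : `|chord x y ^+ 2 - chord x z ^+ 2| <= 2 * chord y z.
    have h1 := chord_triangle x y z; have h2 := chord_triangle x z y.
    rewrite (chordC z y) in h2; rewrite subr_sqr normrM mulrC; apply: ler_pM => //.
      rewrite ger0_norm ?addr_ge0 ?chord_ge0 //.
      by have := chord_le1 x y; have := chord_le1 x z; rewrite -/(chord x y) => u v; lra.
    by rewrite ler_norml; apply/andP; split; lra.
  apply: (le_trans _ h); rewrite /dirichlet_denom.
  move: (chord x y ^+ 2) (chord x z ^+ 2) => a b.
  rewrite ler_norml; have := ler_norm (a - b); have := ler_norm (b - a); rewrite (distrC b a) => h1 h2.
  have h3 := normr_ge0 (a - b).
  by rewrite /Num.max; case: ltP => ha; case: ltP => hb; apply/andP; split; lra.
have py := lt_le_trans d0 (p y); have pz := lt_le_trans d0 (p z).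
have -> : (2 * dirichlet_denom y)^-1 - (2 * dirichlet_denom z)^-1 =
    (dirichlet_denom z - dirichlet_denom y) / (2 * (dirichlet_denom y * dirichlet_denom z)).
  by field; rewrite !gt_eqF.
rewrite normrM distrC; have dd : 0 < d ^+ 2 by rewrite exprn_gt0.
rewrite (@ger0_norm _ (_^-1)) ?invr_ge0 ?mulr_ge0 ?(ltW py) ?(ltW pz) //.
apply: (le_trans (ler_pM (normr_ge0 _) _ lip (_ : _ <= (d ^+ 2)^-1))).
- by rewrite invr_ge0 !mulr_ge0 ?(ltW py) ?(ltW pz).
- rewrite lef_pV2 ?posrE ?mulr_gt0 // expr2.
  have : d * d <= dirichlet_denom y * dirichlet_denom z by apply: ler_pM; rewrite ?p // ltW.
  have : 0 < d * d by rewrite mulr_gt0.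
  move: (d * d) (dirichlet_denom y * _) => *; lra.
by rewrite mulrAC.
Qed.

Let f y := (2 * dirichlet_denom y)^-1.
Let th (M : nat) : R := - (2 * pi * (M%:Z%:~R * x)).

(* With [D_M] the Dirichlet kernel,
   [D_M(t) (1 - cos (2 pi t)) = cos (2 pi M t) - cos (2 pi (M + 1) t)]. *)
Lemma trig_partial_sum_restr M : trig_partial_sum restr_coef x M =
  (\int[mu]_y (\1_K y * f y * osc M (th M) y - \1_K y * f y * osc M.+1 (th M.+1) y))%:C.
Proof.
have bf : bounded_mfun f.
  by apply: (bounded_mfun_chord_lip _ chord_lip_dirichlet_denom); rewrite divr_ge0 ?sqr_ge0.
have bF M' t : bounded_mfun (fun y => \1_K y * f y * osc M' t y).
  by apply: bounded_mfunM; [exact: bounded_mfunM|exact: bounded_mfun_osc].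
have oE (n : nat) y : osc n (th n) y = cos (n%:R * (2 * pi * (x - y))).
  rewrite /osc /th -cosN; congr cos; rewrite -pmulrn; move: (pi : R) (n%:R : R) => p c; ring.
have fE y : K y -> f y * (1 - cos (2 * pi * (x - y))) = 1.
  move=> Ky; rewrite -chord_sqr /f -dirichlet_denom_on // mulVf //.
  rewrite mulf_neq0 // gt_eqF // (lt_le_trans d0) // le_max lexx //.
elim: M => [|M IH].
  rewrite /trig_partial_sum big_ord1 subrr /e2pi mul0r mulr0 cos0 sin0.
  rewrite /restr_coef (_ : restr_mode 0 (- _) = 0); last first.
    rewrite /restr_mode -[RHS](Rintegral_const mu); apply: eq_Rintegral => y _.
    by rewrite /osc mul0r mulr0 add0r cosN cos_pihalf mulr0.
  have -> : restr_mode 0 0 = \int[mu]_y (\1_K y * f y * osc 0 (th 0) y - \1_K y * f y * osc 1 (th 1) y).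
    apply: eq_Rintegral => y _; rewrite !oE /osc !mul0r mulr0 addr0 cos0 mul1r !mulr1.
    rewrite indicE; case: (boolP (y \in K)) => [|_]; last by rewrite !mul0r subrr.
    by rewrite inE => /fE; rewrite !mul1r mulrBr mulr1 => ->.
  by apply/eqP; rewrite eq_complex /=; apply/andP; split; apply/eqP; ring.
rewrite trig_partial_sumS IH restr_coef_pair -rmorphD /=; congr (_ %:C).
rewrite -Rintegral_scale // -Rintegral_add; last 2 first.
- exact: bounded_mfunB.
- by apply: bounded_mfunM => //; exact: bounded_mfun_cst.
apply: eq_Rintegral => y _; rewrite -/(th M.+1) !oE.
rewrite indicE; case: (boolP (y \in K)) => [|_]; last by rewrite !mul0r subrr mulr0 addr0.
rewrite inE => /fE; rewrite !mul1r.
set t := 2 * pi * (x - y) => h.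
have c2 : cos (M.+2%:R * t) + cos (M%:R * t) = 2 * cos (M.+1%:R * t) * cos t.
  have -> : M.+2%:R * t = M.+1%:R * t + t :> R by rewrite -[M.+2%:R]natr1; ring.
  have -> : M%:R * t = M.+1%:R * t - t :> R by rewrite -[M.+1%:R]natr1; ring.
  by rewrite cosD cosB; ring.
have -> : cos (M.+2%:R * t) = 2 * cos (M.+1%:R * t) * cos t - cos (M%:R * t) by rewrite -c2 addrK.
move: h; move: (cos (M%:R * t)) (cos (M.+1%:R * t)) (cos t) (f y) => a b c u h.
have : 2 * b * (u * (1 - c)) = 2 * b by rewrite h mulr1.
lra.
Qed.

(** Both terms of the closed form are oscillating integrals of one fixed function, with phases that
    vary with M; the uniformity in [osc_null] covers them. *)
Lemma trig_partial_sum_restr_cvg :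
  trig_partial_sum restr_coef x M @[M --> \oo] --> (0 : R[i]^o).
Proof.
have bf : bounded_mfun f.
  by apply: (bounded_mfun_chord_lip _ chord_lip_dirichlet_denom); rewrite divr_ge0 ?sqr_ge0.
have bF M' t : bounded_mfun (fun y => \1_K y * f y * osc M' t y).
  by apply: bounded_mfunM; [exact: bounded_mfunM|exact: bounded_mfun_osc].
have nf : osc_null mu (fun y => \1_K y * f y).
  by apply: (osc_null_indic mu01 mu_osc K0 Kc K01 _ chord_lip_dirichlet_denom); rewrite divr_ge0 ?sqr_ge0.
apply: (@cvgrPdist_lt _ (R[i]^o : normedModType R[i]) _ _ _ (trig_partial_sum restr_coef x) 0).2 => -[e e']; rewrite ltcE /= => /andP[/eqP -> e0].
have [N hN] := nf _ (divr_gt0 e0 (ltr0n R 3)).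
exists N => // M /= NM; rewrite sub0r normrN trig_partial_sum_restr.
rewrite normc_def /= expr0n addr0 sqrtr_sqr ltcR Rintegral_sub //.
have h1 := hN M (th M) NM; have h2 := hN M.+1 (th M.+1) (leqW NM).
apply: (le_lt_trans (ler_normB _ _)); apply: (le_lt_trans (lerD h1 h2)); lra.
Qed.

End multiplicity.

Lemma not_uniqueness (R : realType) (mu : probability (measurableTypeR R) R) (E : set R) :
  mu `[0, 1[%classic = 1%E ->
  (forall e : R, 0 < e -> exists M : nat, forall (n : int) (th : R),
    (M <= `|n|)%N -> `|\int[mu]_y osc n th y| <= e) ->
  E `<=` `[0, 1[ -> measurable (E : set (measurableTypeR R)) -> (0 < mu E)%E ->
  ~ set_of_uniqueness E.
Proof.
move=> mu01 mu_osc E01 mE muE [_ uE].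
have [K [Kc KE muK]] := inner_regular mE muE.
have K01 := subset_trans KE E01.
have mK : measurable (K : set (measurableTypeR R)) by exact: closed_measurable.
have K0 : K !=set0.
  by apply/set0P; apply/eqP => K0; move: muK; rewrite K0 measure0 ltxx.
have : restr_coef mu K 0 = 0.
  apply: uE => x [x01 nEx].
  have x01' : 0 <= x < 1 by move: x01; rewrite /= in_itv.
  have d0 := chord_dist_gt0 K0 Kc K01 x01' (fun Kx => nEx (KE x Kx)).
  apply: (trig_partial_sum_restr_cvg mu01 mu_osc Kc K01 muK (exprn_gt0 2 d0)) => y Ky.
  rewrite ler_sqr ?nnegrE ?chord_ge0 ?chord_dist_ge0 //; exact: chord_dist_le.
move=> /(congr1 (@complex.Re R)) /=; rewrite /restr_mode.
have -> : \int[mu]_y (\1_K y * osc 0 0 y) = \int[mu]_y \1_K y.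
  by apply: eq_Rintegral => y _; rewrite /osc mul0r mulr0 addr0 cos0 mulr1.
rewrite Rintegral_indic // => h; move: muK.
by rewrite -[mu K]fineK ?fin_num_measure // h ltxx.
Qed.

Local Open Scope complex_scope.

Lemma riesz_osc (R : realType) (mu : probability (measurableTypeR R) R) :
  (forall th m n, (`|n| <= scaleR m)%N ->
    \int[mu]_x cos (2 * pi * (n%:~R * x) + th) = cos th * rcoef m n) ->
  forall e : R, 0 < e -> exists M : nat, forall (n : int) th,
    (M <= `|n|)%N -> `|\int[mu]_y osc n th y| <= e.
Proof.
move=> mu_mode e e0; have [M hM] := eventually_weight_lt e0.
exists M => n th /hM[i /andP[h1 h2] wi].
rewrite /osc (mu_mode _ _ _ h2) normrM; apply: le_trans (ltW wi).
by apply: le_trans (rcoef_le_weight h1); rewrite ler_piMl // cos_max.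
Qed.

Theorem theorem1p1 (R : realType) :
  (exists mu : probability (measurableTypeR R) R,
    [/\ mu `[0%R, 1%R[%classic = 1%E,
        measurable (normal_odd_not_even R `&` `[0%R, 1%R[
                    : set (measurableTypeR R)),
        mu (normal_odd_not_even R `&` `[0%R, 1%R[) = 1%E,
        rajchman mu &
        forall kappa : R, 0 < kappa ->
          exists2 C : R, 0 < C &
            forall n : int, C <= `|n|%:~R ->
              `|fourier_coef mu n| <=
                (ln (ln (`|n|%:~R : R)) `^ (-1 + kappa))%:C]) /\
  set_of_multiplicity (normal_odd_not_even R `&` `[0, 1[).
Proof.
have [mu [mu01 mu_mode]] := @riesz_measure R.
have mE : measurable (normal_odd_not_even R `&` `[0, 1[ : set (measurableTypeR R)).
  by apply: measurableI; [exact: measurable_odd_not_even|exact: measurable_itv].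
have E1 := normal_odd_not_even_mu mu01 mu_mode.
have mu_osc := riesz_osc mu_mode.
split.
  exists mu; split => //; [exact: rajchman_mu mu01 mu_mode|exact: fourier_decay mu01 mu_mode].
have E01 : normal_odd_not_even R `&` `[0, 1[ `<=` `[0, 1[ by move=> x [].
split => //; apply: (not_uniqueness mu01 mu_osc E01 mE).
by rewrite [ltRHS]E1.
Qed.
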